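(* Let $\alpha_1<\alpha_2$ be fixed in $(0,d)$, let $n=n(N)$ be any integer-valued function of $N$ satisfying $n(N)\in[N^{\alpha_1},N^{\alpha_2}]$, and let $K\subset\mathbb Z^d$ be finite. Then $$\lim_{N\to\infty}\frac{N^d}{n}P[\mathrm{Range}(\mathcal S^{n,N})\cap\varphi(K)\ne\emptyset]=\mathrm{BCap}(K),$$ where $\mathcal S^{n,N}$ is the tree-indexed random walk with size $n$ and a uniform starting point in $\mathbb T_N$.
   Context: Setting: $d\ge 5$; $\mathbb N=\{0,1,2,\dots\}$. $\mu$ is a probability measure on $\mathbb N$ with mean one, not the Dirac mass at $1$, with finite exponential moments ($\sum_i c^i\mu(i)<\infty$ for some $c>1$) and span $1$ ($\gcd\{i:\mu(i)>0\}=1$). $\theta$ is a symmetric, aperiodic probability measure on $\mathbb Z^d$ with finite range (finite support), not supported on any strict subgroup of $\mathbb Z^d$. The size-biased law is $\tilde\mu(k)=k\mu(k)$. Torus and tree-indexed walk: $\mathbb T_N=(\mathbb Z/N\mathbb Z)^d$ and $\varphi=\varphi_N:\mathbb Z^d\to\mathbb T_N$ is the canonical projection mod $N$. $\mathbf T^n$ is the Galton–Watson plane tree with offspring law $\mu$ conditioned to have $n$ vertices. $\mathcal S^{n,N}$ is the random map from the vertices of $\mathbf T^n$ to $\mathbb T_N$ such that the root is mapped to a uniform point of $\mathbb T_N$ and, conditionally on the tree, the increments along edges are independent with the law of $\varphi(\xi)$, $\xi\sim\theta$ (and independent of the root position). $\mathrm{Range}$ denotes the image. Branching capacity. Let $\mathbf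 T^{\mathrm v}$ be the following random infinite plane (rooted ordered) tree, in which every non-root vertex is normal or special. The root produces $i\ge 1$ children with probability $\mu(i-1)$; the last child is special, the others are normal. A normal vertex produces only normal children, their number having law $\mu$. A special vertex produces a number of children with law $\tilde\mu$; one of them, chosen uniformly at random, is special, the others are normal. All choices are independent. The infinite path formed by the root and the special vertices is the spine. The past of the root is the set of vertices $v$ such that, for some non-root spine vertex $s$ with next spine vertex $s'$, either $v=s$ or $v$ is a descendant of (or equal to) a child of $s$ that comes after $s'$ in the order of the children of $s$. The random walk indexed by $\mathbf T^{\mathrm v}$ started at $x\in\mathbb Z^d$ is the random map $\mathcal S:\mathbf T^{\mathrm v}\to\mathbb Z^d$ with $\mathcal S(\text{root})=x$ and, conditionally on the tree, independent $\theta$-distributed increments along edges. For finite $K\subset\mathbb Z^d$ and $x\in K$, $\mathrm{Es}_K(x)$ is the probability that no vertex of the past of the root is mapped into $K$ when the walk is started at $x$; and $\mathrm{BCap}(K)=\sum_{x\in K}\mathrm{Es}_K(x)$. *)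

(* Defs.v *)
From HB Require Import structures.
From mathcomp Require Import all_boot all_order all_algebra.
From mathcomp Require Import finmap.
From mathcomp Require Import all_classical all_reals all_analysis.

Set Implicit Arguments.
Unset Strict Implicit.
Unset Printing Implicit Defensive.

Import Order.TTheory GRing.Theory Num.Theory.
Import numFieldNormedType.Exports.

Local Open Scope classical_set_scope.
Local Open Scope ring_scope.

(* Probability measures on the countable sets nat and Z^d = 'rV[int]_d are
   represented by their mass functions. *)

Definition is_set_gcd (A : set nat) (g : nat) : Prop :=
  (forall i, A i -> (g %| i)%N) /\
  (forall k, (forall i, A i -> (k %| i)%N) -> (k %| g)%N).

Record offspring_law (R : realType) (mu : nat -> R) : Prop := OffspringLaw {
  offspring_ge0 : forall i, 0 <= mu i;
  offspring_sum : (\sum_(0 <= i <oo) (mu i)%:E = 1)%E;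
  offspring_mean : (\sum_(0 <= i <oo) (i%:R * mu i)%:E = 1)%E;
  offspring_not_dirac1 : mu 1%N != 1;
  offspring_exp_moment :
    exists2 c : R, 1 < c & (\sum_(0 <= i <oo) (c ^+ i * mu i)%:E < +oo)%E;
  offspring_span1 : is_set_gcd [set i | 0 < mu i] 1 }.

Definition size_biased (R : realType) (mu : nat -> R) (k : nat) : R :=
  k%:R * mu k.

(* The n-fold convolution power of theta, that is, the law at time n of the
   theta-random walk started at 0. *)
Fixpoint step_power (R : realType) (d : nat) (theta : 'rV[int]_d -> R)
    (n : nat) (x : 'rV[int]_d) : R :=
  if n is m.+1
  then \sum_(y \in [set: 'rV[int]_d]) theta y * step_power theta m (x - y)
  else (x == 0)%:R.

Record step_law (R : realType) (d : nat) (theta : 'rV[int]_d -> R) : Prop :=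
  StepLaw {
    step_ge0 : forall x, 0 <= theta x;
    step_finite_range : finite_set [set x | theta x != 0];
    step_sum : \sum_(x \in [set: 'rV[int]_d]) theta x = 1;
    step_sym : forall x, theta (- x) = theta x;
    step_aperiodic :
      is_set_gcd [set n | (0 < n)%N /\ 0 < step_power theta n 0] 1;
    step_generates : forall G : {pred 'rV[int]_d}, zmod_closed G ->
      (forall x, theta x != 0 -> x \in G) -> forall x, x \in G }.

(* Vertices of plane trees are Ulam-Harris words: the root is [::] and the
   children of u, in order, are rcons u 0, rcons u 1, ... *)
Definition parent (v : seq nat) : seq nat := take (size v).-1 v.

(* The increment along the edge from [parent v] to v is [xi v]; the value of xi
   at the root is not used. *)
Definition walk (V : zmodType) (x : V) (xi : seq nat -> V) (u : seq nat) : V :=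
  x + \sum_(1 <= m < (size u).+1) xi (take m u).

Definition plane_tree (t : {fset seq nat}) : Prop :=
  [::] \in t /\
  (forall u i, rcons u i \in t ->
     u \in t /\ forall j, (j < i)%N -> rcons u j \in t).

Definition nb_children (t : {fset seq nat}) (u : seq nat) : nat :=
  #|` [fset v in t | (v != [::]) && (parent v == u)]%fset |.

Definition gw_law (R : realType) (mu : nat -> R) (t : {fset seq nat}) : R :=
  \prod_(u <- t) mu (nb_children t u).

Definition plane_trees (n : nat) : set {fset seq nat} :=
  [set t | plane_tree t /\ #|` t| = n].

(* Equal to 0 by convention for those (finitely many) n such that no tree with n
   vertices has positive probability. *)
Definition cond_gw_law (R : realType) (mu : nat -> R) (n : nat)
    (t : {fset seq nat}) : R :=
  gw_law mu t / \sum_(t' \in plane_trees n) gw_law mu t'.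

(* Since 'Z_N is Z/2Z when N < 2, this is (Z/NZ)^d only for N >= 2. *)
Notation torus d N := 'rV['Z_N]_d.

Definition torus_proj (d N : nat) (x : 'rV[int]_d) : torus d N :=
  map_mx (intr : int -> 'Z_N) x.

Definition torus_step (R : realType) (d N : nat) (theta : 'rV[int]_d -> R)
    (y : torus d N) : R :=
  \sum_(x \in [set x | torus_proj N x = y]) theta x.

Definition ext0 (t : {fset seq nat}) (V : zmodType) (xi : {ffun t -> V})
    (v : seq nat) : V :=
  oapp xi 0 (insub v).

Definition tree_range (t : {fset seq nat}) (V : zmodType) (S : seq nat -> V) :
    {fset V} :=
  [fset S u | u in t]%fset.

(* Conditionally on the tree t, the root position x is uniform and the
   increments xi, indexed by the non-root vertices of t, are independent with
   law [torus_step theta]. *)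
Definition hit_prob_given_tree (R : realType) (d N : nat)
    (theta : 'rV[int]_d -> R) (K : {fset 'rV[int]_d}) (t : {fset seq nat}) : R :=
  \sum_(x : torus d N) \sum_(xi : {ffun (t `\ [::])%fset -> torus d N})
    ((tree_range t (walk x (ext0 xi)) `&` [fset torus_proj N y | y in K])%fset
       != fset0)%:R
    * (#|{: torus d N}|%:R^-1 * \prod_v torus_step theta (xi v)).

(* P[Range(S^{n,N}) meets phi(K)] *)
Definition hit_prob (R : realType) (d : nat) (mu : nat -> R)
    (theta : 'rV[int]_d -> R) (n N : nat) (K : {fset 'rV[int]_d}) : R :=
  \sum_(t \in plane_trees n)
    cond_gw_law mu n t * hit_prob_given_tree N theta K t.

(* Independent choices from which the infinite tree and the walk indexed by it
   are built. [normal_nb u] is the number of children of u if u is normal, and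
   that number minus one if u is the root. [special_nb u] is the number of
   children of u if u is special, and [special_idx u] the index of the special
   one among them. [incr u] is the increment along the edge from [parent u]
   to u. Any realization on any probability space is allowed: [BCap] below
   depends only on their joint law. *)
Record branching_env (disp : measure_display) (Omega : measurableType disp)
    (R : realType) (P : probability Omega R) (d : nat) (mu : nat -> R)
    (theta : 'rV[int]_d -> R) := BranchingEnv {
  normal_nb : seq nat -> Omega -> nat;
  special_nb : seq nat -> Omega -> nat;
  special_idx : seq nat -> Omega -> nat;
  incr : seq nat -> Omega -> 'rV[int]_d;
  special_pair := fun u w => (special_nb u w, special_idx u w);
  env_measurable_normal : forall u (B : set nat),
    measurable (normal_nb u @^-1` B);
  env_measurable_special : forall u (B : set (nat * nat)),
    measurable (special_pair u @^-1` B);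
  env_measurable_incr : forall u (B : set 'rV[int]_d),
    measurable (incr u @^-1` B);
  env_law_normal : forall u k, P (normal_nb u @^-1` [set k]) = (mu k)%:E;
  env_law_special : forall u k j, P (special_pair u @^-1` [set (k, j)]) =
    (if (j < k)%N then size_biased mu k * k%:R^-1 else 0)%:E;
  env_law_incr : forall u x, P (incr u @^-1` [set x]) = (theta x)%:E;
  env_independent : forall (J : {fset seq nat}) (A : seq nat -> set nat)
      (B : seq nat -> set (nat * nat)) (C : seq nat -> set 'rV[int]_d),
    P (\bigcap_(u in [set` J]) (normal_nb u @^-1` A u
         `&` special_pair u @^-1` B u `&` incr u @^-1` C u)) =
    (\prod_(u <- J) (P (normal_nb u @^-1` A u) * P (special_pair u @^-1` B u)
                     * P (incr u @^-1` C u)))%E }.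

Section InfiniteTree.
Context (disp : measure_display) (Omega : measurableType disp) (R : realType)
  (P : probability Omega R) (d : nat) (mu : nat -> R)
  (theta : 'rV[int]_d -> R) (E : branching_env P mu theta).

(* The root has [(normal_nb E [::] w).+1] children, the last one being
   special. *)
Fixpoint spine (w : Omega) (m : nat) : seq nat :=
  match m with
  | 0 => [::]
  | 1 => [:: normal_nb E [::] w]
  | m'.+1 => rcons (spine w m') (special_idx E (spine w m') w)
  end.

Definition is_special (w : Omega) (u : seq nat) : bool :=
  (u != [::]) && (u == spine w (size u)).

Definition inf_nb_children (w : Omega) (u : seq nat) : nat :=
  if u == [::] then (normal_nb E u w).+1
  else if is_special w u then special_nb E u w
  else normal_nb E u w.

Definition inf_tree (w : Omega) : set (seq nat) :=
  [set u | forall i, (i < size u)%N ->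
     (nth 0%N u i < inf_nb_children w (take i u))%N].

(* Membership of v in the tree forces [rcons s j] to be an actual child of s. *)
Definition past (w : Omega) : set (seq nat) :=
  [set v | inf_tree w v /\ exists m, let s := spine w m.+1 in
     v = s \/
     exists2 j, (special_idx E s w < j)%N & prefix (rcons s j) v].

Definition escape_prob (K : {fset 'rV[int]_d}) (x : 'rV[int]_d) : R :=
  fine (P [set w | forall v, past w v ->
                     walk x (fun u => incr E u w) v \notin K]).

Definition BCap (K : {fset 'rV[int]_d}) : R :=
  \sum_(x <- K) escape_prob K x.

End InfiniteTree.

(* Main.v *)
(* Let X mark the number of vertices and let W n 1 be the probability that a walk with step law mu
   is at n - 1 at time n, so that n [X^n] T = W n 1 for the generating function T of the trees. The
   hitting probabilities of K from the points y of the torus have generating functions [HitS y],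
   given by a linear equation over the step operator. As theta is symmetric this operator is
   self-adjoint, and the sum of the [HitS y] over y equals the sum over x in phi(K) of T * S(x),
   where S(x) counts the trees hung along a path from x that avoid phi(K) afterwards. The claim thus
   becomes [X^n] (T * S(x)) / W n 1 --> Es_K(x).

   Let S_b(x) ignore the returns to phi(K) at tree distance more than b from x. For fixed b the walk
   does not see the torus when N is large, and the local limit W (n - a) L / W n 1 --> 1 gives
   [X^n] (T * S_b(x)) / W n 1 --> G_b(x), the probability that the vertices of the past of the root
   up to level b avoid K; G_b(x) decreases to Es_K(x). The difference S_b - S is at most the sum
   over j > b of the probability that the walk is in phi(K) at time j, of order j^(-d/2) + N^(-d),
   times the weight of the pairs of vertices at distance j, of order j for j <= n / 2 and of order n
   after summation over all j. Since d >= 5 and n N^(-d) --> 0, it vanishes as n, then b, go to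
   infinity. *)

From HB Require Import structures.
Require Import Defs.
From mathcomp Require Import all_boot all_order all_algebra.
From mathcomp Require Import finmap.
From mathcomp Require Import all_classical all_reals all_analysis.
From mathcomp Require Import zify ring lra.
Set Implicit Arguments.
Unset Strict Implicit.
Unset Printing Implicit Defensive.
Import Order.TTheory GRing.Theory Num.Theory.
Import numFieldNormedType.Exports.
Local Open Scope classical_set_scope.
Local Open Scope ring_scope.

(** * Formal power series *)

(** No Gaussian asymptotics enter. The ratio limit for [Wd] only needs neighbouring values to differ
    by O(1/n) while the values themselves are at least c / sqrt n. Both facts come from splitting a
    binomial component off a power of [mu], so that binomial coefficients supply all explicit
    estimates. The torus heat kernel is bounded by the same device, with one binomial walk in each
    of d independent directions.

    Everything about trees is an identity or a coefficientwise inequality between formal series; no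
    radius of convergence or singularity occurs. The size is conditioned on by dividing by W n 1.
    Products are controlled by asking for bounds and limits of the coefficients of T^L kap for all L
    at once, because each further free subtree brings one more factor T.

    The choices are made in the order b, n, N: for fixed b the limit in n concerns series on Z^d, in
    which N does not occur, and the distance between S_b and S is bounded by a quantity explicit in
    b, n and N. *)

Definition fps (R : Type) := nat -> R.

HB.instance Definition _ (R : zmodType) :=
  GRing.Zmodule.copy (fps R) (nat -> R).

Section FpsRing.
Context (R : comNzRingType).
Implicit Types f g h : fps R.

Definition fps_mul f g : fps R := fun k => \sum_(i < k.+1) f i * g (k - i)%N.
Definition fps_one : fps R := fun k => (k == 0%N)%:R.

(** Coefficients of a product up to degree n depend only on those of the factors up to n, so
    associativity and commutativity are inherited from polynomials by truncation. *)
Let tp n f : {poly R} := \poly_(i < n.+1) f i.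

Let tpE n f k : (k <= n)%N -> (tp n f)`_k = f k.
Proof. by move=> kn; rewrite coef_poly ltnS kn. Qed.

Let fps_mulE n f g k : (k <= n)%N -> fps_mul f g k = (tp n f * tp n g)`_k.
Proof.
move=> kn; rewrite coefM; apply: eq_bigr => i _.
by rewrite !tpE ?(leq_trans (leq_subr _ _)) // (leq_trans _ kn) // -ltnS.
Qed.

Let mulA : associative fps_mul.
Proof.
move=> f g h; apply/funext => k.
have -> : fps_mul f (fps_mul g h) k = (tp k f * (tp k g * tp k h))`_k.
  rewrite coefM; apply: eq_bigr => i _.
  by rewrite tpE -1?ltnS // (fps_mulE (n := k)) // leq_subr.
rewrite mulrA coefM; apply: eq_bigr => i _.
by rewrite tpE ?leq_subr // (fps_mulE (n := k)) // -ltnS.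
Qed.

Let mulC : commutative fps_mul.
Proof. by move=> f g; apply/funext => k; rewrite !(fps_mulE (n := k)) // mulrC. Qed.

Let mul1 : left_id fps_one fps_mul.
Proof.
move=> f; apply/funext => k; rewrite /fps_mul big_ord_recl /= subn0 mul1r.
by rewrite big1 ?addr0 // => i _; rewrite /fps_one /= mul0r.
Qed.

Let mulD : left_distributive fps_mul +%R.
Proof.
move=> f g h; apply/funext => k; rewrite /fps_mul.
rewrite -[RHS]/(_ + _) -big_split /=; apply: eq_bigr => i _.
by rewrite -mulrDl.
Qed.

Let one_neq0 : fps_one != 0.
Proof.
apply/eqP => /(congr1 (fun f => f 0%N)) /= /eqP.
by rewrite /fps_one /= oner_eq0.
Qed.

HB.instance Definition _ := GRing.Zmodule_isComNzRing.Build (fps R)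
  mulA mulC mul1 mulD one_neq0.

Lemma fpsM f g k : (f * g) k = \sum_(i < k.+1) f i * g (k - i)%N.
Proof. by []. Qed.

Lemma fpsD f g k : (f + g) k = f k + g k. Proof. by []. Qed.

Lemma fpsB f g k : (f - g) k = f k - g k. Proof. by []. Qed.

Lemma fps1 k : (1 : fps R) k = (k == 0%N)%:R.
Proof. by []. Qed.

Lemma fps_sum (I : Type) (r : seq I) (P : pred I) (F : I -> fps R) k :
  (\sum_(i <- r | P i) F i) k = \sum_(i <- r | P i) F i k.
Proof. by elim/big_rec2: _ => // i x f _ <-. Qed.

Lemma fpsMn f m k : (f *+ m) k = f k *+ m.
Proof. by elim: m => // m IH; rewrite !mulrS -IH. Qed.

Definition fX : fps R := fun k => (k == 1%N)%:R.

Lemma fXM0 f : (fX * f) 0%N = 0.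
Proof. by rewrite fpsM big_ord1 /fX mul0r. Qed.

Lemma fXMS f k : (fX * f) k.+1 = f k.
Proof.
rewrite fpsM big_ord_recl {1}/fX /= mul0r add0r big_ord_recl /= {1}/fX /= mul1r.
rewrite subSS subn0 big1 ?addr0 // => i _.
by rewrite /fX /bump /= mul0r.
Qed.

Definition fC (a : R) : fps R := fun k => a *+ (k == 0%N).

Lemma fCM a f k : (fC a * f) k = a * f k.
Proof.
rewrite fpsM big_ord_recl /= subn0 /fC /= big1 ?addr0 // => i _.
by rewrite /= mulr0n mul0r.
Qed.

Lemma fMC a f g k : (f * (fC a * g)) k = a * (f * g) k.
Proof. by rewrite mulrCA fCM. Qed.

Lemma fC_nat n : fC n%:R = n%:R.
Proof.
by apply/funext => k; rewrite fpsMn fps1 /fC; case: (k == _); rewrite ?mulr0n ?mul0rn.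
Qed.

Lemma fnM n f k : (n%:R * f) k = n%:R * f k.
Proof. by rewrite -fC_nat fCM. Qed.

Lemma fC1 : fC 1 = 1. Proof. by []. Qed.

Lemma fC_is_monoid_morphism : {morph fC : a b / a * b}.
Proof.
by move=> a b; apply/funext => k; rewrite fCM /fC mulrnAr.
Qed.

(* [fX ^+ m] divides [f] *)
Definition ford m f := forall k, (k < m)%N -> f k = 0.

Lemma ford0 f : ford 0 f. Proof. by []. Qed.

Lemma fordM m n f g : ford m f -> ford n g -> ford (m + n) (f * g).
Proof.
move=> fm gn k kmn; rewrite fpsM big1 // => i _.
have [im|mi] := ltnP i m; first by rewrite fm ?mul0r.
by rewrite gn ?mulr0 //; have := ltn_ord i; lia.
Qed.

Lemma fordW m n f : (n <= m)%N -> ford m f -> ford n f.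
Proof. by move=> nm fm k kn; apply: fm; apply: leq_trans nm. Qed.

Lemma fordMl m f g : ford m g -> ford m (f * g).
Proof. by move=> gm; rewrite -[m]add0n; apply: fordM. Qed.

Lemma fordMr m f g : ford m f -> ford m (f * g).
Proof. by rewrite mulrC; apply: fordMl. Qed.

Lemma fordX f n : ford 1 f -> ford n (f ^+ n).
Proof.
move=> f1; elim: n => [|n IH]; first exact: ford0.
by rewrite exprS -add1n; apply: fordM.
Qed.

Lemma fordfX : ford 1 fX.
Proof. by case. Qed.

(* The condition makes every coefficient of the infinite sum [fsumm u] a finite
   sum; the terms that matter below have order at least c - 2. *)
Definition summable (u : nat -> fps R) := forall c, ford c.-2 (u c).

Definition fsumm (u : nat -> fps R) : fps R := fun k => \sum_(c < k.+3) u c k.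

Lemma fsummE u m k : summable u -> (k.+2 < m)%N -> fsumm u k = \sum_(c < m) u c k.
Proof.
move=> su km; rewrite /fsumm (big_ord_widen m (fun c => u c k)) //.
rewrite [RHS](bigID (fun c : 'I_m => (c < k.+3)%N)) /=.
rewrite [X in _ = _ + X]big1 ?addr0 // => c.
by rewrite -leqNgt => kc; apply: su; case: (c : nat) kc => // -[].
Qed.

Lemma summableC (a : nat -> R) u : summable u -> summable (fun c => fC (a c) * u c).
Proof. by move=> su c; apply: fordMl. Qed.

Lemma fsummM g u : summable u -> g * fsumm u = fsumm (fun c => g * u c).
Proof.
move=> su; apply/funext => k; rewrite {2}/fsumm.
under [RHS]eq_bigr do rewrite fpsM.
rewrite fpsM exchange_big /=; apply: eq_bigr => i _.
rewrite (fsummE (m := k.+3) su) ?mulr_sumr //.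
by rewrite !ltnS leq_subr.
Qed.

Lemma fsummB u v : fsumm u - fsumm v = fsumm (fun c => u c - v c).
Proof.
by apply/funext => k; rewrite fpsB /fsumm -sumrB.
Qed.

Lemma eq_fsumm u v : u =1 v -> fsumm u = fsumm v.
Proof. by move=> uv; apply/funext => k; apply: eq_bigr => c _; rewrite uv. Qed.

Definition fD f : fps R := fun k => k%:R * f k.

Lemma fDM f g : fD (f * g) = fD f * g + f * fD g.
Proof.
apply/funext => k; rewrite fpsD !fpsM -big_split /fD /= fpsM mulr_sumr.
apply: eq_bigr => i _; rewrite -{1}(subnKC (n := k) (m := i)) -1?ltnS // natrD; ring.
Qed.

Lemma fD1 : fD 1 = 0.
Proof. by apply/funext => -[|k]; rewrite /fD ?mul0r // fps1 /= mulr0. Qed.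

Lemma fDD f g : fD (f + g) = fD f + fD g.
Proof. by apply/funext => k; rewrite fpsD /fD -mulrDr fpsD. Qed.

Lemma fDX f n : fD (f ^+ n) = n%:R * f ^+ n.-1 * fD f.
Proof.
elim: n => [|n IH]; first by rewrite expr0 fD1 !mul0r.
rewrite exprS fDM IH /= -natr1; case: n {IH} => [|n] /=; first by rewrite !expr0; ring.
by rewrite exprS; ring.
Qed.

Lemma fDfC a f : fD (fC a * f) = fC a * fD f.
Proof. by apply/funext => k; rewrite /fD !fCM; ring. Qed.

Lemma fDfX f : fD (fX * f) = fX * f + fX * fD f.
Proof.
rewrite fDM; congr (_ * _ + _).
by apply/funext => -[|[|k]]; rewrite /fD /fX /= ?mul0r ?mulr1 ?mulr0.
Qed.

Lemma fDsumm u : fD (fsumm u) = fsumm (fun c => fD (u c)).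
Proof. by apply/funext => k; rewrite /fD /fsumm mulr_sumr. Qed.

End FpsRing.

(** * The coefficientwise order on series *)

Section FpsOrder.
Context (R : realType).
Implicit Types f g h : fps R.

Definition fle f g := forall k, f k <= g k.

Local Notation "f <=p g" := (fle f g) (at level 70).
Local Notation "0p" := (0 : fps R).

Lemma flexx f : f <=p f. Proof. by []. Qed.

Lemma fle_trans g f h : f <=p g -> g <=p h -> f <=p h.
Proof. by move=> fg gh k; apply: le_trans (gh k). Qed.

Lemma fleD f g f' g' : f <=p g -> f' <=p g' -> f + f' <=p g + g'.
Proof. by move=> fg fg' k; apply: lerD. Qed.

Lemma fsubr_ge0 f g : 0p <=p g - f <-> f <=p g.
Proof. by split=> h k; have := h k; rewrite fpsB subr_ge0. Qed.

Lemma fle0D f g : 0p <=p f -> 0p <=p g -> 0p <=p f + g.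
Proof. by move=> f0 g0 k; apply: addr_ge0; [apply: f0|apply: g0]. Qed.

Lemma fle0M f g : 0p <=p f -> 0p <=p g -> 0p <=p f * g.
Proof. by move=> f0 g0 k; apply: sumr_ge0 => i _; apply: mulr_ge0; [apply: f0|apply: g0]. Qed.

Lemma fleM2l h f g : 0p <=p h -> f <=p g -> h * f <=p h * g.
Proof.
by move=> h0 fg; apply/fsubr_ge0; rewrite -mulrBr; apply: fle0M => //; apply/fsubr_ge0.
Qed.

Lemma fleM2r h f g : 0p <=p h -> f <=p g -> f * h <=p g * h.
Proof. by rewrite ![_ * h]mulrC; apply: fleM2l. Qed.

Lemma fleM f g f' g' : 0p <=p f -> 0p <=p f' -> f <=p g -> f' <=p g' ->
  f * f' <=p g * g'.
Proof.
move=> f0 f'0 fg fg'; apply: (@fle_trans (g * f')); first exact: fleM2r.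
by apply: fleM2l => //; apply: fle_trans fg.
Qed.

Lemma fle01 : 0p <=p 1.
Proof. by move=> k; rewrite fps1; apply: ler0n. Qed.

Lemma fle0X f n : 0p <=p f -> 0p <=p f ^+ n.
Proof.
move=> f0; elim: n => [|n IH]; first exact: fle01.
by rewrite exprS; apply: fle0M.
Qed.

Lemma fleX f g n : 0p <=p f -> f <=p g -> f ^+ n <=p g ^+ n.
Proof.
move=> f0 fg; elim: n => [|n IH] //.
by rewrite !exprS; apply: fleM => //; apply: fle0X.
Qed.

Lemma fle0fX : 0p <=p @fX R.
Proof. by move=> k; rewrite /fX; apply: ler0n. Qed.

Lemma fle0fC a : 0 <= a -> 0p <=p fC a.
Proof. by move=> a0 k; apply: mulrn_wge0. Qed.

Lemma fle0n n : 0p <=p n%:R.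
Proof. by elim: n => // n IH; rewrite -natr1; apply: fle0D => //; apply: fle01. Qed.

Lemma fle_sum (I : eqType) (r : seq I) (F G : I -> fps R) :
  (forall i, i \in r -> F i <=p G i) -> \sum_(i <- r) F i <=p \sum_(i <- r) G i.
Proof.
move=> FG k; rewrite !fps_sum big_seq [leRHS]big_seq.
by apply: ler_sum => i /FG.
Qed.

Lemma fle0_sum (I : eqType) (r : seq I) (F : I -> fps R) :
  (forall i, i \in r -> 0p <=p F i) -> 0p <=p \sum_(i <- r) F i.
Proof.
by move=> F0; have := fle_sum F0; rewrite big1.
Qed.

Lemma fle_fsumm u v : (forall c, u c <=p v c) -> fsumm u <=p fsumm v.
Proof. by move=> uv k; apply: ler_sum => c _; apply: uv. Qed.

Lemma fle0_fsumm u : (forall c, 0p <=p u c) -> 0p <=p fsumm u.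
Proof. by move=> u0 k; apply: sumr_ge0 => c _; apply: u0. Qed.

(** Convexity of the power map: b^n - a^n is b - a times n monomials of degree n - 1, each at most
    b^(n-1). *)
Lemma fleXB a b n : 0p <=p a -> a <=p b -> b ^+ n - a ^+ n <=p n%:R * b ^+ n.-1 * (b - a).
Proof.
move=> a0 ab; elim: n => [|n IH]; first by rewrite !expr0 subrr !mul0r.
have -> : b ^+ n.+1 - a ^+ n.+1 = b * (b ^+ n - a ^+ n) + a ^+ n * (b - a).
  by rewrite !exprS; ring.
have b0 := fle_trans a0 ab.
have ba0 : 0p <=p b - a by apply/fsubr_ge0.
apply: fle_trans (fleD (fleM2l b0 IH) (fleM2r ba0 (fleX n a0 ab))) _.
case: n {IH} => [|n] /=; rewrite -?natr1 ?exprS; apply: eq_ind (flexx _) _ _; ring.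
Qed.

End FpsOrder.

Notation "f <=p g" := (fle f g) (at level 70).

(** * The generating functions of the tree-indexed walk *)

Section TreeSeries.
Context (R : realType) (mu : nat -> R) (mu_ge0 : forall c, 0 <= mu c).
Implicit Types (a : fps R).

Definition Fs a : fps R := fsumm (fun c => fC (mu c) * a ^+ c).

Context (T : fps R) (T_ge0 : 0 <=p T) (TE : T = @fX R * Fs T).

(* [Ks a] is the divided difference (Fs T - Fs a) / (T - a). *)
Definition Ks a : fps R :=
  fsumm (fun c => fC (mu c) * \sum_(i < c) a ^+ i * T ^+ (c.-1 - i)).
(** Writing F for [Fs]: [phi] is X F'(T), one step along a marked line together with the trees hung
    beside it; [wS] is 1 / (1 - phi), all such lines; [qS] is X F''(T) / 2, a vertex with two marked
    children. *)
Definition phi : fps R := @fX R * fsumm (fun c => fC (c%:R * mu c) * T ^+ c.-1).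
Definition wS : fps R := fsumm (fun c => phi ^+ c).
Definition qS : fps R := @fX R * fsumm (fun c => fC ('C(c, 2)%:R * mu c) * T ^+ c.-2).

(* P(S_k = k - L) for the random walk S with step law mu *)
Definition Wd (k L : nat) : R := if (L <= k)%N then ((mu : fps R) ^+ k) (k - L)%N else 0.

Lemma ford1T : ford 1 T.
Proof. by case=> // _; rewrite TE fXM0. Qed.

Lemma ford_pow a c : ford 1 a -> ford c.-2 (a ^+ c).
Proof. by move=> a1; apply: fordW (fordX (n := c) a1); lia. Qed.

Lemma summable_pow (b : nat -> R) a : ford 1 a -> summable (fun c => fC (b c) * a ^+ c).
Proof. by move=> a1; apply: summableC => c; apply: ford_pow. Qed.

Lemma summable_pow1 (b : nat -> R) a : ford 1 a -> summable (fun c => fC (b c) * a ^+ c.-1).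
Proof. by move=> a1; apply: summableC => c; apply: fordW (fordX (n := c.-1) a1); lia. Qed.

Lemma summable_pow2 (b : nat -> R) a : ford 1 a -> summable (fun c => fC (b c) * a ^+ c.-2).
Proof. by move=> a1; apply: summableC => c; apply: fordX. Qed.

Lemma ford1_phi : ford 1 phi.
Proof. by case=> // _; rewrite /phi fXM0. Qed.

Lemma ford1_le a b : 0 <=p a -> a <=p b -> ford 1 b -> ford 1 a.
Proof.
move=> a0 ab b1 [|//] _; apply/eqP; rewrite eq_le [X in _ && X]a0 andbT.
by apply: le_trans (ab 0%N) _; rewrite b1.
Qed.

Lemma phi_ge0 : 0 <=p phi.
Proof.
apply: fle0M; first exact: fle0fX.
apply: fle0_fsumm => c; apply: fle0M; last exact: fle0X.
by apply: fle0fC; rewrite mulr_ge0.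
Qed.

Lemma qS_ge0 : 0 <=p qS.
Proof.
apply: fle0M; first exact: fle0fX.
apply: fle0_fsumm => c; apply: fle0M; last exact: fle0X.
by apply: fle0fC; rewrite mulr_ge0.
Qed.

Lemma wS_ge0 : 0 <=p wS.
Proof. by apply: fle0_fsumm => c; apply: fle0X; apply: phi_ge0. Qed.

Lemma summable_phi : summable (fun c => phi ^+ c).
Proof. by move=> c; apply: ford_pow; apply: ford1_phi. Qed.

Lemma wSE : wS = 1 + phi * wS.
Proof.
rewrite [in RHS]/wS fsummM; last exact: summable_phi.
apply/funext => k; rewrite fpsD /wS.
rewrite (fsummE (m := k.+4) summable_phi) // big_ord_recl expr0; congr (_ + _).
by apply: eq_bigr => c _; rewrite /= /bump /= add1n exprS.
Qed.

Lemma TL_wS0 L : (T ^+ L.+1 * wS) 0%N = 0.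
Proof. by rewrite exprS {1}TE -!mulrA fXM0. Qed.

(** Opening the root of the first of L + 1 trees mirrors the first step of the walk in [Wd_S]. The
    range c < k.+3 is the cut-off built into [fsumm]. *)
Lemma TL_S L (g : fps R) k : (T ^+ L.+1 * g) k.+1 = \sum_(c < k.+3) mu c * (T ^+ (L + c) * g) k.
Proof.
rewrite exprS {1}TE -!mulrA fXMS mulrC fsummM; last exact: (summable_pow _ ford1T).
by apply: eq_bigr => c _; rewrite fMC mulrAC -exprD.
Qed.

Lemma phi_S (g : fps R) k : (phi * g) k.+1 = \sum_(c < k.+3) c%:R * mu c * (T ^+ c.-1 * g) k.
Proof.
rewrite /phi -!mulrA fXMS mulrC fsummM; last exact: (summable_pow1 _ ford1T).
by apply: eq_bigr => c _; rewrite fMC [g * _]mulrC.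
Qed.

Lemma qS_S (g : fps R) k : (qS * g) k.+1 = \sum_(c < k.+3) 'C(c, 2)%:R * mu c * (T ^+ c.-2 * g) k.
Proof.
rewrite /qS -!mulrA fXMS mulrC fsummM; last exact: (summable_pow2 _ ford1T).
by apply: eq_bigr => c _; rewrite fMC [g * _]mulrC.
Qed.

Lemma Wd_S k L : Wd k.+1 L.+1 = \sum_(c < k.+3) mu c * Wd k (L + c).
Proof.
rewrite /Wd ltnS subSS; case: leqP => [Lk|kL]; last first.
  by rewrite big1 // => c _; rewrite ifN ?mulr0 // -ltnNge; apply: leq_trans kL _; apply: leq_addr.
rewrite exprS fpsM (big_ord_widen k.+3 (fun i => mu i * ((mu : fps R) ^+ k) (k - L - i)%N)); last lia.
rewrite big_mkcond; apply: eq_bigr => c _.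
by case: ifP; case: ifP => //; rewrite ?mulr0 ?subnDA //; lia.
Qed.

(** Apply [fD] to [mu ^+ k.+1] and read coefficient k.+1: [fD] multiplies it by the index k.+1, the
    power rule by the exponent k.+1, and the two cancel. This is the place of the cycle lemma. *)
Lemma Wd_S0 k : Wd k.+1 0 = \sum_(c < k.+3) c%:R * mu c * Wd k c.-1.
Proof.
rewrite /Wd /= subn0.
have k0 : k.+1%:R != 0 :> R by rewrite pnatr_eq0.
apply: (mulfI k0); rewrite -[LHS]/(fD (_ ^+ _) _) fDX /= -mulrA.
rewrite fnM; congr (_ * _); rewrite mulrC fpsM.
rewrite (big_ord_widen k.+3 (fun i => fD (mu : fps R) i * ((mu : fps R) ^+ k) (k.+1 - i)%N)) //.
rewrite big_mkcond; apply: eq_bigr => -[[|c] ck] _ /=; first by rewrite /fD !mul0r.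
rewrite ltnS; case: ifP => ck'; case: ifP => ck''; rewrite ?mulr0 ?subSS //; lia.
Qed.

(** A form of Lagrange inversion: both sides obey the same recursion in k, by [TL_S] and [Wd_S] for
    positive exponents, and by [wSE], [phi_S] and [Wd_S0] for exponent 0. *)
Lemma TL_wS k L : (T ^+ L * wS) k = Wd k L.
Proof.
elim: k L => [|k IH] [|L].
- by rewrite expr0 mul1r wSE fpsD (fordMr _ ford1_phi) ?addr0.
- by rewrite TL_wS0 /Wd.
- rewrite expr0 mul1r wSE fpsD fps1 add0r phi_S Wd_S0.
  by apply: eq_bigr => c _; rewrite IH.
- by rewrite TL_S Wd_S; apply: eq_bigr => c _; rewrite IH.
Qed.

(** Differentiating T = X F(T) gives (1 - phi) fD T = T, and [wS] is the inverse of 1 - phi. *)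
Lemma fD_T : fD T = T * wS.
Proof.
have DT : fD T = T + phi * fD T.
  rewrite {1}TE fDfX -TE; congr (_ + _).
  rewrite /phi -mulrA; congr (_ * _); rewrite mulrC /Fs fDsumm fsummM; last exact: (summable_pow1 _ ford1T).
  apply: eq_fsumm => c; rewrite fDfC fDX fC_is_monoid_morphism fC_nat.
  ring.
have d1 : fD T - phi * fD T = T by rewrite {1}DT addrK.
have w1 : wS - phi * wS = 1 by rewrite {1}wSE addrK.
transitivity (wS * (fD T - phi * fD T)); last by rewrite d1 mulrC.
by rewrite -[LHS]mulr1 -w1; ring.
Qed.

Lemma T_Wd n : n%:R * T n = Wd n 1.
Proof. by rewrite -[LHS]/(fD T n) fD_T -TL_wS expr1. Qed.

Lemma le_Fs a b : 0 <=p a -> a <=p b -> ford 1 b -> fX R * Fs a <=p fX R * Fs b.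
Proof.
move=> a0 ab b1; apply: fleM2l; first exact: fle0fX.
apply: fle_fsumm => c; apply: fleM2l; first exact: fle0fC.
exact: fleX.
Qed.

(** F has nonnegative coefficients, so its slope between a and b is at most its slope at T, which is
    what [phi] contains. *)
Lemma FsB a b : 0 <=p a -> a <=p b -> b <=p T ->
  fX R * Fs b - fX R * Fs a <=p phi * (b - a).
Proof.
move=> a0 ab bT; rewrite -mulrBr /phi -mulrA; apply: fleM2l; first exact: fle0fX.
have b0 := fle_trans a0 ab.
have ba : 0 <=p b - a by apply/fsubr_ge0.
rewrite fsummB mulrC fsummM; last exact: (summable_pow1 _ ford1T).
apply: fle_fsumm => c; rewrite -mulrBr.
have -> : (b - a) * (fC (c%:R * mu c) * T ^+ c.-1) =
   fC (mu c) * (c%:R * T ^+ c.-1 * (b - a)).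
  by rewrite fC_is_monoid_morphism fC_nat; ring.
apply: fleM2l; first exact: fle0fC.
apply: fle_trans (fleXB _ a0 ab) _; apply: fleM2r => //.
by apply: fleM2l; [exact: fle0n|exact: fleX].
Qed.

Lemma ford_aT a c : ford 1 a ->
  ford c.-2 (\sum_(i < c) a ^+ i * T ^+ (c.-1 - i)).
Proof.
move=> a1 k kc; rewrite fps_sum big1 // => i _.
apply: (fordM (fordX (n := i) a1) (fordX (n := c.-1 - i) ford1T)).
by have := ltn_ord i; lia.
Qed.

Lemma summableK a : ford 1 a ->
  summable (fun c => fC (mu c) * \sum_(i < c) a ^+ i * T ^+ (c.-1 - i)).
Proof. by move=> a1; apply: summableC => c; apply: ford_aT. Qed.

Lemma KsE a : ford 1 a -> fX R * Ks a * (T - a) = T - fX R * Fs a.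
Proof.
move=> a1; rewrite [in RHS]TE -mulrBr -mulrA; congr (_ * _).
rewrite mulrC fsummM; last exact: summableK.
rewrite fsummB; apply: eq_fsumm => -[|c]; first by rewrite !expr0 big_ord0; ring.
rewrite mulrCA -mulrBr; congr (_ * _).
by rewrite subrXX; congr (_ * _); apply: eq_bigr => i _; rewrite mulrC.
Qed.

Lemma KsT : fX R * Ks T = phi.
Proof.
congr (_ * _); apply: eq_fsumm => c.
rewrite mulrC [c%:R * _]mulrC fC_is_monoid_morphism fC_nat -mulrA mulrC.
congr (_ * _).
rewrite (eq_bigr (fun=> T ^+ c.-1)); last first.
  by move=> i _; rewrite -exprD subnKC //; have := ltn_ord i; lia.
by rewrite sumr_const card_ord mulr_natl.
Qed.

Lemma Ks_ge0 a : 0 <=p a -> 0 <=p Ks a.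
Proof.
move=> a0; apply: fle0_fsumm => c; apply: fle0M; first exact: fle0fC.
by apply: fle0_sum => i _; apply: fle0M; apply: fle0X.
Qed.

Lemma le_Ks a b : 0 <=p a -> a <=p b -> Ks a <=p Ks b.
Proof.
move=> a0 ab; apply: fle_fsumm => c; apply: fleM2l; first exact: fle0fC.
apply: fle_sum => i _; apply: fleM2r; first exact: fle0X.
exact: fleX.
Qed.

(** The slope of a^i T^(c-1-i) in a is at most i T^(c-2), and the sum of i over i < c is the
    binomial coefficient in [qS]. *)
Lemma KsB a b : 0 <=p a -> a <=p b -> b <=p T ->
  fX R * Ks b - fX R * Ks a <=p qS * (b - a).
Proof.
move=> a0 ab bT; rewrite -mulrBr /qS -mulrA; apply: fleM2l; first exact: fle0fX.
have b0 := fle_trans a0 ab.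
have ba : 0 <=p b - a by apply/fsubr_ge0.
rewrite fsummB mulrC fsummM; last exact: (summable_pow2 _ ford1T).
apply: fle_fsumm => c; rewrite -mulrBr.
have -> : (b - a) * (fC ('C(c, 2)%:R * mu c) * T ^+ c.-2) =
   fC (mu c) * ('C(c, 2)%:R * T ^+ c.-2 * (b - a)).
  by rewrite fC_is_monoid_morphism fC_nat; ring.
apply: fleM2l; first exact: fle0fC.
rewrite -sumrB.
have -> : 'C(c, 2)%:R * T ^+ c.-2 * (b - a) = \sum_(i < c) i%:R * T ^+ c.-2 * (b - a).
  by rewrite -triangular_sum natr_sum big_mkord !mulr_suml.
apply: fle_sum => i _; rewrite -mulrBl.
apply: (@fle_trans _ (i%:R * b ^+ i.-1 * (b - a) * T ^+ (c.-1 - i))).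
  by apply: fleM2r; [exact: fle0X|exact: fleXB].
case: i => -[|i] ic /=; first by rewrite !mul0r.
have -> : c.-2 = (i + (c.-1 - i.+1))%N by lia.
rewrite exprD -!mulrA; apply: fleM2l; first exact: fle0n.
rewrite [(b - a) * _]mulrC !mulrA; apply: fleM2r => //.
by apply: fleM2r; [exact: fle0X|exact: fleX].
Qed.

Lemma sum_phi_le M : \sum_(j < M) phi ^+ j <=p wS.
Proof.
have wp := wS_ge0; have pp := phi_ge0.
elim: M => [|M IH]; first by rewrite big_ord0.
rewrite big_ord_recl expr0 wSE; apply: fleD => //.
rewrite (eq_bigr (fun j : 'I_M => phi * phi ^+ j)).
  by rewrite -mulr_sumr; apply: fleM2l.
by move=> j _; rewrite exprS.
Qed.

(* Generating function of the pairs (u, v) of vertices at distance j such that v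
   lies in the past of u: v is the j-th ancestor of u, or the lines of u and v
   branch at one of j - 1 possible heights. *)
Definition cS (j : nat) : fps R :=
  phi ^+ j * wS + j.-1%:R * (qS * T * wS * phi ^+ j.-2).

Lemma cS_ge0 j : 0 <=p cS j.
Proof.
have wp := wS_ge0; have pp := phi_ge0; have qp := qS_ge0.
apply: fle0D; first by apply: fle0M => //; apply: fle0X.
apply: fle0M; first exact: fle0n.
by do !apply: fle0M => //; apply: fle0X.
Qed.

Lemma sum_phi2_le M : \sum_(j < M) j%:R * phi ^+ j.-1 <=p wS ^+ 2.
Proof.
have wp := wS_ge0; have pp := phi_ge0.
elim: M => [|M IH]; first by rewrite big_ord0; apply: fle0X.
have -> : \sum_(j < M.+1) j%:R * phi ^+ j.-1 =
    phi * \sum_(j < M) j%:R * phi ^+ j.-1 + \sum_(j < M) phi ^+ j.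
  rewrite big_ord_recl mul0r add0r mulr_sumr -big_split /=; apply: eq_bigr => j _.
  rewrite /bump /= add1n -natr1 mulrDl mul1r; congr (_ + _).
  by case: (j : nat) => [|j'] /=; rewrite ?mul0r ?mulr0 // exprS; ring.
have -> : wS ^+ 2 = phi * wS ^+ 2 + wS by rewrite !expr2 {1}wSE; ring.
apply: fleD; first exact: fleM2l.
exact: sum_phi_le.
Qed.

(** [T * wS] is [fD T], the series of trees with one marked vertex, so the right side marks a second
    vertex while the left side counts only some of these pairs. Besides the cut at M, the algebra
    throws away T wS^2 + qS T^2 wS^3. *)
Lemma sum_cS_le M : T * \sum_(j < M) cS j.+1 <=p fD (T * wS).
Proof.
have wp := wS_ge0; have pp := phi_ge0; have qp := qS_ge0.
have Dphi : fD phi = phi + 2%:R * qS * (T * wS).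
  rewrite fDfX; congr (_ + _); rewrite -fD_T [2%:R * _]mulrC -!mulrA; congr (_ * _).
  rewrite fDsumm [RHS]mulrC fsummM; last exact: (summable_pow2 _ ford1T).
  apply: eq_fsumm => c; rewrite fDfC fDX !fC_is_monoid_morphism !fC_nat.
  case: c => [|c] /=; first by rewrite !mul0r mulr0.
  have c2 : 2%:R * 'C(c.+1, 2)%:R = c.+1%:R * c%:R :> fps R.
    by rewrite -!natrM -mul_bin_diag bin1.
  have -> : (2%:R * fD T) * ('C(c.+1, 2)%:R * fC (mu c.+1) * T ^+ c.-1) =
    (2%:R * 'C(c.+1, 2)%:R) * (fD T * fC (mu c.+1) * T ^+ c.-1) by ring.
  by rewrite c2; ring.
have Dw : fD wS = wS ^+ 2 * fD phi.
  have d1 : fD wS - phi * fD wS = fD phi * wS.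
    by rewrite {1}wSE fDD fD1 add0r fDM addrK.
  have w1 : wS - phi * wS = 1 by rewrite {1}wSE addrK.
  transitivity (wS * (fD wS - phi * fD wS)); last by rewrite d1; ring.
  by rewrite -[LHS]mulr1 -w1; ring.
have -> : T * \sum_(j < M) cS j.+1 = T * phi * wS * \sum_(j < M) phi ^+ j +
    qS * T ^+ 2 * wS * \sum_(j < M) j%:R * phi ^+ j.-1.
  rewrite !mulr_sumr -big_split /=; apply: eq_bigr => j _.
  by rewrite /cS /= exprS; ring.
rewrite fDM Dw fD_T Dphi.
apply: (@fle_trans _ (T * phi * wS * wS + qS * T ^+ 2 * wS * wS ^+ 2)).
  apply: fleD; apply: fleM2l; do ?apply: fle0M => //.
  - exact: sum_phi_le.
  - exact: sum_phi2_le.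
apply/fsubr_ge0.
have -> : T * wS * wS + T * (wS ^+ 2 * (phi + 2%:R * qS * (T * wS))) -
   (T * phi * wS * wS + qS * T ^+ 2 * wS * wS ^+ 2) =
   T * wS * wS + qS * T ^+ 2 * wS ^+ 3 by ring.
by apply: fle0D; do ?apply: fle0M => //; apply: fle0X.
Qed.

Section Space.
Context (I : eqType) (r : seq I) (th : I -> R) (th_ge0 : forall z, 0 <= th z)
  (th_sum : \sum_(z <- r) th z = 1) (V : zmodType) (io : I -> V) (A : pred V).

Implicit Types (f g : V -> fps R).

Definition Tf (f : V -> fps R) (y : V) : fps R :=
  \sum_(z <- r) fC (th z) * f (y + io z).
Definition Tr (f : V -> R) (y : V) : R := \sum_(z <- r) th z * f (y + io z).
Definition kill (f : V -> fps R) (y : V) : fps R := if A y then 0 else f y.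
(* E_j y = probability that the walk from y is in A at time j *)
Definition EA (j : nat) : V -> R := iter j Tr (fun y => (A y)%:R).

(* [SpS b] is the series S_b of the introduction; the exact S is the limit of [SxS M] as M grows,
   with [al] the limit of [alphaS b]. *)
Definition alphaS (b : nat) : V -> fps R :=
  iter b (fun al => Tf (kill (fun p => fX R * Fs (al p)))) (fun=> T).
Fixpoint SpS (b : nat) : V -> fps R :=
  if b is b'.+1 then
    fun y => 1 + Tf (kill (fun p => fX R * Ks (alphaS b' p) * SpS b' p)) y
  else fun=> wS.

Context (al : V -> fps R) (al_ge0 : forall p, 0 <=p al p)
  (al_le : forall p, al p <=p T)
  (alE : forall p, al p = Tf (kill (fun p => fX R * Fs (al p))) p).
Definition SxS (M : nat) : V -> fps R :=
  iter M (fun (g : V -> fps R) y => 1 + Tf (kill (fun p => fX R * Ks (al p) * g p)) y) (fun=> 0).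
Definition HitS (y : V) : fps R := T - kill (fun p => fX R * Fs (al p)) y.

Lemma le_Tf f g y : (forall y, f y <=p g y) -> Tf f y <=p Tf g y.
Proof. by move=> fg; apply: fle_sum => z _; apply: fleM2l => //; apply: fle0fC. Qed.

Lemma Tf_ge0 f y : (forall y, 0 <=p f y) -> 0 <=p Tf f y.
Proof. by move=> f0; apply: fle0_sum => z _; apply: fle0M => //; apply: fle0fC. Qed.

Lemma TfB f g y : Tf f y - Tf g y = Tf (fun y => f y - g y) y.
Proof. by rewrite -sumrB; apply: eq_bigr => z _; rewrite mulrBr. Qed.

Lemma TfD f g y : Tf f y + Tf g y = Tf (fun y => f y + g y) y.
Proof. by rewrite -big_split; apply: eq_bigr => z _; rewrite /= mulrDr. Qed.

Lemma Tf_cst a y : Tf (fun=> a) y = a.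
Proof.
rewrite /Tf -mulr_suml; have -> : \sum_(z <- r) fC (th z) = 1 :> fps R.
  rewrite -fC1 -th_sum; elim: (r) => [|z s IH]; rewrite ?big_nil ?big_cons.
    by apply/funext => k; rewrite /fC mul0rn.
  by rewrite IH; apply/funext => k; rewrite fpsD /fC mulrnDl.
exact: mul1r.
Qed.

Lemma TfM a f y : Tf (fun y => a * f y) y = a * Tf f y.
Proof. by rewrite /Tf mulr_sumr; apply: eq_bigr => z _; rewrite mulrCA. Qed.

Lemma Tf_fC (f : V -> R) y : Tf (fun y => fC (f y)) y = fC (Tr f y).
Proof.
apply/funext => k; rewrite /Tf fps_sum /fC /Tr -sumrMnl; apply: eq_bigr => z _.
by rewrite fCM mulrnAr.
Qed.

Lemma Tf_sum (J : Type) (s : seq J) (F : J -> V -> fps R) y :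
  Tf (fun y => \sum_(j <- s) F j y) y = \sum_(j <- s) Tf (F j) y.
Proof.
by rewrite /Tf exchange_big; apply: eq_bigr => z _; rewrite mulr_sumr.
Qed.

Lemma kill_ge0 f y : (forall y, 0 <=p f y) -> 0 <=p kill f y.
Proof. by move=> f0; rewrite /kill; case: (A y). Qed.

Lemma le_kill f g y : (forall y, f y <=p g y) -> kill f y <=p kill g y.
Proof. by move=> fg; rewrite /kill; case: (A y). Qed.

Lemma le_kill1 f y : (forall y, 0 <=p f y) -> kill f y <=p f y.
Proof. by move=> f0; rewrite /kill; case: (A y). Qed.

Lemma Fs_ge0 a : 0 <=p a -> 0 <=p fX R * Fs a.
Proof.
move=> a0; apply: fle0M; first exact: fle0fX.
by apply: fle0_fsumm => c; apply: fle0M; [exact: fle0fC|exact: fle0X].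
Qed.

Lemma alphaS_bound b p : 0 <=p alphaS b p /\ alphaS b p <=p T.
Proof.
elim: b p => [|b IH] p; first by split.
split.
  by apply: Tf_ge0 => y; apply: kill_ge0 => z; apply: Fs_ge0; case: (IH z).
rewrite /= -[X in _ <=p X](Tf_cst T p); apply: le_Tf => y.
apply: fle_trans (le_kill1 _ _) _ => [z|]; first by apply: Fs_ge0; case: (IH z).
rewrite [X in _ <=p X]TE; apply: le_Fs ford1T; by case: (IH y).
Qed.

Lemma ford1_al p : ford 1 (al p).
Proof.
case=> // _; rewrite alE /Tf fps_sum big1 // => z _; rewrite fCM /kill.
by case: ifP; rewrite ?fXM0 mulr0.
Qed.

(** Split at the first child whose tree meets A: the i siblings on one side avoid A, those on the
    other side are free, which is the divided difference [Ks]. In formulas, [KsE] is combined with T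
    - al = Tf HitS. *)
Lemma HitE y : HitS y = if A y then T else fX R * Ks (al y) * Tf HitS y.
Proof.
rewrite /HitS {1}/kill; case: ifP => _; first by rewrite subr0.
rewrite -KsE; last exact: ford1_al.
by rewrite -TfB Tf_cst -alE.
Qed.

Lemma al_le_alphaS b p : al p <=p alphaS b p.
Proof.
elim: b p => [|b IH] p; first exact: al_le.
rewrite alE /=; apply: le_Tf => y; apply: le_kill => z.
apply: le_Fs => //; have [a0 aT] := alphaS_bound b z.
exact: ford1_le a0 aT ford1T.
Qed.

Lemma SpS_bound b y : 0 <=p SpS b y /\ SpS b y <=p wS.
Proof.
have wp := wS_ge0.
elim: b y => [|b IH] y; first by split.
have sp p : 0 <=p fX R * Ks (alphaS b p) * SpS b p.
  have [s0 _] := IH p; have [a0 _] := alphaS_bound b p.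
  by do !apply: fle0M => //; exact: Ks_ge0.
split.
  apply: fle0D; first exact: fle01.
  by apply: Tf_ge0 => p; apply: kill_ge0.
rewrite [X in _ <=p X]wSE /=; apply: fleD => //.
rewrite -[X in _ <=p X](Tf_cst _ y); apply: le_Tf => p.
apply: fle_trans (le_kill1 _ sp) _; have [s0 sw] := IH p; have [a0 aT] := alphaS_bound b p.
apply: fleM => //; first by apply: fle0M; [exact: fle0fX|exact: Ks_ge0].
by rewrite -KsT; apply: fleM2l; [exact: fle0fX|exact: le_Ks].
Qed.

Lemma le_XKs a b f g y : 0 <=p a -> a <=p b -> 0 <=p f y -> f y <=p g y ->
  fX R * Ks a * f y <=p fX R * Ks b * g y.
Proof.
move=> a0 ab f0 fg; apply: (fleM _ f0 _ fg).
  by apply: fle0M; [exact: fle0fX|exact: Ks_ge0].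
by apply: fleM2l; [exact: fle0fX|exact: le_Ks].
Qed.

Lemma SxS_ge0 M y : 0 <=p SxS M y.
Proof.
elim: M y => [|M IH] y //=; apply: fle0D; first exact: fle01.
apply: Tf_ge0 => p; apply: kill_ge0 => q; do ?apply: fle0M => //.
by apply: Ks_ge0.
Qed.

Lemma SxS_le_SpS M b y : SxS M y <=p SpS b y.
Proof.
elim: M b y => [|M IH] [|b] y.
- exact: wS_ge0.
- by have [] := SpS_bound b.+1 y.
- rewrite -[SpS 0 y]/wS wSE /=; apply: fleD => //.
  rewrite -[X in _ <=p X](Tf_cst _ y); apply: le_Tf => p.
  have sx := SxS_ge0 M.
  apply: fle_trans (le_kill1 _ _) _.
    by move=> q; do !apply: fle0M => //; exact: Ks_ge0.
  by rewrite -KsT; apply: (le_XKs (f := SxS M) (g := fun=> wS)) => //; apply: (IH 0%N).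
- apply: fleD => //; apply: le_Tf => p; apply: le_kill => q.
  apply: le_XKs => //; [exact: al_le_alphaS|exact: SxS_ge0].
Qed.

Lemma TfA (e : V -> R) (a : fps R) y : Tf (fun y => fC (e y) * a) y = fC (Tr e y) * a.
Proof.
rewrite -Tf_fC mulrC -TfM; congr (Tf _ y).
by apply/funext => z; rewrite mulrC.
Qed.

(** Common shape of the error bounds. [u] and [rem] do not depend on the point, so [Tf] acts only on
    the probabilities [EA] and shifts their time by one. In the applications [rem] has high order in
    X and disappears from a fixed coefficient. *)
Definition ErrS (a N : nat) (u : nat -> fps R) (rem : fps R) (y : V) : fps R :=
  \sum_(a <= g < N) fC (EA g.+1 y) * u g + rem.

Lemma Tf_ErrS (a N : nat) u rem h y :
  Tf (fun y => h * ErrS a N u rem y) y =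
  ErrS a.+1 N.+1 (fun g : nat => h * u g.-1) (h * rem) y.
Proof.
rewrite TfM /ErrS -TfD Tf_cst mulrDr; congr (_ + _).
rewrite Tf_sum mulr_sumr big_add1 /=; apply: eq_bigr => g _.
by rewrite TfA; ring.
Qed.

Lemma ErrSD (a N : nat) u u' rem rem' y :
  ErrS a N u rem y + ErrS a N u' rem' y =
  ErrS a N (fun g : nat => u g + u' g) (rem + rem') y.
Proof.
rewrite /ErrS addrACA -big_split; congr (_ + _).
by apply: eq_bigr => g _; rewrite /= mulrDr.
Qed.

Lemma eq_ErrS (a N : nat) u u' rem y : (forall g : nat, (a <= g)%N -> u g = u' g) ->
  ErrS a N u rem y = ErrS a N u' rem y.
Proof.
move=> uu; rewrite /ErrS; congr (_ + _); rewrite !big_nat; apply: eq_bigr => g.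
by case/andP => ag _; rewrite uu.
Qed.

Lemma ErrS0 N u rem y :
  ErrS 0 N.+1 u rem y = fC (EA 1 y) * u 0%N + ErrS 1 N.+1 u rem y.
Proof. by rewrite /ErrS big_ltn // addrA. Qed.

Lemma subr_kill f h y : h - kill f y = fC (A y)%:R * h + (kill (fun=> h) y - kill f y).
Proof.
rewrite /kill; case: (A y); first by rewrite fC1 mul1r !subr0 addr0.
have -> : fC 0 = 0 :> fps R by apply/funext => k; rewrite /fC mul0rn.
by rewrite mul0r add0r.
Qed.

Lemma le_killB f g h y : (forall y, 0 <=p h y) -> (forall y, f y - g y <=p h y) ->
  kill f y - kill g y <=p h y.
Proof. by move=> h0 fgh; rewrite /kill; case: (A y) => //; rewrite subrr. Qed.

Lemma Tal_ge0 p : 0 <=p T - al p.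
Proof. exact/fsubr_ge0. Qed.

(** Unrolling the equation of [al]: either the child lands in A, which costs [EA 1], or [FsB] passes
    the defect T - al on with a factor [phi]. *)
Lemma alphaS_err0 M p :
  T - al p <=p ErrS 0 M (fun g : nat => phi ^+ g * T) (phi ^+ M * T) p.
Proof.
have pp := phi_ge0.
elim: M p => [|M IH] p.
  rewrite /ErrS big_nil add0r expr0 mul1r; apply/fsubr_ge0.
  by rewrite opprB addrC subrK.
have st : T - al p <=p fC (EA 1 p) * T + Tf (fun y => phi * (T - al y)) p.
  rewrite {1}alE -[X in X - _](Tf_cst _ p) TfB -TfA TfD; apply: le_Tf => y.
  rewrite subr_kill; apply: fleD => //.
  apply: (le_killB (h := fun y => phi * (T - al y))) => z.
    by apply: fle0M => //; apply: Tal_ge0.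
  by rewrite [X in X - _]TE; apply: FsB.
apply: fle_trans st _; rewrite ErrS0 expr0 mul1r; apply: fleD => //.
apply: (@fle_trans _ (Tf (fun y => phi * ErrS 0 M (fun g : nat => phi ^+ g * T) (phi ^+ M * T) y) p)).
  by apply: le_Tf => y; apply: fleM2l.
rewrite Tf_ErrS mulrA -exprS.
rewrite (@eq_ErrS _ _ _ (fun g : nat => phi ^+ g * T)) // => -[//|g] _.
by rewrite /= exprS mulrA.
Qed.

Lemma alphaS_err b M p : alphaS b p - al p <=p
  ErrS b (b + M) (fun g : nat => phi ^+ g * T) (phi ^+ (b + M) * T) p.
Proof.
have pp := phi_ge0.
elim: b p => [|b IH] p; first exact: alphaS_err0.
rewrite {1}alE TfB addSn.
apply: (@fle_trans _ (Tf (fun y => phi * ErrS b (b + M) (fun g : nat => phi ^+ g * T) (phi ^+ (b + M) * T) y) p)).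
  apply: le_Tf => y; apply: fle_trans (fleM2l pp (IH y)).
  have ab z : 0 <=p alphaS b z - al z by apply/fsubr_ge0; apply: al_le_alphaS.
  apply: (le_killB (h := fun y => phi * (alphaS b y - al y))) => z.
    by apply: fle0M.
  have [a0 aT] := alphaS_bound b z.
  by apply: FsB => //; apply: al_le_alphaS.
rewrite Tf_ErrS mulrA -exprS.
rewrite (@eq_ErrS _ _ _ (fun g : nat => phi ^+ g * T)) // => -[//|g] _.
by rewrite /= exprS mulrA.
Qed.

Definition remS N : fps R := phi ^+ N * wS + N%:R * (qS * T * wS * phi ^+ N.-1).

Lemma remS_S N : qS * wS * (phi ^+ N * T) + phi * remS N = remS N.+1.
Proof.
rewrite /remS /= -natr1; case: N => [|N] /=; first by rewrite !expr0 expr1; ring.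
by rewrite !exprS; ring.
Qed.

Lemma cS_S (g : nat) : qS * wS * (phi ^+ g * T) + phi * cS g.+1 = cS g.+2.
Proof.
rewrite /cS /= -natr1; case: g => [|g] /=; first by rewrite !expr0 !expr1 expr2; ring.
by rewrite !exprS; ring.
Qed.

(** The defect has three sources at each step: landing in A, a constrained side tree (by [KsB], [qS]
    times the defect of [al]), and the defect at the next vertex of the path (factor [phi]).
    [remS_S] and [cS_S] say that their sum has the same shape again. *)
Lemma SpS_err0 M y : wS - SxS M y <=p ErrS 0 M (fun g : nat => cS g.+1) (remS M) y.
Proof.
have pp := phi_ge0; have wp := wS_ge0; have qp := qS_ge0.
elim: M y => [|M IH] y.
  rewrite /ErrS big_nil add0r /remS expr0 mul1r mul0r addr0 /=.
  by rewrite subr0.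
rewrite {1}wSE /= opprD addrACA subrr add0r -[X in X - _](Tf_cst _ y) TfB.
apply: (@fle_trans _ (Tf (fun y => fC (A y)%:R * (phi * wS) +
   (qS * wS * ErrS 0 M (fun g : nat => phi ^+ g * T) (phi ^+ M * T) y
      + phi * ErrS 0 M (fun g : nat => cS g.+1) (remS M) y)) y)).
  apply: le_Tf => p; rewrite subr_kill; apply: fleD => //.
  apply: (@fle_trans _ (qS * wS * (T - al p) + phi * (wS - SxS M p))); last first.
    by apply: fleD; apply: fleM2l => //; [exact: fle0M|exact: alphaS_err0].
  have ws z : 0 <=p wS - SxS M z.
    by apply/fsubr_ge0; apply: (SxS_le_SpS M 0).
  apply: (le_killB (h := fun p => qS * wS * (T - al p) + phi * (wS - SxS M p))) => z.
    by apply: fle0D; do ?apply: fle0M => //; exact: Tal_ge0.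
  have -> : phi * wS - fX R * Ks (al z) * SxS M z =
     (phi - fX R * Ks (al z)) * wS + fX R * Ks (al z) * (wS - SxS M z) by ring.
  apply: fleD.
    rewrite -KsT mulrAC; apply: fleM2r => //; exact: KsB.
  by apply: fleM2r => //; rewrite -KsT; apply: fleM2l; [exact: fle0fX|exact: le_Ks].
rewrite -TfD -TfD !Tf_ErrS TfA ErrSD ErrS0 remS_S; apply: fleD.
  by rewrite /cS /= expr1 mul0r addr0.
rewrite (@eq_ErrS _ _ _ (fun g : nat => cS g.+1)) // => -[//|g] _.
by rewrite /= cS_S.
Qed.

(** Within b steps [SpS] and [SxS] are killed on A alike, so the contribution of landing in A
    cancels b times and the error starts at time b + 1. *)
Lemma SpS_err b M y :
  SpS b y - SxS (b + M) y <=p ErrS b (b + M) (fun g : nat => cS g.+1) (remS (b + M)) y.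
Proof.
have pp := phi_ge0; have wp := wS_ge0; have qp := qS_ge0.
elim: b y => [|b IH] y; first exact: SpS_err0.
rewrite addSn /= opprD addrACA subrr add0r TfB.
apply: (@fle_trans _ (Tf (fun y =>
   (qS * wS * ErrS b (b + M) (fun g : nat => phi ^+ g * T) (phi ^+ (b + M) * T) y
      + phi * ErrS b (b + M) (fun g : nat => cS g.+1) (remS (b + M)) y)) y)).
  apply: le_Tf => p.
  apply: (@fle_trans _ (qS * wS * (alphaS b p - al p) + phi * (SpS b p - SxS (b + M) p))); last first.
    by apply: fleD; apply: fleM2l => //; [exact: fle0M|exact: alphaS_err].
  have ws z : 0 <=p SpS b z - SxS (b + M) z.
    by apply/fsubr_ge0; apply: SxS_le_SpS.
  have as0 z : 0 <=p alphaS b z - al z by apply/fsubr_ge0; apply: al_le_alphaS.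
  apply: (le_killB (h := fun p => qS * wS * (alphaS b p - al p) + phi * (SpS b p - SxS (b + M) p))) => z.
    by apply: fle0D; apply: fle0M => //; exact: fle0M.
  have -> : fX R * Ks (alphaS b z) * SpS b z - fX R * Ks (al z) * SxS (b + M) z =
     (fX R * Ks (alphaS b z) - fX R * Ks (al z)) * SpS b z
     + fX R * Ks (al z) * (SpS b z - SxS (b + M) z) by ring.
  have [a0 aT] := alphaS_bound b z; have [s0 sw] := SpS_bound b z.
  apply: fleD.
    rewrite mulrAC; apply: fleM => //.
    - by apply/fsubr_ge0; apply: fleM2l; [exact: fle0fX|apply: le_Ks => //; exact: al_le_alphaS].
    - by apply: KsB => //; exact: al_le_alphaS.
  by apply: fleM2r => //; rewrite -KsT; apply: fleM2l; [exact: fle0fX|exact: le_Ks].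
rewrite -TfD !Tf_ErrS ErrSD remS_S.
rewrite (@eq_ErrS _ _ _ (fun g : nat => cS g.+1)) // => -[//|g] _.
by rewrite /= cS_S.
Qed.

Lemma ford_remS N : ford N (T * remS N).
Proof.
case: N => [|N]; first exact: ford0.
have pN := fordX (n := N) ford1_phi.
rewrite /remS mulrDr => k kN; rewrite fpsD (fordMl _ (fordMr _ (fordX ford1_phi))) // add0r.
rewrite mulrCA fnM /=.
have /(_ k kN) -> : ford (1 + N) (T * (qS * T * wS * phi ^+ N)); last exact: mulr0.
by apply: fordM; [exact: ford1T|apply: fordMl].
Qed.

(** [T * remS (b + M)] has order at least b + M > n, so at degree n only the sum over times is
    left. *)
Lemma SpS_coef_err b M y n : (n < b + M)%N ->
  (T * (SpS b y - SxS (b + M) y)) n <=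
  \sum_(b <= g < b + M) EA g.+1 y * (T * cS g.+1) n.
Proof.
move=> nM; apply: le_trans (fleM2l T_ge0 (SpS_err b M y) n) _.
rewrite /ErrS mulrDr fpsD (ford_remS nM) addr0 mulr_sumr fps_sum.
by apply: ler_sum => g _; rewrite fMC.
Qed.

End Space.

(** * Self-adjointness and the sum over starting points *)

Section Duality.
Context (I : eqType) (r : seq I) (th : I -> R)
  (th_sum : \sum_(z <- r) th z = 1) (V : finZmodType) (io : I -> V) (A : pred V).
Context (th_sym : forall (f : V -> fps R) y,
   \sum_(z <- r) fC (th z) * f (y - io z) = \sum_(z <- r) fC (th z) * f (y + io z)).
Context (al : V -> fps R) (alE : forall p, al p = Tf r th io (kill A (fun p => fX R * Fs (al p))) p).

Lemma Tf_sym (f g : V -> fps R) :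
  \sum_y f y * Tf r th io g y = \sum_y Tf r th io f y * g y.
Proof.
under eq_bigr do rewrite mulr_sumr.
rewrite exchange_big /=.
rewrite (eq_bigr (fun z => \sum_y fC (th z) * f (y - io z) * g y)); last first.
  move=> z _; rewrite (reindex_inj (addIr (- io z))) /=; apply: eq_bigr => y _.
  by rewrite subrK; ring.
rewrite exchange_big /=; apply: eq_bigr => y _.
by rewrite -mulr_suml th_sym.
Qed.

(* The operators of the equations of [HitS] and [SxS] are adjoint. *)
Lemma HitS_duality M n : (n < M)%N ->
  \sum_y HitS A al y n = \sum_(y | A y) (T * SxS r th io A al M y) n.
Proof.
move=> nM; pose E (f : V -> fps R) := kill A (fun p => fX R * Ks (al p) * f p).
have Esym f g y : E f y * g y = f y * E g y.
  by rewrite /E /kill; case: (A y); rewrite ?mul0r ?mulr0 //; ring.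
have HE y : HitS A al y = fC (A y)%:R * T + E (Tf r th io (HitS A al)) y.
  rewrite (HitE th_sum alE) /E /kill; case: (A y); first by rewrite fC1 mul1r addr0.
  have -> : fC 0 = 0 :> fps R by apply/funext => k; rewrite /fC mul0rn.
  by rewrite mul0r add0r.
set S := SxS r th io A al; set H := HitS A al.
have SS N y : S N.+1 y = 1 + Tf r th io (E (S N)) y by [].
(* The iterates converge in the X-adic sense, since each further step of the path carries a factor
   X. *)
have Sord N y : ford N (S N.+1 y - S N y).
  elim: N y => [|N IH] y; first exact: ford0.
  rewrite !SS opprD addrACA subrr add0r TfB => k kN.
  rewrite /Tf fps_sum big1 // => z _; rewrite fCM /E /kill.
  case: (A _); first by rewrite subrr mulr0.
  rewrite -mulrBr -mulrA -add1n in kN *.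
  by rewrite (fordM (@fordfX R) (fordMl _ (IH _))) ?mulr0.
(* The equation of [HitS] is paired with S M. Self-adjointness moves the operator onto S M, where it
   gives S M.+1 - 1; the difference S M.+1 - S M is invisible at degree n < M. *)
have key : \sum_y S M y * (fC (A y)%:R * T) + \sum_y (S M.+1 y - S M y) * H y = \sum_y H y.
  have -> : \sum_y S M y * (fC (A y)%:R * T) =
      \sum_y S M y * H y - \sum_y Tf r th io (E (S M)) y * H y.
    rewrite -Tf_sym -sumrB; apply: eq_bigr => y _.
    by rewrite Esym -mulrBr; congr (_ * _); rewrite {1}/H HE addrK.
  rewrite -sumrB -big_split; apply: eq_bigr => y _.
  by rewrite SS /=; ring.
have := congr1 (fun f : fps R => f n) key.
rewrite /= fpsD !fps_sum => <-; rewrite [X in _ + X]big1; last first.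
  by move=> y _; rewrite (fordMr _ (Sord M y)).
rewrite addr0 [RHS]big_mkcond; apply: eq_bigr => y _ /=.
rewrite mulrCA fCM; case: (A y); rewrite ?mul1r ?mul0r //.
by rewrite mulrC.
Qed.

End Duality.

End TreeSeries.

(** * A local limit theorem *)

Section Mass.
Context (R : realType).
Implicit Types f g : fps R.

Definition psum f (n : nat) : R := \sum_(i < n) f i.
(** The value of the series at X = 1. For a probability law f, the masses of [fD f] and [fD (fD f)]
    are the first two moments. *)
Definition mass f (m : R) := psum f @ \oo --> m.

Lemma psum_ge0 f n : 0 <=p f -> 0 <= psum f n.
Proof. by move=> f0; apply: sumr_ge0 => i _; apply: f0. Qed.

Lemma psum_le f m n : 0 <=p f -> (m <= n)%N -> psum f m <= psum f n.
Proof.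
move=> f0 mn; rewrite /psum -!(big_mkord xpredT f) [leRHS](@big_cat_nat _ _ _ m) //=.
by rewrite lerDl sumr_ge0 // => i _; apply: f0.
Qed.

Lemma mass_le f m n : 0 <=p f -> mass f m -> psum f n <= m.
Proof.
move=> f0 fm; rewrite -(cvg_lim (@Rhausdorff R) fm).
apply: nondecreasing_cvgn_le; last exact: cvgP fm.
by move=> i j; apply: psum_le.
Qed.

Lemma mass_ge0 f m : 0 <=p f -> mass f m -> 0 <= m.
Proof. by move=> f0 fm; have := mass_le 0 f0 fm; rewrite /psum big_ord0. Qed.

Lemma massD f g a b : mass f a -> mass g b -> mass (f + g) (a + b).
Proof.
move=> fa gb; rewrite /mass (_ : psum (f + g) = fun n => psum f n + psum g n).
  exact: cvgD.
by apply/funext => n; rewrite /psum -big_split.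
Qed.

Lemma massC f a c : mass f a -> mass (fC c * f) (c * a).
Proof.
move=> fa; rewrite /mass (_ : psum (fC c * f) = fun n => c * psum f n).
  exact: cvgMr.
by apply/funext => n; rewrite /psum mulr_sumr; apply: eq_bigr => i _; rewrite fCM.
Qed.

Lemma mass_nat f a n : mass f a -> mass (n%:R * f) (n%:R * a).
Proof. by rewrite -fC_nat; apply: massC. Qed.

Lemma psum_fin f N n : (forall i, (N <= i)%N -> f i = 0) -> (N <= n)%N -> psum f n = psum f N.
Proof.
move=> f0 Nn; rewrite /psum -!(big_mkord xpredT f) (big_cat_nat _ (n := N)) //=.
rewrite [X in _ + X]big_nat [X in _ + X]big1 ?addr0 // => i /andP[Ni _]; exact: f0.
Qed.

Lemma mass_fin f N : (forall i, (N <= i)%N -> f i = 0) -> mass f (psum f N).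
Proof.
move=> f0; apply: cvg_near_cst; exists N => // n /= Nn.
by rewrite (psum_fin f0).
Qed.

Lemma mass1 : mass 1 1.
Proof.
have := @mass_fin 1 1; rewrite {1}/psum big_ord1 fps1; apply => -[|i] //.
Qed.

Lemma massX : mass (@fX R) 1.
Proof.
have := @mass_fin (@fX R) 2; rewrite {1}/psum !big_ord_recl big_ord0 /fX /= add0r addr0.
by apply => -[|[|i]].
Qed.

Lemma triang_sum (F : nat -> nat -> R) N :
  \sum_(n < N) \sum_(i < n.+1) F i (n - i)%N = \sum_(i < N) \sum_(l < N - i) F i l.
Proof.
elim: N => [|N IH]; first by rewrite !big_ord0.
rewrite big_ord_recr /= IH big_ord_recr /= [RHS]big_ord_recr /= addrA; congr (_ + _).
  rewrite -big_split; apply: eq_bigr => i _ /=.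
  by rewrite subSn ?(ltnW (ltn_ord i)) // big_ord_recr.
by rewrite subnn subSnn big_ord1.
Qed.

Lemma psumM f g n : 0 <=p f -> 0 <=p g -> psum (f * g) n <= psum f n * psum g n.
Proof.
move=> f0 g0; rewrite /psum.
under eq_bigr do rewrite fpsM.
rewrite (triang_sum (fun i l => f i * g l)) mulr_suml; apply: ler_sum => i _.
rewrite -mulr_sumr; apply: ler_wpM2l; first exact: f0.
by apply: psum_le => //; apply: leq_subr.
Qed.

Lemma psumM2 f g n : 0 <=p f -> 0 <=p g -> psum f n * psum g n <= psum (f * g) (n + n).
Proof.
move=> f0 g0; rewrite /psum.
under [leRHS]eq_bigr do rewrite fpsM.
rewrite (triang_sum (fun i l => f i * g l)) big_split_ord /=.
apply: ler_wpDr.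
  by apply: sumr_ge0 => i _; apply: sumr_ge0 => l _; apply: mulr_ge0; [apply: f0|apply: g0].
rewrite mulr_suml; apply: ler_sum => i _; rewrite -mulr_sumr.
apply: ler_wpM2l; first exact: f0.
by apply: psum_le => //; rewrite -addnBA ?leq_addr // ltnW.
Qed.

(** Partial sums of the product are squeezed between products of partial sums: [psumM] from above,
    [psumM2] from below at twice the length. *)
Lemma massM f g a b : 0 <=p f -> 0 <=p g -> mass f a -> mass g b -> mass (f * g) (a * b).
Proof.
move=> f0 g0 fa gb.
have fg0 := fle0M f0 g0.
have nd : nondecreasing_seq (psum (f * g)) by move=> i j; apply: psum_le.
have ub n : psum (f * g) n <= a * b.
  apply: le_trans (psumM _ f0 g0) _.
  by apply: ler_pM; rewrite ?psum_ge0 // mass_le.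
have cv : cvgn (psum (f * g)).
  by apply: nondecreasing_is_cvgn => //; exists (a * b) => _ [n _ <-].
suff -> : a * b = limn (psum (f * g)) by [].
apply/eqP; rewrite eq_le; apply/andP; split; last first.
  by apply: limr_le => //; apply: nearW => n.
have <- := cvg_lim (@Rhausdorff R) (cvgM fa gb).
apply: limr_le; first by apply: cvgP; exact: cvgM fa gb.
apply: nearW => n /=; apply: le_trans (psumM2 _ f0 g0) _.
exact: nondecreasing_cvgn_le.
Qed.

Lemma massX_exp f a n : 0 <=p f -> mass f a -> mass (f ^+ n) (a ^+ n).
Proof.
move=> f0 fa; elim: n => [|n IH]; first exact: mass1.
by rewrite !exprS; apply: massM => //; apply: fle0X.
Qed.

Lemma fD_ge0 f : 0 <=p f -> 0 <=p fD f.
Proof. by move=> f0 k; apply: mulr_ge0 => //; apply: f0. Qed.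

Lemma massDX f a n : 0 <=p f -> mass f 1 -> mass (fD f) a ->
  mass (fD (f ^+ n)) (n%:R * a).
Proof.
move=> f0 f1 fa; rewrite fDX.
have : mass (f ^+ n.-1) 1 by rewrite -[1](expr1n _ n.-1); apply: massX_exp.
move=> m1; rewrite -mulrA -[a]mul1r.
by apply: mass_nat; apply: massM => //; [exact: fle0X|exact: fD_ge0].
Qed.

Lemma massD2X f a s n : 0 <=p f -> mass f 1 -> mass (fD f) a -> mass (fD (fD f)) s ->
  mass (fD (fD (f ^+ n))) (n%:R * s + n%:R * n.-1%:R * a ^+ 2).
Proof.
move=> f0 f1 fa fs.
have m1 k : mass (f ^+ k) 1 by rewrite -[1](expr1n _ k); apply: massX_exp.
have Df0 := fD_ge0 f0; have DDf0 := fD_ge0 Df0.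
have -> : fD (fD (f ^+ n)) = n%:R * (fD (f ^+ n.-1) * fD f + f ^+ n.-1 * fD (fD f)).
  by rewrite fDX -mulrA -fC_nat fDfC fDM.
have -> : n%:R * s + n%:R * n.-1%:R * a ^+ 2 = n%:R * (n.-1%:R * a * a + 1 * s) by ring.
apply: mass_nat; apply: massD; apply: massM => //.
- by apply: fD_ge0; apply: fle0X.
- exact: massDX.
- exact: fle0X.
Qed.

Definition l1 f (m : R) := forall n, \sum_(i < n) `|f i| <= m.

Lemma l1_ge0 f m : l1 f m -> 0 <= m.
Proof. by move=> /(_ 0%N); rewrite big_ord0. Qed.

Lemma l1_mass f m : 0 <=p f -> mass f m -> l1 f m.
Proof.
move=> f0 fm n; apply: le_trans (mass_le n f0 fm).
by apply: ler_sum => i _; rewrite ger0_norm //; apply: f0.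
Qed.

Lemma l1D f g a b : l1 f a -> l1 g b -> l1 (f + g) (a + b).
Proof.
move=> fa gb n; apply: le_trans (lerD (fa n) (gb n)).
by rewrite -big_split; apply: ler_sum => i _; apply: ler_normD.
Qed.

Lemma l1_sum (J : Type) (s : seq J) (F : J -> fps R) (m : J -> R) :
  (forall j, l1 (F j) (m j)) -> l1 (\sum_(j <- s) F j) (\sum_(j <- s) m j).
Proof.
move=> h; elim: s => [|j s IH]; last by rewrite !big_cons; apply: l1D.
by rewrite !big_nil => n; rewrite big1 // => i _; rewrite normr0.
Qed.

Lemma l1M f g a b : l1 f a -> l1 g b -> l1 (f * g) (a * b).
Proof.
move=> fa gb n.
apply: (@le_trans _ _ (\sum_(k < n) \sum_(i < k.+1) `|f i| * `|g (k - i)%N|)).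
  apply: ler_sum => k _; apply: le_trans (ler_norm_sum _ _ _) _.
  by apply: ler_sum => i _; rewrite normrM.
rewrite (triang_sum (fun i l => `|f i| * `|g l|)).
apply: (@le_trans _ _ ((\sum_(i < n) `|f i|) * b)).
  by rewrite mulr_suml; apply: ler_sum => i _; rewrite -mulr_sumr ler_wpM2l.
by apply: ler_wpM2r => //; apply: l1_ge0 gb.
Qed.

Lemma sup_l1M f g a b k : l1 f a -> (forall i, `|g i| <= b) -> `|(f * g) k| <= a * b.
Proof.
move=> fa gb; rewrite fpsM; apply: le_trans (ler_norm_sum _ _ _) _.
apply: (@le_trans _ _ ((\sum_(i < k.+1) `|f i|) * b)).
  by rewrite mulr_suml; apply: ler_sum => i _; rewrite normrM ler_wpM2l.
by apply: ler_wpM2r => //; apply: le_trans (gb 0%N).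
Qed.

(* A series is recovered from its increments by summation. *)
Lemma sup_grad f m k : l1 ((1 - @fX R) * f) m -> `|f k| <= m.
Proof.
move=> h; suff -> : f k = \sum_(i < k.+1) ((1 - @fX R) * f) i.
  by apply: le_trans (ler_norm_sum _ _ _) (h _).
have e i : ((1 - @fX R) * f) i = f i - (if i is i'.+1 then f i' else 0).
  rewrite mulrBl mul1r fpsB; case: i => [|i]; first by rewrite fXM0.
  by rewrite fXMS.
elim: k => [|k IH]; first by rewrite big_ord1 e subr0.
by rewrite big_ord_recr /= -IH e; ring.
Qed.

End Mass.

(** * Estimates for symmetric binomial laws *)

Section Binomial.
Context (R : realType).

Definition bet (m : nat) : fps R := fun l => 'C(m, l)%:R / 2 ^+ m.

Lemma bet_ge0 m : 0 <=p bet m.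
Proof. by move=> l; rewrite divr_ge0 // exprn_ge0. Qed.

Lemma bet1 : bet 1 = fC 2^-1 * (1 + @fX R).
Proof.
apply/funext => l; rewrite /bet fCM fpsD fps1 /fX expr1 mulrC; congr (_ * _).
by case: l => [|[|l]]; rewrite ?addr0 ?add0r.
Qed.

Lemma betE m : bet m = bet 1 ^+ m.
Proof.
elim: m => [|m IH]; apply/funext => l.
  by rewrite expr0 fps1 /bet expr0 invr1 mulr1; case: l.
rewrite exprS -IH bet1 -mulrA fCM mulrDl mul1r fpsD /bet.
case: l => [|l]; rewrite ?fXM0 ?fXMS.
  by rewrite !bin0 addr0 exprS invfM; ring.
by rewrite binS natrD exprS invfM; ring.
Qed.

Lemma betX j m : bet m ^+ j = bet (m * j).
Proof. by rewrite (betE m) -exprM -betE. Qed.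

Lemma mass_fD_X : mass (fD (@fX R)) 1.
Proof.
have -> : fD (@fX R) = fX R; last exact: massX.
by apply/funext => -[|[|l]]; rewrite /fD /fX ?mulr0 ?mul1r.
Qed.

Lemma mass_bet1 : [/\ mass (bet 1) 1, mass (fD (bet 1)) 2^-1 & mass (fD (fD (bet 1))) 2^-1].
Proof.
have e : 2^-1 * (1 + 1) = 1 :> R by rewrite mulVf // pnatr_eq0.
have DX : fD (@fX R) = fX R.
  by apply/funext => -[|[|l]]; rewrite /fD /fX ?mulr0 ?mul1r.
rewrite bet1; split.
- by have := massC (c := 2^-1) (massD (@mass1 R) (@massX R)); rewrite e.
- by rewrite fDfC fDD fD1 add0r DX; have := massC (c := 2^-1) (@massX R); rewrite mulr1.
- by rewrite !fDfC fDD fD1 add0r !DX; have := massC (c := 2^-1) (@massX R); rewrite mulr1.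
Qed.

Lemma mass_bet m : mass (bet m) 1.
Proof.
rewrite betE -[1](expr1n _ m); apply: massX_exp; first exact: bet_ge0.
by case: mass_bet1.
Qed.

Lemma mass_var (f : fps R) a s c : mass f 1 -> mass (fD f) a -> mass (fD (fD f)) s ->
  mass (fun l => (l%:R - c) ^+ 2 * f l) (s - 2 * c * a + c ^+ 2).
Proof.
move=> f1 fa fs.
have -> : (fun l => (l%:R - c) ^+ 2 * f l) =
   fD (fD f) + (fC (- (2 * c)) * fD f + fC (c ^+ 2) * f) :> fps R.
  by apply/funext => l; rewrite !fpsD !fCM /fD; ring.
have -> : s - 2 * c * a + c ^+ 2 = s + (- (2 * c) * a + c ^+ 2 * 1) by ring.
by do 2 apply: massD => //; apply: massC.
Qed.

Lemma mass_varX (f : fps R) a s k : 0 <=p f ->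
  mass f 1 -> mass (fD f) a -> mass (fD (fD f)) s ->
  mass (fun l => (l%:R - k%:R * a) ^+ 2 * (f ^+ k) l) (k%:R * (s - a ^+ 2)).
Proof.
move=> f0 f1 fa fs.
have -> : k%:R * (s - a ^+ 2) =
   (k%:R * s + k%:R * k.-1%:R * a ^+ 2) - 2 * (k%:R * a) * (k%:R * a) + (k%:R * a) ^+ 2.
  case: k => [|k] /=; first by ring.
  by rewrite -natr1; ring.
apply: mass_var; last exact: massD2X.
- by rewrite -[1](expr1n _ k); apply: massX_exp.
- exact: massDX.
Qed.

(** C(m, l) and C(m, l-1) are explicit fractions of C(m+1, l). The increment thus becomes a centred
    variable times the next binomial law, and its total variation a first absolute moment. *)
Lemma bet_grad m l : ((1 - @fX R) * bet m) l =
  2 / m.+1%:R * (m.+1%:R - 2 * l%:R) * bet m.+1 l.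
Proof.
have m0 : m.+1%:R != 0 :> R by rewrite pnatr_eq0.
have e2 : 2 ^+ m != 0 :> R by rewrite expf_eq0 pnatr_eq0 andbF.
have two : 2 != 0 :> R by rewrite pnatr_eq0.
rewrite mulrBl mul1r fpsB /bet exprS.
case: l => [|l].
  by rewrite fXM0 !bin0; move: (m.+1%:R : R) m0 => M M0; field; rewrite M0 e2.
rewrite fXMS.
have h1 : m.+1%:R * 'C(m, l)%:R = l.+1%:R * 'C(m.+1, l.+1)%:R :> R.
  by rewrite -!natrM mul_bin_diag.
have h2 : 'C(m.+1, l.+1)%:R = 'C(m, l.+1)%:R + 'C(m, l)%:R :> R by rewrite binS natrD.
have -> : 'C(m, l)%:R = l.+1%:R * 'C(m.+1, l.+1)%:R / m.+1%:R :> R by rewrite -h1 mulrC mulKf.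
have -> : 'C(m, l.+1)%:R = 'C(m.+1, l.+1)%:R - l.+1%:R * 'C(m.+1, l.+1)%:R / m.+1%:R :> R.
  by rewrite -h1 h2 mulrC mulKf // addrK.
by move: (m.+1%:R : R) m0 => M M0; field; rewrite M0 e2.
Qed.

Lemma amgm_abs (x s : R) : 0 < s -> `|x| <= 2^-1 * (x ^+ 2 / s + s).
Proof.
move=> s0; have := sqr_ge0 (`|x| - s); rewrite sqrrB real_normK ?num_real // => h.
rewrite -(ler_pM2r s0) (_ : 2^-1 * (x ^+ 2 / s + s) * s = 2^-1 * (x ^+ 2 + s ^+ 2)); last by field; rewrite gt_eqF.
by nra.
Qed.

(** [amgm_abs] with s = sqrt(m+1) bounds the first absolute moment of the centred binomial law by
    its variance. *)
Lemma l1_bet_grad m : l1 ((1 - @fX R) * bet m) (2 / Num.sqrt m.+1%:R).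
Proof.
move=> n; set M := m.+1%:R : R.
have M0 : 0 < M by rewrite ltr0n.
have s0 : 0 < Num.sqrt M by rewrite sqrtr_gt0.
have [b1 bD bDD] := mass_bet1.
have vM := mass_varX (k := m.+1) (@bet_ge0 1) b1 bD bDD; rewrite -betE -/M in vM.
have v0 : 0 <=p (fun l => (l%:R - M * 2^-1) ^+ 2 * bet m.+1 l).
  by move=> l; rewrite mulr_ge0 ?sqr_ge0 // bet_ge0.
apply: (@le_trans _ _ (\sum_(l < n) (2 / M * (2^-1 *
   (4 / Num.sqrt M * ((l%:R - M * 2^-1) ^+ 2 * bet m.+1 l) + Num.sqrt M * bet m.+1 l))))).
  apply: ler_sum => l _; rewrite bet_grad -/M 2!normrM.
  have -> : `|bet m.+1 l| = bet m.+1 l by rewrite ger0_norm // bet_ge0.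
  have -> : `|2 / M| = 2 / M by rewrite ger0_norm // ltW // divr_gt0.
  rewrite -mulrA ler_pM2l ?divr_gt0 //.
  apply: le_trans (ler_wpM2r (@bet_ge0 _ _) (amgm_abs _ s0)) _.
  by rewrite le_eqVlt; apply/orP; left; apply/eqP; field; rewrite gt_eqF.
rewrite -mulr_sumr -mulr_sumr big_split /= -!mulr_sumr.
have h1 := mass_le n v0 vM; have h2 := mass_le n (@bet_ge0 m.+1) (mass_bet m.+1).
apply: (@le_trans _ _ (2 / M * (2^-1 * (4 / Num.sqrt M * (M * (2^-1 - 2^-1 ^+ 2)) + Num.sqrt M * 1)))).
  rewrite ler_pM2l ?divr_gt0 // ler_pM2l ?invr_gt0 //.
  apply: lerD; rewrite ler_pM2l ?divr_gt0 //.
have e : M = Num.sqrt M ^+ 2 by rewrite sqr_sqrtr // ltW.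
move: e s0; clear; move: (Num.sqrt M) => S -> S0.
by rewrite le_eqVlt; apply/orP; left; apply/eqP; field; rewrite gt_eqF.
Qed.

(** C(k, j) / (j+1) = C(k+1, j+1) / (k+1) turns the sum into part of a binomial expansion of
    exponent k + 1. *)
Lemma binom_inv_sum (q p : R) k : 0 < q -> 0 <= p -> q + p = 1 ->
  \sum_(j < k.+1) ('C(k, j)%:R * q ^+ j * p ^+ (k - j)) / j.+1%:R <= (k.+1%:R * q)^-1.
Proof.
move=> q0 p0 qp.
have k0 : 0 < k.+1%:R :> R by rewrite ltr0n.
have : \sum_(j < k.+1) ('C(k.+1, j.+1)%:R * q ^+ j.+1 * p ^+ (k - j)) <= 1.
  apply: (@le_trans _ _ ((p + q) ^+ k.+1)); last by rewrite addrC qp expr1n.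
  rewrite [leRHS]exprDn [leRHS]big_ord_recl /=; apply: ler_wpDl.
    by rewrite mulrn_wge0 // mulr_ge0 ?exprn_ge0 // ltW.
  apply: ler_sum => j _; rewrite /bump /= add1n subSS -[leRHS]mulr_natl.
  by rewrite le_eqVlt; apply/orP; left; apply/eqP; ring.
move=> h; rewrite -[leRHS]mul1r ler_pdivlMr ?mulr_gt0 //.
apply: le_trans h; rewrite mulr_suml; apply: ler_sum => j _.
have j0 : j.+1%:R != 0 :> R by rewrite pnatr_eq0.
have e : 'C(k.+1, j.+1)%:R = k.+1%:R * 'C(k, j)%:R / j.+1%:R :> R.
  by rewrite -natrM mul_bin_diag natrM mulrC mulKf.
by rewrite e exprS le_eqVlt; apply/orP; left; apply/eqP; field.
Qed.

Lemma binom_sum1 (q p : R) k : q + p = 1 ->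
  \sum_(j < k.+1) ('C(k, j)%:R * q ^+ j * p ^+ (k - j)) = 1.
Proof.
move=> qp; transitivity ((p + q) ^+ k); last by rewrite addrC qp expr1n.
by rewrite exprDn; apply: eq_bigr => j _; rewrite -[RHS]mulr_natl; ring.
Qed.

(** The arithmetic-geometric inequality reduces to [binom_inv_sum]; its parameter 1/s is chosen so
    that both halves are at most 1/s. *)
Lemma binom_invsqrt_sum (q p : R) k : 0 < q -> 0 <= p -> q + p = 1 ->
  \sum_(j < k.+1) ('C(k, j)%:R * q ^+ j * p ^+ (k - j)) / Num.sqrt j.+1%:R
   <= (Num.sqrt (k.+1%:R * q))^-1.
Proof.
move=> q0 p0 qp; set s := Num.sqrt (k.+1%:R * q).
have k0 : 0 < k.+1%:R :> R by rewrite ltr0n.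
have s0 : 0 < s by rewrite sqrtr_gt0 mulr_gt0.
have e : k.+1%:R * q = s ^+ 2 by rewrite sqr_sqrtr // ltW // mulr_gt0.
apply: (@le_trans _ _ (\sum_(j < k.+1) (2^-1 * (s * (('C(k, j)%:R * q ^+ j * p ^+ (k - j)) / j.+1%:R)
   + s^-1 * ('C(k, j)%:R * q ^+ j * p ^+ (k - j)))))).
  apply: ler_sum => j _.
  have c0 : 0 <= 'C(k, j)%:R * q ^+ j * p ^+ (k - j).
    by rewrite !mulr_ge0 ?exprn_ge0 // ltW.
  have j0 : 0 < j.+1%:R :> R by rewrite ltr0n.
  have t0 : 0 < (Num.sqrt (j.+1%:R : R))^-1 by rewrite invr_gt0 sqrtr_gt0.
  have := amgm_abs (Num.sqrt (j.+1%:R : R))^-1 (s := s^-1).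
  rewrite invr_gt0 s0 (gtr0_norm t0) exprVn sqr_sqrtr ?(ltW j0) // invrK => /(_ isT) h.
  apply: le_trans (ler_wpM2l c0 h) _.
  by rewrite le_eqVlt; apply/orP; left; apply/eqP; ring.
rewrite -mulr_sumr big_split /= -!mulr_sumr binom_sum1 // mulr1.
have := binom_inv_sum k q0 p0 qp; rewrite e => h.
apply: (@le_trans _ _ (2^-1 * (s * (s ^+ 2)^-1 + s^-1))).
  by rewrite ler_pM2l ?invr_gt0 // lerD2r ler_pM2l.
by rewrite le_eqVlt; apply/orP; left; apply/eqP; field; rewrite gt_eqF.
Qed.

(** The elementary bound of C(2j, j) from below by 4^j / (2 sqrt j), squared to stay in nat. From k
    to k + 1 the square of the coefficient gains 4 (2k+1)^2 / (k+1)^2, which is at least 16 k /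
    (k+1). *)
Lemma central_bin j : (0 < j)%N -> (16 ^ j <= 4 * j * 'C(2 * j, j) ^ 2)%N.
Proof.
elim: j => // -[_|j IH] _; first by [].
have {IH} := IH isT; set k := j.+1; set c := 'C(_, _) => IH.
have e : (k.+1 * 'C(2 * k.+1, k.+1) = 2 * (2 * k).+1 * c)%N.
  have h1 := mul_bin_diag (2 * k).+2 k; have h2 := mul_bin_diag (2 * k).+1 k.
  have h3 : ('C((2 * k).+1, k) = 'C((2 * k).+1, k.+1))%N.
    by rewrite -(@bin_sub _ k.+1); [congr ('C(_, _)); lia|lia].
  have -> : (2 * k.+1 = (2 * k).+2)%N by lia.
  by rewrite /= in h1 h2; rewrite -/c in h2; nia.
set d := 'C(_, _) in e *.
have e2 : ((k.+1 * d) ^ 2 = (2 * (2 * k).+1 * c) ^ 2)%N by rewrite e.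
rewrite expnS; apply: (@leq_trans (16 * (4 * k * c ^ 2))); first by rewrite leq_mul2l.
rewrite -(@leq_pmul2r k.+1) //.
have -> : (4 * k.+1 * d ^ 2 * k.+1 = 4 * (k.+1 * d) ^ 2)%N by rewrite !expnS !expn0; ring.
rewrite e2; have -> : (4 * (2 * (2 * k).+1 * c) ^ 2 = 16 * ((2 * k).+1 ^ 2 * c ^ 2))%N.
  by rewrite !expnS !expn0; ring.
have -> : (16 * (4 * k * c ^ 2) * k.+1 = 16 * ((4 * k * k.+1) * c ^ 2))%N by ring.
rewrite leq_mul2l leq_mul2r /=; apply/orP; right.
by rewrite !expnS !expn0; lia.
Qed.

(** The ratio of consecutive coefficients is (j+x+1) / (j-x), at most 1 + 2(2x+1)/j as long as 2x <=
    j; and 2x^2 grows by 2(2x+1) at each step. *)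
Lemma bin_ratio (j x : nat) : (0 < j)%N -> (2 * x <= j)%N ->
  'C(2 * j, j)%:R <= 'C(2 * j, j + x)%:R * expR (2 * x%:R ^+ 2 / j%:R) :> R.
Proof.
move=> j0; have jR : 0 < j%:R :> R by rewrite ltr0n.
elim: x => [|x IH] xj; first by rewrite addn0 expr0n /= mulr0 mul0r expR0 mulr1.
apply: le_trans (IH _) _; first lia.
have -> : expR (2 * x.+1%:R ^+ 2 / j%:R) = expR (2 * x%:R ^+ 2 / j%:R) * expR (2 * (2 * x%:R + 1) / j%:R) :> R.
  by rewrite -expRD; congr expR; rewrite -natr1; field; rewrite gt_eqF.
rewrite [leRHS]mulrCA [leLHS]mulrC; apply: ler_wpM2l; first exact: expR_ge0.
have e : (j + x).+1%:R * 'C(2 * j, j + x.+1)%:R = (j%:R - x%:R) * 'C(2 * j, j + x)%:R :> R.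
  rewrite -natrB; last lia.
  rewrite -!natrM addnS -[X in _ = X%:R]mulnC; congr _%:R.
  have := mul_bin_left (2 * j) (j + x); rewrite mulnC => ->.
  by rewrite mulnC; congr (_ * _)%N; lia.
have jx : 0 < j%:R - x%:R :> R by rewrite subr_gt0 ltr_nat; lia.
rewrite -(ler_pM2l jx) -e mulrCA [leRHS]mulrC; apply: ler_wpM2r; first by [].
apply: le_trans (ler_wpM2l (ltW jx) (expR_ge1Dx _)).
have xj' : 2 * (x%:R + 1) <= j%:R :> R by rewrite natr1 -natrM ler_nat.
rewrite -natr1 natrD -subr_ge0.
have -> : (j%:R - x%:R) * (1 + 2 * (2 * x%:R + 1) / j%:R) - (j%:R + x%:R + 1) =
   (2 * x%:R + 1) * (j%:R - 2 * x%:R) / j%:R :> R by field; rewrite gt_eqF.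
have x0 : 0 <= x%:R :> R by [].
by apply: divr_ge0; [apply: mulr_ge0; lra|exact: ltW].
Qed.

Lemma bet_low (A : R) (j x : nat) : (0 < j)%N -> (2 * x <= j)%N ->
  x%:R ^+ 2 <= A * j%:R ->
  expR (- (2 * A)) / (2 * Num.sqrt j%:R) <= bet (2 * j) (j + x)%N /\
  expR (- (2 * A)) / (2 * Num.sqrt j%:R) <= bet (2 * j) (j - x)%N.
Proof.
move=> j0 xj xA; have jR : 0 < j%:R :> R by rewrite ltr0n.
have sj : 0 < Num.sqrt (j%:R : R) by rewrite sqrtr_gt0.
suff h : expR (- (2 * A)) / (2 * Num.sqrt j%:R) <= bet (2 * j) (j + x)%N.
  split=> //; rewrite /bet -bin_sub; last lia.
  by have -> : (2 * j - (j - x) = j + x)%N by lia.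
have e4 : 0 < 2 ^+ (2 * j) :> R by rewrite exprn_gt0.
rewrite ler_pdivrMr ?mulr_gt0 // /bet mulrAC ler_pdivlMr // expRN.
rewrite mulrC ler_pdivrMr ?expR_gt0 //.
have cR : 2 ^+ (2 * j) <= 2 * Num.sqrt j%:R * 'C(2 * j, j)%:R :> R.
  have h0 : 0 <= 2 * Num.sqrt j%:R * 'C(2 * j, j)%:R :> R.
    by do !apply: mulr_ge0 => //; apply: ltW.
  rewrite -ler_sqr ?nnegrE ?(ltW e4) // !exprMn sqr_sqrtr ?(ltW jR) //.
  have := central_bin j0; rewrite -(ler_nat R) natrM natrX natrM natrX.
  have -> : (2 ^+ (2 * j)) ^+ 2 = 16 ^+ j :> R.
    by rewrite -exprM (_ : (2 * j * 2 = 4 * j)%N); [rewrite exprM; congr (_ ^+ _); ring|lia].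
  by have -> : 2 ^+ 2 = 4 :> R by ring.
apply: le_trans cR _.
have -> : 'C(2 * j, j + x)%:R * (2 * Num.sqrt j%:R) * expR (2 * A) =
   2 * Num.sqrt j%:R * ('C(2 * j, j + x)%:R * expR (2 * A)) by ring.
apply: ler_wpM2l; first by apply: mulr_ge0 => //; apply: ltW.
apply: le_trans (bin_ratio j0 xj) _; apply: ler_wpM2l => //.
by rewrite ler_expR ler_pdivrMr // -mulrA ler_pM2l.
Qed.

End Binomial.

(** * Laws with a binomial component *)

Section Block.
Context (R : realType) (nu : fps R) (b : nat) (q : R) (G : fps R).
Context (q_gt0 : 0 < q) (q_le1 : q <= 1) (G_ge0 : 0 <=p G)
  (nuE : nu = G + fC q * (@fX R ^+ b * bet R 2)) (nu1 : mass nu 1).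

Let p := 1 - q.
Let p_ge0 : 0 <= p. Proof. by rewrite subr_ge0. Qed.
Let qp : q + p = 1. Proof. by rewrite /p addrC subrK. Qed.

Lemma mass_fXn n : mass (@fX R ^+ n) 1.
Proof. by rewrite -[1](expr1n _ n); apply: massX_exp; [exact: fle0fX|exact: massX]. Qed.

Lemma mass_G : mass G p.
Proof.
have e : G = nu + fC (- q) * (@fX R ^+ b * bet R 2).
  have -> : fC (- q) = - fC q by apply/funext => k; rewrite /fC mulNrn.
  by rewrite nuE mulNr addrK.
rewrite e /p -[X in 1 - X]mulr1 -mulNr; apply: massD => //; apply: massC.
rewrite -[1]mulr1; apply: massM; last exact: mass_bet.
- by apply: fle0X; apply: fle0fX.
- exact: bet_ge0.
- exact: mass_fXn.
Qed.

(** Weight of the event that exactly j of the k factors are the binomial component, the other k - j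
    being drawn from [G]. *)
Definition hB k j : fps R := fC ('C(k, j)%:R * q ^+ j) * G ^+ (k - j).

Lemma hB_ge0 k j : 0 <=p hB k j.
Proof.
by apply: fle0M; [apply: fle0fC; rewrite mulr_ge0 ?exprn_ge0 // ltW|apply: fle0X].
Qed.

Lemma mass_hB k j : mass (hB k j) ('C(k, j)%:R * q ^+ j * p ^+ (k - j)).
Proof. by apply: massC; apply: massX_exp => //; apply: mass_G. Qed.

Lemma hBX (B : fps R) k : (G + fC q * B) ^+ k = \sum_(j < k.+1) hB k j * B ^+ j.
Proof.
rewrite exprDn; apply: eq_bigr => j _.
have fCX n : fC q ^+ n = fC (q ^+ n).
  by elim: n => [|n IH]; rewrite ?expr0 // !exprS IH fC_is_monoid_morphism.
rewrite exprMn fCX /hB fC_is_monoid_morphism fC_nat -mulr_natl; ring.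
Qed.

Lemma nuX k : nu ^+ k = \sum_(j < k.+1) hB k j * (@fX R ^+ (b * j) * bet R (2 * j)).
Proof.
by rewrite nuE hBX; apply: eq_bigr => j _; rewrite exprMn -exprM betX.
Qed.

Lemma l1_le (f : fps R) a a' : a <= a' -> l1 f a -> l1 f a'.
Proof. by move=> aa' fa n; apply: le_trans aa'. Qed.

(** When j of the k factors are binomial, the increment has total variation O(1 / sqrt(j+1)). The
    number j is Binomial(k, q), and [binom_invsqrt_sum] takes the average. *)
Lemma l1_nu_grad k : l1 ((1 - @fX R) * nu ^+ k) (2 / Num.sqrt (k.+1%:R * q)).
Proof.
have -> : (1 - @fX R) * nu ^+ k =
   \sum_(j < k.+1) hB k j * (@fX R ^+ (b * j) * ((1 - @fX R) * bet R (2 * j))).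
  by rewrite nuX mulr_sumr; apply: eq_bigr => j _; ring.
apply: l1_le (_ : \sum_(j < k.+1) 'C(k, j)%:R * q ^+ j * p ^+ (k - j) * (1 * (2 / Num.sqrt j.+1%:R)) <= _) _.
  apply: le_trans (ler_wpM2l _ (binom_invsqrt_sum k q_gt0 p_ge0 qp)); last by [].
  rewrite mulr_sumr; apply: ler_sum => j _.
  by rewrite le_eqVlt; apply/orP; left; apply/eqP; ring.
apply: l1_sum => j; apply: l1M; first by apply: l1_mass; [exact: hB_ge0|exact: mass_hB].
apply: l1M; first by apply: l1_mass; [apply: fle0X; apply: fle0fX|exact: mass_fXn].
apply: l1_le (l1_bet_grad _ _).
rewrite ler_pM2l // lef_pV2 ?posrE ?sqrtr_gt0 ?ltr0n // ler_wsqrtr // ler_nat; lia.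
Qed.

Lemma fXnMr (F : fps R) j z : (F * @fX R ^+ j) z = if (z < j)%N then 0 else F (z - j)%N.
Proof.
elim: j z => [|j IH] z; first by rewrite expr0 mulr1 subn0.
rewrite exprS mulrCA; case: z => [|z]; first by rewrite fXM0.
by rewrite fXMS IH ltnS subSS.
Qed.

(** In [F * X^j] the law [B] is replaced by a point mass at j. An atom z of it in the window comes
    from z - j under [F], from which [B] reaches y with probability [B (y + j - z)], at least m. *)
Lemma conv_window (F B : fps R) j y N (w : pred nat) m : 0 <=p F -> 0 <=p B ->
  (forall z, w z -> (z <= y + j)%N /\ m <= B (y + j - z)%N) ->
  m * (\sum_(z < N | w z) (F * @fX R ^+ j) z) <= (F * B) y.
Proof.
move=> F0 B0 hw.
have G0 : 0 <=p F * @fX R ^+ j by apply: fle0M => //; apply: fle0X; apply: fle0fX.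
have [m0|m0] := lerP m 0.
  apply: (@le_trans _ _ 0); last exact: fle0M.
  by rewrite mulr_le0_ge0 //; apply: sumr_ge0 => z _; apply: G0.
have -> : \sum_(z < N | w z) (F * @fX R ^+ j) z = \sum_(z < N | w z && (z < y + j.+1)%N) (F * @fX R ^+ j) z.
  apply: eq_bigl => z; case wz : (w z) => //=; have [zy _] := hw _ wz.
  by rewrite addnS ltnS zy.
apply: (@le_trans _ _ (m * \sum_(z < j + y.+1 | w z) (F * @fX R ^+ j) z)).
  rewrite ler_pM2l //.
  pose H z := if w z && (z < y + j.+1)%N then (F * @fX R ^+ j) z else 0.
  have H0 z : 0 <= H z by rewrite /H; case: ifP => // _; apply: G0.
  rewrite big_mkcond /= [leRHS]big_mkcond /=.
  apply: (@le_trans _ _ (\sum_(z < N + (j + y.+1)) H z)).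
    by rewrite big_split_ord /= lerDl; apply: sumr_ge0.
  rewrite addnC big_split_ord /= [X in _ + X]big1 ?addr0; last first.
    by move=> i _; rewrite /H /= ifF //; apply/negP => /andP[_]; lia.
  apply: ler_sum => z _; rewrite /H; case: (w z) => //=; case: ifP => // _.
  exact: G0.
rewrite big_split_ord /= big1 ?add0r; last first.
  by move=> i _; rewrite fXnMr ltn_ord.
rewrite fpsM big_mkcond mulr_sumr; apply: ler_sum => i _.
case: ifP => [wi|_]; last by rewrite mulr0; apply: mulr_ge0; [apply: F0|apply: B0].
have [_] := hw _ wi; rewrite (_ : (y + j - (j + i) = y - i)%N); last lia.
rewrite fXnMr ltnNge leq_addr /= addKn mulrC => h.
by apply: ler_wpM2l => //; apply: F0.
Qed.

(** [nu] with its binomial component collapsed to the midpoint b + 1: the mean is unchanged, and the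
    spread of the binomial part is added back by [conv_window]. *)
Let hat := G + fC q * @fX R ^+ b.+1.

Lemma hatX k : hat ^+ k = \sum_(j < k.+1) hB k j * @fX R ^+ (b * j) * @fX R ^+ j.
Proof.
rewrite /hat hBX; apply: eq_bigr => j _.
by rewrite -exprM -mulrA -exprD; congr (_ * _ ^+ _); lia.
Qed.

Lemma hat_ge0 : 0 <=p hat.
Proof.
apply: fle0D => //; apply: fle0M; first by apply: fle0fC; apply: ltW.
by apply: fle0X; apply: fle0fX.
Qed.

Context (rho s : R) (nuD : mass (fD nu) rho) (nuDD : mass (fD (fD nu)) s).

Lemma massfC_N (f : fps R) a c : mass f a -> mass (- (fC c * f)) (- (c * a)).
Proof.
have -> : - (fC c * f) = fC (- c) * f.
  by apply/funext => k; rewrite -[LHS]/(- ((fC c * f) k)) !fCM mulNr.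
by move=> fa; rewrite -mulNr; apply: massC.
Qed.

Lemma mass_hat : exists s', [/\ mass hat 1, mass (fD hat) rho & mass (fD (fD hat)) s'].
Proof.
have X1 := @mass_fXn.
have b20 := @bet_ge0 R 2; have Xb0 : 0 <=p @fX R ^+ b by apply: fle0X; apply: fle0fX.
have fX0 := @fle0fX R.
have [b1 bD bDD] := @mass_bet1 R.
have D2 : mass (fD (bet R 2)) 1.
  rewrite betE (_ : 1 = 2%:R * 2^-1); last by rewrite mulfV // pnatr_eq0.
  by apply: massDX => //; apply: bet_ge0.
have DXn n : mass (fD (@fX R ^+ n)) n%:R.
  by rewrite -[n%:R]mulr1; apply: massDX => //; [exact: massX|exact: mass_fD_X].
have eD : fD hat = fD nu - fC q * fD (@fX R ^+ b * bet R 2) + fC q * fD (@fX R ^+ b.+1).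
  by rewrite /hat nuE !fDD !fDfC; ring.
have eDD : fD (fD hat) = fD (fD nu) - fC q * fD (fD (@fX R ^+ b * bet R 2)) + fC q * fD (fD (@fX R ^+ b.+1)).
  by rewrite /hat nuE !fDD !fDfC; ring.
have fin0 i : (b + 3 <= i)%N -> (@fX R ^+ b * bet R 2) i = 0.
  move=> bi; rewrite mulrC fXnMr; case: ifP => // _.
  by rewrite /bet bin_small ?mul0r //; lia.
have fin1 i : (b + 2 <= i)%N -> (@fX R ^+ b.+1) i = 0.
  move=> bi; rewrite -[_ ^+ _]mul1r fXnMr; case: ifP => // bi'.
  by rewrite fps1; case: eqP => //; lia.
exists (s - q * psum (fD (fD (@fX R ^+ b * bet R 2))) (b + 3)
   + q * psum (fD (fD (@fX R ^+ b.+1))) (b + 2)); split.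
- rewrite -[1]qp addrC; apply: massD; first exact: mass_G.
  by rewrite -[q in mass _ q]mulr1; apply: massC; apply: X1.
- rewrite eD (_ : rho = rho - q * (b%:R * 1 + 1 * 1) + q * b.+1%:R); last by rewrite -natr1; ring.
  apply: massD; last exact: massC.
  apply: massD => //; apply: massfC_N; rewrite fDM; apply: massD.
    by apply: massM => //; [exact: fD_ge0|exact: mass_bet].
  by apply: massM => //; exact: fD_ge0.
- rewrite eDD; apply: massD; last first.
    by apply: massC; apply: mass_fin => i bi; rewrite /fD fin1 ?mulr0.
  apply: massD => //; apply: massfC_N.
  by apply: mass_fin => i bi; rewrite /fD fin0 ?mulr0.
Qed.

(** Second moments suffice: Chebyshev keeps the collapsed walk [hat ^+ k] within O(sqrt k) of its
    mean; outside an event of probability 1/4, of order k factors are binomial; and their binomial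
    law has mass at least of order 1 / sqrt k at every target at distance O(sqrt k). *)
Lemma nu_lower (D0 : R) : 0 <= D0 -> exists2 c, 0 < c &
  exists k0, forall k y, (k0 <= k)%N -> `|y%:R - k%:R * rho| <= D0 ->
    c / Num.sqrt k%:R <= (nu ^+ k) y.
Proof.
move=> D00; have [s' [h1 hD hDD]] := mass_hat.
set v := s' - rho ^+ 2.
have v0 : 0 <= v.
  have h : mass (fun l => (l%:R - 1%:R * rho) ^+ 2 * (hat ^+ 1) l) (1%:R * (s' - rho ^+ 2)).
    by apply: mass_varX => //; apply: hat_ge0.
  rewrite !mul1r in h; apply: mass_ge0 h => l; rewrite expr1.
  by apply: mulr_ge0; [exact: sqr_ge0|exact: hat_ge0].
(* [B0] bounds (y - z)^2 / k: twice D0^2 for the target y, twice 4(v+1) for z in the window. [A]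
   below is [B0] divided by q/8, since good j are at least kq/8. *)
pose B0 := 2 * D0 ^+ 2 + 8 * (v + 1).
have B00 : 0 < B0 by rewrite /B0 ltr_wpDl ?mulr_ge0 ?sqr_ge0 // mulr_gt0 // ltr_wpDl.
pose A := 8 * B0 / q.
exists (expR (- (2 * A)) / 2 * (3 / 8)).
  by rewrite mulr_gt0 // divr_gt0 // expR_gt0.
(* k q >= 8 turns the bound on j + 1 into j >= kq/8; k q^2 >= 256 B0 then gives 2x <= j, as
   [bet_low] requires. *)
exists (maxn 1 (maxn (Num.bound (8 / q)) (Num.bound (256 * B0 / q ^+ 2)))) => k y.
rewrite !geq_max => /and3P[k1 kb1 kb2] yk.
have kR : 1 <= k%:R :> R by rewrite ler1n.
have k0 : 0 < k%:R :> R by rewrite ltr0n.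
have kq : 8 <= k%:R * q.
  rewrite -ler_pdivrMr //; apply: (@le_trans _ _ (Num.bound (8 / q))%:R); last by rewrite ler_nat.
  by apply/ltW/archi_boundP; rewrite divr_ge0 // ltW.
have kq2 : 256 * B0 <= k%:R * q ^+ 2.
  rewrite -ler_pdivrMr ?exprn_gt0 //.
  apply: (@le_trans _ _ (Num.bound (256 * B0 / q ^+ 2))%:R); last by rewrite ler_nat.
  by apply/ltW/archi_boundP; apply: divr_ge0; [apply: mulr_ge0 => //; exact: ltW|exact/exprn_ge0/ltW].
pose H2 := 4 * (v + 1) * k%:R.
have H20 : 0 < H2 by rewrite !mulr_gt0 // ltr_wpDl.
pose w (z : nat) := (z%:R - k%:R * rho) ^+ 2 <= H2.
pose good (j : nat) := k.+1%:R * q <= 4 * j.+1%:R.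
pose m := expR (- (2 * A)) / (2 * Num.sqrt k%:R).
have m0 : 0 <= m by rewrite divr_ge0 ?expR_ge0 // mulr_ge0 // sqrtr_ge0.
have hatk0 : 0 <=p hat ^+ k by apply: fle0X; apply: hat_ge0.
have hatk1 : mass (hat ^+ k) 1 by rewrite -[1](expr1n _ k); apply: massX_exp => //; apply: hat_ge0.
have [N hN] : exists N, 7 / 8 <= psum (hat ^+ k) N.
  have : \forall N \near \oo, 7 / 8 < psum (hat ^+ k) N.
    by apply: (cvgr_gt 1 hatk1) => /=; lra.
  by case=> N _ /(_ N (leqnn N)) /ltW; exists N.
(* Chebyshev with H2 = 4(v+1)k. With the cut at N and the bad j below, 7/8 - 1/4 - 1/4 = 3/8 of the
   mass remains. *)
have tail : \sum_(z < N | ~~ w z) (hat ^+ k) z <= 1 / 4.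
  have vk := mass_le N _ (mass_varX (k := k) hat_ge0 h1 hD hDD).
  have {}vk := vk (fun l => mulr_ge0 (sqr_ge0 _) (hatk0 l)).
  rewrite -(ler_pM2l H20) mulr_sumr big_mkcond.
  apply: (@le_trans _ _ (k%:R * v)); last first.
    by rewrite /H2; have := v0; nra.
  apply: le_trans vk; apply: ler_sum => z _.
  case: ifP => [|_]; last by apply: mulr_ge0; [exact: sqr_ge0|exact: hatk0].
  by rewrite /w -ltNge => /ltW h; exact: (ler_wpM2r (hatk0 z) h).
have body : 5 / 8 <= \sum_(z < N | w z) (hat ^+ k) z.
  by move: hN tail; rewrite /psum (bigID (fun z : 'I_N => w z)) /=; lra.
pose P j : fps R := hB k j * @fX R ^+ (b * j) * @fX R ^+ j.
have P0 j : 0 <=p P j.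
  rewrite /P; apply: fle0M; last by apply: fle0X; exact: fle0fX.
  by apply: fle0M; [exact: hB_ge0|apply: fle0X; exact: fle0fX].
(* Markov's inequality for 1/(j+1), whose mean is at most 1 / ((k+1)q) by [binom_inv_sum]. *)
have bad : \sum_(j < k.+1 | ~~ good j) \sum_(z < N | w z) P j z <= 1 / 4.
  apply: (@le_trans _ _ (\sum_(j < k.+1 | ~~ good j) 'C(k, j)%:R * q ^+ j * p ^+ (k - j))).
    apply: ler_sum => j _.
    apply: (@le_trans _ _ (psum (P j) N)).
      by rewrite /psum big_mkcond; apply: ler_sum => z _; case: ifP => // _; apply: P0.
    apply: mass_le => //.
    have X0 i : 0 <=p @fX R ^+ i by apply: fle0X; exact: fle0fX.
    have := massM (fle0M (hB_ge0 k j) (X0 (b * j)%N)) (X0 j)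
      (massM (hB_ge0 k j) (X0 (b * j)%N) (@mass_hB k j) (@mass_fXn (b * j)%N)) (@mass_fXn j).
    by rewrite !mulr1.
  have kq0 : 0 < k.+1%:R * q by rewrite mulr_gt0 // ltr0n.
  have := binom_inv_sum k q_gt0 p_ge0 qp; rewrite -[leRHS]mul1r ler_pdivlMr // => h.
  apply: (@le_trans _ _ (4^-1 * ((\sum_(j < k.+1) 'C(k, j)%:R * q ^+ j * p ^+ (k - j) / j.+1%:R) * (k.+1%:R * q)))); last by lra.
  rewrite big_mkcond mulr_suml mulr_sumr; apply: ler_sum => j _.
  have c0 : 0 <= 'C(k, j)%:R * q ^+ j * p ^+ (k - j).
    by rewrite !mulr_ge0 ?exprn_ge0 // ltW.
  have j0 : 0 < j.+1%:R :> R by rewrite ltr0n.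
  case: ifP => [|_]; last first.
    by apply: mulr_ge0 => //; apply: mulr_ge0; [apply: divr_ge0 => //; exact: ltW|exact: ltW].
  rewrite /good -ltNge => /ltW gj.
  have -> : 4^-1 * ('C(k, j)%:R * q ^+ j * p ^+ (k - j) / j.+1%:R * (k.+1%:R * q)) =
     'C(k, j)%:R * q ^+ j * p ^+ (k - j) * ((k.+1%:R * q) / (4 * j.+1%:R)).
    by move: (j.+1%:R : R) j0 => J J0; field; rewrite gt_eqF.
  rewrite -[leLHS]mulr1; apply: ler_wpM2l => //.
  by rewrite ler_pdivlMr ?mulr_gt0 // mul1r.
have main : 3 / 8 <= \sum_(j < k.+1 | good j) \sum_(z < N | w z) P j z.
  have : \sum_(z < N | w z) (hat ^+ k) z = \sum_(j < k.+1) \sum_(z < N | w z) P j z.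
    by rewrite exchange_big /=; apply: eq_bigr => z _; rewrite hatX fps_sum.
  rewrite (bigID (fun j : 'I_k.+1 => good j)) /=; lra.
apply: (@le_trans _ _ (m * (3 / 8))).
  rewrite le_eqVlt; apply/orP; left; apply/eqP; rewrite /m; field.
  by rewrite gt_eqF // sqrtr_gt0.
apply: le_trans (ler_wpM2l m0 main) _.
rewrite nuX fps_sum mulr_sumr big_mkcond; apply: ler_sum => j _.
case: ifP => [gj|_]; last first.
  apply: fle0M; first exact: hB_ge0.
  by apply: fle0M; [apply: fle0X; exact: fle0fX|exact: bet_ge0].
rewrite mulrA /P; apply: conv_window.
- by apply: fle0M; [exact: hB_ge0|apply: fle0X; exact: fle0fX].
- exact: bet_ge0.
move=> z wz.
pose x := ((y - z) + (z - y))%N.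
have xR : x%:R = `|y%:R - z%:R| :> R.
  rewrite /x natrD; case: (leqP y z) => yz.
    rewrite (eqP (_ : y - z == 0)%N) ?subn_eq0 // add0r natrB // distrC ger0_norm //.
    by rewrite subr_ge0 ler_nat.
  rewrite (eqP (_ : z - y == 0)%N) ?subn_eq0 1?ltnW // addr0 natrB 1?ltnW // ger0_norm //.
  by rewrite subr_ge0 ler_nat ltnW.
have x2 : x%:R ^+ 2 <= B0 * k%:R.
  rewrite xR real_normK ?num_real //.
  have y2 : (y%:R - k%:R * rho) ^+ 2 <= D0 ^+ 2.
    by rewrite -real_normK ?num_real // ler_sqr ?nnegrE.
  move: wz; rewrite /w /H2 => wz.
  have D2 : D0 ^+ 2 <= D0 ^+ 2 * k%:R by rewrite ler_peMr // sqr_ge0.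
  have := sqr_ge0 ((y%:R - k%:R * rho) + (z%:R - k%:R * rho)).
  by rewrite /B0; nra.
have jk : k%:R * q / 8 <= j%:R.
  move: gj kq; rewrite /good -(natr1 k) -(natr1 j) mulrDl mul1r => gj kq'.
  by have := q_gt0; lra.
have j0 : 0 < j%:R :> R by apply: lt_le_trans jk; rewrite divr_gt0 // mulr_gt0.
have xA : x%:R ^+ 2 <= A * j%:R.
  apply: le_trans x2 _; rewrite /A -mulrA; apply: (@le_trans _ _ (8 * B0 / q * (k%:R * q / 8))).
    by rewrite le_eqVlt; apply/orP; left; apply/eqP; field; rewrite gt_eqF.
  by rewrite -!mulrA !ler_pM2l // ?invr_gt0 // mulrA.
have xj : (2 * x <= j)%N.
  rewrite -(ler_nat R) natrM -ler_sqr ?nnegrE ?mulr_ge0 // exprMn.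
  apply: (@le_trans _ _ ((k%:R * q / 8) ^+ 2)); last first.
    rewrite ler_sqr ?nnegrE ?(ltW j0) //.
    by apply: divr_ge0 => //; apply: mulr_ge0; exact: ltW.
  have -> : (k%:R * q / 8) ^+ 2 = k%:R * (k%:R * q ^+ 2) / 64 :> R by field.
  nra.
have [|hp hm] := bet_low _ xj xA; first by rewrite -(ltr_nat R).
have mj : m <= expR (- (2 * A)) / (2 * Num.sqrt j%:R).
  rewrite /m ler_pM2l ?expR_gt0 // lef_pV2 ?posrE ?mulr_gt0 ?sqrtr_gt0 //.
  by rewrite ler_pM2l // ler_wsqrtr // ler_nat -ltnS.
split; first by move: xj; rewrite /x; clear; lia.
apply: le_trans mj _.
case: (leqP z y) => yz.
  have -> : (y + j - z = j + x)%N by move: yz; rewrite /x; clear; lia.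
  by [].
have -> : (y + j - z = j - x)%N by move: yz xj; rewrite /x; clear; lia.
by [].
Qed.

End Block.

(** * Smoothness and lower bound for the walk with step law [mu] *)

Section LocalLimit.
Context (R : realType) (mu : fps R) (mu_ge0 : 0 <=p mu) (mu1 : mass mu 1)
  (muD : mass (fD mu) 1) (s : R) (muDD : mass (fD (fD mu)) s) (mu00 : 0 < mu 0%N).
Context (r b : nat) (r_gt0 : (0 < r)%N) (h0 : 0 < (mu ^+ r) b)
  (h1 : 0 < (mu ^+ r) b.+1) (h2 : 0 < (mu ^+ r) b.+2).

Let nu := mu ^+ r.

(** q is the least of three consecutive atoms of [mu ^+ r]; the two-step binomial law shifted by b
    lives on these atoms and is at most 1 there, so q times it can be subtracted. *)
Lemma block_decomposition : exists q G, [/\ 0 < q, q <= 1, 0 <=p G &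
  nu = G + fC q * (@fX R ^+ b * bet R 2)].
Proof.
pose q := Num.min (nu b) (Num.min (nu b.+1) (nu b.+2)).
have q0 : 0 < q by rewrite !lt_min h0 h1 h2.
have nu_ge0 : 0 <=p nu by apply: fle0X.
have nu1 : mass nu 1 by rewrite -[1](expr1n _ r); apply: massX_exp.
have q1 : q <= 1.
  apply: (@le_trans _ _ (nu b)); first by rewrite ge_min lexx.
  apply: le_trans (mass_le b.+1 nu_ge0 nu1); rewrite /psum big_ord_recr /= lerDr.
  exact: psum_ge0.
exists q, (nu - fC q * (@fX R ^+ b * bet R 2)); split => //; last by rewrite subrK.
move=> i; rewrite fpsB subr_ge0 fCM mulrC.
have e : (@fX R ^+ b * bet R 2) i = if (i < b)%N then 0 else bet R 2 (i - b)%N.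
  by rewrite mulrC fXnMr.
have ble j : bet R 2 j <= 1.
  apply: le_trans (mass_le j.+1 (@bet_ge0 R 2) (@mass_bet R 2)).
  by rewrite /psum big_ord_recr /= lerDr; apply: psum_ge0; apply: bet_ge0.
rewrite e; case: ltnP => ib; first by rewrite mul0r nu_ge0.
have [j ->] : exists j, i = (b + j)%N by exists (i - b)%N; rewrite subnKC.
rewrite addKn; case: (ltnP j 3) => j3; last first.
  by rewrite /bet bin_small // !mul0r nu_ge0.
apply: (@le_trans _ _ q); first by rewrite ler_piMl // ltW.
by case: j j3 {ib e} => [|[|[|//]]] _; rewrite ?addn0 ?addn1 ?addn2 /q !ge_min lexx ?orbT.
Qed.

Lemma mass_muX n : mass (mu ^+ n) 1.
Proof. by rewrite -[1](expr1n _ n); apply: massX_exp. Qed.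

Lemma muX_le1 n k : (mu ^+ n) k <= 1.
Proof.
have m0 : 0 <=p mu ^+ n by apply: fle0X.
apply: le_trans (mass_le k.+1 m0 (mass_muX n)).
by rewrite /psum big_ord_recr /= lerDr; apply: psum_ge0.
Qed.

(** Full blocks of r factors do the smoothing; convolution with the n %% r remaining factors does
    not increase the total variation. *)
Lemma l1_grad : exists2 C, 0 < C &
  forall n, l1 ((1 - @fX R) * mu ^+ n) (C / Num.sqrt n.+1%:R).
Proof.
have [q [G [q0 q1 G0 nuE]]] := block_decomposition.
have rR : 0 < r%:R :> R by rewrite ltr0n.
exists (2 * Num.sqrt (r%:R / q)); first by rewrite mulr_gt0 // sqrtr_gt0 divr_gt0.
move=> n; set k := (n %/ r)%N.
have -> : (1 - @fX R) * mu ^+ n = ((1 - @fX R) * nu ^+ k) * mu ^+ (n %% r).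
  by rewrite -mulrA -exprM -exprD {1}(divn_eq n r) mulnC.
have := l1M (l1_nu_grad q0 q1 G0 nuE (mass_muX r) k)
  (l1_mass (fle0X (n %% r) mu_ge0) (mass_muX (n %% r))).
rewrite mulr1; apply: l1_le.
have kR : 0 < k.+1%:R :> R by rewrite ltr0n.
have nR : 0 < n.+1%:R :> R by rewrite ltr0n.
rewrite -mulrA ler_pM2l // ler_pdivlMr ?sqrtr_gt0 // mulrC ler_pdivrMr ?sqrtr_gt0 ?mulr_gt0 //.
rewrite -sqrtrM; last by rewrite divr_ge0 // ltW.
rewrite ler_wsqrtr // (_ : r%:R / q * (k.+1%:R * q) = (r * k.+1)%:R); last first.
  by rewrite natrM; field; rewrite gt_eqF.
by rewrite ler_nat mulnC /k ltn_ceil.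
Qed.

Lemma sup_muX : exists2 C, 0 < C & forall n k, (mu ^+ n) k <= C / Num.sqrt n.+1%:R.
Proof.
have [C C0 hC] := l1_grad; exists C => // n k.
by apply: le_trans (sup_grad k (hC n)); apply: ler_norm.
Qed.

(** Half of the steps smooth, with total variation O(n^(-1/2)); the other half spread, with supremum
    O(n^(-1/2)). *)
Lemma grad_muX : exists2 C, 0 < C &
  forall n k, `|((1 - @fX R) * mu ^+ n) k| <= C / n.+1%:R.
Proof.
have [C C0 hC] := l1_grad; exists (2 * C ^+ 2); first by rewrite mulr_gt0 ?exprn_gt0.
move=> n k; set m := (n./2)%N; set m' := (n - m)%N.
have nm : n = (m + m')%N by rewrite /m' /m; lia.
have -> : (1 - @fX R) * mu ^+ n = ((1 - @fX R) * mu ^+ m) * mu ^+ m'.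
  by rewrite -mulrA -exprD -nm.
apply: le_trans (sup_l1M k (hC m) (fun i => sup_grad i (hC m'))) _.
have mR : 0 < m.+1%:R :> R by rewrite ltr0n.
have mR' : 0 < m'.+1%:R :> R by rewrite ltr0n.
rewrite mulf_div -expr2 -sqrtrM ?(ltW mR) //.
have -> : 2 * C ^+ 2 / n.+1%:R = C ^+ 2 * (2 / n.+1%:R) by ring.
rewrite ler_pM2l ?exprn_gt0 // ler_pdivlMr ?ltr0n // mulrC ler_pdivrMr ?sqrtr_gt0 ?mulr_gt0 //.
rewrite -[leLHS]ger0_norm // -sqrtr_sqr -[X in _ <= X * _]ger0_norm // -[X in _ <= X * _]sqrtr_sqr.
rewrite -sqrtrM ?sqr_ge0 // ler_wsqrtr //.
rewrite -!natrX -!natrM ler_nat.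
have : (n.+1 <= 2 * m.+1)%N /\ (n.+1 <= 2 * m'.+1)%N by rewrite /m' /m; lia.
by case=> a1 a2; have := leq_mul a1 a2; rewrite !expnS !expn0; lia.
Qed.

(** The n %% r steps outside the k blocks are forced to be 0, at a price of at least mu(0)^r; the
    target n - 1 is then within r of the mean kr of the blocks. *)
Lemma lower_muX : exists2 c, 0 < c &
  exists n0, forall n, (n0 <= n)%N -> c / Num.sqrt n%:R <= (mu ^+ n) n.-1.
Proof.
have [q [G [q0 q1 G0 nuE]]] := block_decomposition.
have nuD : mass (fD nu) (r%:R * 1) by apply: massDX.
have nuDD := massD2X (n := r) mu_ge0 mu1 muD muDD.
have rR : 0 <= r%:R :> R by [].
have [c c0 [k0 hk]] := nu_lower q0 q1 G0 nuE (mass_muX r) nuD nuDD rR.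
exists (mu 0%N ^+ r * c); first by rewrite mulr_gt0 // exprn_gt0.
exists (r * maxn 1 k0)%N => n nk; set k := (n %/ r)%N.
have kk : (maxn 1 k0 <= k)%N by rewrite leq_divRL // mulnC.
have [k1 kk0] : (0 < k)%N /\ (k0 <= k)%N by apply/andP; rewrite -geq_max.
have n1 : (0 < n)%N by apply: leq_trans nk; rewrite muln_gt0 r_gt0 leq_max.
have e : mu ^+ n = mu ^+ (n %% r) * nu ^+ k.
  by rewrite -exprM -exprD {1}(divn_eq n r) mulnC addnC.
have mu0i i : mu 0%N ^+ i <= (mu ^+ i) 0%N.
  elim: i => [|i IH]; first by rewrite !expr0 fps1.
  by rewrite !exprS fpsM big_ord1 ler_pM2l.
have mu0le : mu 0%N <= 1 by have := muX_le1 1 0; rewrite expr1.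
rewrite e fpsM big_ord_recl /= subn0 -[leLHS]addr0 lerD //; last first.
  by apply: sumr_ge0 => i _; apply: mulr_ge0; apply: fle0X => //; apply: fle0X.
rewrite -mulrA; apply: ler_pM.
- by rewrite exprn_ge0 // ltW.
- by rewrite divr_ge0 ?sqrtr_ge0 // ltW.
- apply: le_trans (mu0i _); apply: ler_wiXn2l => //; first exact: ltW.
  by rewrite ltnW // ltn_mod.
have kR : 0 < k%:R :> R by rewrite ltr0n.
apply: (@le_trans _ _ (c / Num.sqrt k%:R)).
  rewrite ler_pM2l // lef_pV2 ?posrE ?sqrtr_gt0 ?ltr0n //.
  by rewrite ler_wsqrtr // ler_nat leq_div.
apply: hk => //; rewrite mulr1 -natrM.
have -> : n.-1%:R = (k * r)%:R + (n %% r)%:R - 1 :> R.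
  by rewrite -natrD -divn_eq -[in RHS](prednK n1) -natr1 addrK.
have -> : (k * r)%:R + (n %% r)%:R - 1 - (k * r)%:R = (n %% r)%:R - 1 :> R by ring.
have : (n %% r < r)%N by rewrite ltn_mod.
rewrite -(ler_nat R) -natr1 => hr; have : 0 <= (n %% r)%:R :> R by [].
have : 1 <= r%:R :> R by rewrite ler1n.
by rewrite ler_norml; lra.
Qed.

Local Notation W := (Wd mu).

Lemma Wd_ge0 n L : 0 <= W n L.
Proof. by rewrite /Wd; case: ifP => // _; apply: fle0X. Qed.

Lemma Wd_grad (n L : nat) (G : R) : 0 <= G ->
  (forall k, `|((1 - @fX R) * mu ^+ n) k| <= G) -> `|W n L - W n L.+1| <= G.
Proof.
move=> G0 hG; rewrite /Wd; case: (ltngtP n L) => [nL|nL|nL].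
- by rewrite subrr normr0.
- have := hG (n - L)%N; rewrite mulrBl mul1r fpsB.
  rewrite (_ : (n - L = (n - L.+1).+1)%N); last lia.
  by rewrite fXMS.
- by have := hG 0%N; rewrite -nL mulrBl mul1r fpsB fXM0 !subr0 subnn.
Qed.

Lemma Wd_gradL (n L c : nat) (G : R) : 0 <= G ->
  (forall k, `|((1 - @fX R) * mu ^+ n) k| <= G) -> `|W n (L + c) - W n L| <= c%:R * G.
Proof.
move=> G0 hG; elim: c => [|c IH]; first by rewrite addn0 subrr normr0 mul0r.
rewrite -natr1 mulrDl mul1r addnS.
have -> : W n (L + c).+1 - W n L = (W n (L + c) - W n L) - (W n (L + c) - W n (L + c).+1) by ring.
apply: le_trans (ler_normB _ _) _; apply: lerD => //.
exact: Wd_grad.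
Qed.

Lemma mu_tail N : N%:R * (1 - psum mu N) <= 1.
Proof.
have cv : (fun M => N%:R * (psum mu M - psum mu N)) @ \oo --> N%:R * (1 - psum mu N).
  by apply: cvgMr; apply: cvgB => //; apply: cvg_cst.
rewrite -(cvg_lim (@Rhausdorff R) cv); apply: limr_le; first exact: cvgP cv.
exists N => // M /= NM.
have := mass_le M (fD_ge0 mu_ge0) muD.
rewrite /psum -!(big_mkord xpredT (mu : nat -> R)) -(big_mkord xpredT (fD mu)).
have -> : \sum_(0 <= i < M) mu i - \sum_(0 <= i < N) mu i = \sum_(N <= i < M) mu i.
  by rewrite (@big_cat_nat _ _ _ N) //= addrAC subrr add0r.
rewrite (@big_cat_nat _ _ _ N) //= => h.
apply: le_trans h; apply: ler_wpDl.
  by rewrite big_mkord; apply: sumr_ge0 => i _; apply: fD_ge0.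
rewrite mulr_sumr; apply: ler_sum_nat => i /andP[Ni _].
by rewrite /fD; apply: ler_wpM2r; [exact: mu_ge0|rewrite ler_nat].
Qed.

(** The second bound uses mean one: a step c moves L by c at the cost of c gradients, and c has mean
    1. [mu_tail] covers the steps beyond the range of [Wd_S]. *)
Lemma Wd_step : exists2 K, 0 < K & forall n L,
  `|W n L - W n L.+1| <= K / n.+1%:R /\ `|W n.+1 L.+1 - W n L| <= K / n.+1%:R.
Proof.
have [C C0 hC] := grad_muX; have [C' C'0 hC'] := sup_muX.
have nR n : 0 < n.+1%:R :> R by rewrite ltr0n.
exists (C + 1); first by rewrite addr_gt0.
move=> n L; have G0 : 0 <= C / n.+1%:R by rewrite divr_ge0 // ltW.
split.
  apply: le_trans (Wd_grad L G0 (hC n)) _.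
  by rewrite ler_pM2r ?invr_gt0 // lerDl.
rewrite Wd_S.
have -> : \sum_(c < n.+3) mu c * W n (L + c) - W n L =
   \sum_(c < n.+3) mu c * (W n (L + c) - W n L) - (1 - psum mu n.+3) * W n L.
  rewrite /psum mulrBl mul1r mulr_suml opprB addrA -big_split /=; congr (_ - _).
  by apply: eq_bigr => c _; ring.
apply: le_trans (ler_normB _ _) _; rewrite [leRHS]mulrDl; apply: lerD.
  apply: le_trans (ler_norm_sum _ _ _) _.
  apply: (@le_trans _ _ (psum (fD mu) n.+3 * (C / n.+1%:R))).
    rewrite /psum mulr_suml; apply: ler_sum => c _.
    rewrite normrM ger0_norm ?mu_ge0 // /fD [c%:R * _]mulrC -mulrA.
    by apply: ler_wpM2l; [exact: mu_ge0|exact: Wd_gradL].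
  rewrite -[leRHS]mul1r; apply: ler_wpM2r => //.
  by apply: mass_le => //; apply: fD_ge0.
have t0 : 0 <= 1 - psum mu n.+3 by rewrite subr_ge0; apply: mass_le.
rewrite ger0_norm ?mulr_ge0 ?Wd_ge0 //.
apply: (@le_trans _ _ ((1 - psum mu n.+3) * 1)).
  apply: ler_wpM2l => //; rewrite /Wd; case: ifP => // _; exact: muX_le1.
rewrite mulr1 ler_pdivlMr ?ltr0n // mulrC.
apply: le_trans (mu_tail n.+3); apply: ler_wpM2r => //.
by rewrite ler_nat; lia.
Qed.

Lemma Wd_lower : exists2 c, 0 < c &
  exists n0, forall n, (n0 <= n)%N -> c / Num.sqrt n%:R <= W n 1.
Proof.
have [c c0 [n0 h]] := lower_muX; exists c => //; exists (maxn 1 n0) => n.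
by rewrite geq_max => /andP[n1 nn0]; rewrite /Wd n1 subn1; apply: h.
Qed.

Lemma Wd_upper : exists2 C, 0 < C & forall n L, W n L <= C / Num.sqrt n.+1%:R.
Proof.
have [C C0 h] := sup_muX; exists C => // n L; rewrite /Wd; case: ifP => // _.
by rewrite divr_ge0 ?sqrtr_ge0 // ltW.
Qed.

Lemma cvg_inv_sqrt : (fun n : nat => (Num.sqrt (n%:R : R))^-1) @ \oo --> (0 : R).
Proof.
apply/cvgrPdist_lt => e e0; exists (Num.bound (e ^- 2)).+1 => // n /= hn.
have n0 : 0 < n%:R :> R by rewrite ltr0n; apply: leq_trans hn.
rewrite sub0r normrN ger0_norm ?invr_ge0 ?sqrtr_ge0 // -[e]invrK.
rewrite ltf_pV2 ?posrE ?invr_gt0 ?sqrtr_gt0 //.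
rewrite -[e^-1]gtr0_norm ?invr_gt0 // -sqrtr_sqr ltr_sqrt // exprVn.
apply: lt_le_trans (_ : (Num.bound (e ^- 2))%:R <= _).
  by apply: archi_boundP; rewrite invr_ge0 exprn_ge0 // ltW.
by rewrite ler_nat ltnW.
Qed.

(** Numerator and denominator differ by O(1/n) while the denominator is at least c / sqrt n, so the
    ratio is 1 + O(n^(-1/2)). *)
Lemma Wd_ratio a L : (fun n => W (n - a)%N L / W n 1) @ \oo --> (1 : R).
Proof.
have [K K0 hK] := Wd_step; have [c c0 [n0 hc]] := Wd_lower.
have nR n : 0 < n.+1%:R :> R by rewrite ltr0n.
(* moving by one in either direction costs O(1/n) *)
have step n l : `|W n.+1 l - W n l| <= 2 * K / n.+1%:R.
  have [h3 h4] := hK n l; have [h5 h6] := hK n.+1 l.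
  have h7 : K / n.+2%:R <= K / n.+1%:R by rewrite ler_pM2l // lef_pV2 ?posrE // ler_nat.
  have -> : W n.+1 l - W n l = (W n.+1 l - W n.+1 l.+1) + (W n.+1 l.+1 - W n l) by ring.
  apply: le_trans (ler_normD _ _) _; rewrite -mulrA mulr2n mulrDl mul1r.
  exact: lerD (le_trans h5 h7) h4.
have stepa n i l : `|W (n + i) l - W n l| <= i%:R * (2 * K / n.+1%:R).
  elim: i => [|i IH]; first by rewrite addn0 subrr normr0 mul0r.
  have -> : W (n + i.+1) l - W n l = (W (n + i).+1 l - W (n + i) l) + (W (n + i) l - W n l).
    by rewrite addnS; ring.
  apply: le_trans (ler_normD _ _) _; rewrite -natr1 mulrDl mul1r addrC; apply: lerD => //.
  apply: le_trans (step _ _) _; rewrite ler_pM2l ?mulr_gt0 // lef_pV2 ?posrE // ler_nat.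
  by rewrite ltnS leq_addr.
have stepL n l : `|W n l - W n 0| <= l%:R * (2 * K / n.+1%:R).
  elim: l => [|l IH]; first by rewrite subrr normr0 mul0r.
  have [h3 _] := hK n l.
  have -> : W n l.+1 - W n 0 = (W n l - W n 0) - (W n l - W n l.+1) by ring.
  apply: le_trans (ler_normB _ _) _; rewrite -natr1 mulrDl mul1r; apply: lerD => //.
  apply: le_trans h3 _; rewrite ler_pM2r ?invr_gt0 // ler_peMl ?ltW //.
  by rewrite ltr1n.
have tot n : (2 * a <= n)%N -> `|W (n - a) L - W n 1| <= (a + L + 1)%:R * (4 * K / n.+1%:R).
  move=> an; set m := (n - a)%N; have em : n = (m + a)%N by rewrite /m subnK //; lia.
  have -> : W m L - W n 1 = (W m L - W m 0) - (W m 1 - W m 0) - (W (m + a) 1 - W m 1).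
    by rewrite -em; ring.
  apply: le_trans (ler_normB _ _) _; rewrite addnAC -addnA addnC natrD mulrDl addrC.
  have hm : 2 * K / m.+1%:R <= 4 * K / n.+1%:R.
    have -> : 4 * K / n.+1%:R = 2 * K * (2 / n.+1%:R) by ring.
    rewrite ler_pM2l ?mulr_gt0 // ler_pdivlMr // mulrC ler_pdivrMr //.
    by rewrite -natrM ler_nat; lia.
  apply: lerD.
    by rewrite [(a + m)%N]addnC; apply: le_trans (stepa _ _ _) _; apply: ler_wpM2l.
  apply: le_trans (ler_normB _ _) _; rewrite natrD mulrDl addrC; apply: lerD.
    by apply: le_trans (stepL _ _) _; apply: ler_wpM2l.
  by apply: le_trans (stepL _ _) _; apply: ler_wpM2l.
set B := (a + L + 1)%:R * (4 * K) / c.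
have lim0 : (fun n : nat => B * (Num.sqrt (n%:R : R))^-1) @ \oo --> (0 : R).
  by rewrite -[X in _ --> X](mulr0 B); apply: cvgMr; exact: cvg_inv_sqrt.
apply/cvgrPdist_lt => e e0.
have /cvgrPdist_lt /(_ e e0) [N _ hN] := lim0.
exists (maxn (maxn 1 N) (maxn (2 * a) n0)) => // n /=.
rewrite !geq_max => /andP[/andP[n1 nN] /andP[na nn0]].
have n_0 : 0 < n%:R :> R by rewrite ltr0n.
have sn : 0 < Num.sqrt (n%:R : R) by rewrite sqrtr_gt0.
have wn := hc n nn0; have w0 : 0 < W n 1 by apply: lt_le_trans wn; rewrite divr_gt0.
have := hN n nN; rewrite /= sub0r normrN => /(le_lt_trans (ler_norm _)); apply: le_lt_trans.
rewrite -[X in X - _](divff (lt0r_neq0 w0)) -mulrBl normrM normfV (gtr0_norm w0).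
rewrite ler_pdivrMr // distrC; apply: le_trans (tot n na) _.
apply: (@le_trans _ _ (B / Num.sqrt n%:R * (c / Num.sqrt n%:R))); last first.
  apply: ler_wpM2l => //; rewrite divr_ge0 ?sqrtr_ge0 // /B divr_ge0 ?(ltW c0) //.
  by rewrite !mulr_ge0 // ltW.
have -> : B / Num.sqrt n%:R * (c / Num.sqrt n%:R) = (a + L + 1)%:R * (4 * K / Num.sqrt n%:R ^+ 2).
  by rewrite /B; field; rewrite !gt_eqF.
rewrite sqr_sqrtr ?(ltW n_0) //; apply: ler_wpM2l => //.
by rewrite ler_pM2l ?mulr_gt0 // lef_pV2 ?posrE // ler_nat.
Qed.

End LocalLimit.

(** * Heat kernel bound on the torus *)

Section Separated.
Context (R : realType).

Lemma sum_separated (F : nat -> R) (P : pred nat) g n M : (forall i, 0 <= F i) ->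
  (forall t t', P t -> P t' -> (t < t')%N -> (t + g <= t')%N) ->
  (forall t, P t -> (t < n)%N -> (t + g <= M)%N) ->
  \sum_(t < n | P t) \sum_(i < g) F (t + i)%N <= \sum_(l < M) F l.
Proof.
move=> F0 sep; elim: n M => [|n IH] M hM; first by rewrite big_ord0 sumr_ge0.
rewrite big_mkcond big_ord_recr /= -big_mkcond /=.
case: ifP => Pn; last first.
  by rewrite addr0; apply: IH => t Pt tn; apply: hM => //; apply: leqW.
have nM : (n + g <= M)%N by apply: hM.
apply: (@le_trans _ _ (\sum_(l < n + g) F l)).
  rewrite big_split_ord /=; apply: lerD => //; apply: IH => t Pt tn; exact: sep.
rewrite -!(big_mkord xpredT F) [leRHS](@big_cat_nat _ _ _ (n + g)%N) //=.
by rewrite lerDl sumr_ge0.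
Qed.

(* A binomial law gives mass O(1/g + 1/sqrt m) to a g-separated set. *)
Lemma bet_separated m (P : pred nat) g : (0 < g)%N ->
  (forall t t', P t -> P t' -> (t < t')%N -> (t + g <= t')%N) ->
  forall n, \sum_(t < n | P t) bet R m t <= g%:R^-1 + 2 / Num.sqrt m.+1%:R.
Proof.
move=> g0 sep n; have gR : 0 < g%:R :> R by rewrite ltr0n.
pose D l : R := `|((1 - @fX R) * bet R m) l|.
have inc t i : bet R m t <= bet R m (t + i)%N + \sum_(l < i) D (t + l.+1)%N.
  elim: i => [|i IH]; first by rewrite addn0 big_ord0 addr0.
  apply: le_trans IH _; rewrite big_ord_recr /= addrCA addrC lerD2r.
  rewrite /D addnS mulrBl mul1r fpsB fXMS.
  have := ler_norm (- (bet R m (t + i).+1 - bet R m (t + i)%N)); rewrite normrN; lra.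
have win t : g%:R * bet R m t <= \sum_(i < g) bet R m (t + i)%N + g%:R * \sum_(l < g) D (t + l)%N.
  have -> : g%:R * bet R m t = \sum_(i < g) bet R m t by rewrite sumr_const card_ord mulr_natl.
  have -> : g%:R * (\sum_(l < g) D (t + l)%N) = \sum_(i < g) \sum_(l < g) D (t + l)%N.
    by rewrite [RHS]sumr_const card_ord mulr_natl.
  rewrite -big_split; apply: ler_sum => i _; apply: le_trans (inc t i) _; apply: lerD => //.
  rewrite -(big_mkord xpredT (fun l => D (t + l.+1)%N)) -(big_add1 _ _ 0 i.+1 xpredT (fun l => D (t + l)%N)).
  rewrite -(big_mkord xpredT (fun l => D (t + l)%N)) (@big_cat_nat _ _ _ 1 0 g) //=.
  rewrite (@big_cat_nat _ _ _ i.+1 1 g) //=.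
  rewrite addrCA lerDl addr_ge0 // sumr_ge0 // => l _; exact: normr_ge0.
rewrite -(ler_pM2l gR) mulrDr mulfV ?gt_eqF // mulr_sumr.
apply: (@le_trans _ _ (\sum_(t < n | P t) (\sum_(i < g) bet R m (t + i)%N + g%:R * \sum_(l < g) D (t + l)%N))).
  by apply: ler_sum => t _.
rewrite big_split /=; apply: lerD.
  apply: le_trans (mass_le (n + g) (@bet_ge0 R m) (@mass_bet R m)).
  apply: sum_separated => // [i|t Pt tn]; first exact: bet_ge0.
  by rewrite leq_add2r ltnW.
rewrite -mulr_sumr ler_pM2l //; apply: le_trans (l1_bet_grad R m (n + g)).
apply: (sum_separated (F := D)) => // [i|t Pt tn]; first exact: normr_ge0.
by rewrite leq_add2r ltnW.
Qed.

End Separated.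

(** * Averages over pairs of opposite steps *)

Section Averaging.
Context (R : realType) (V : zmodType).
Implicit Types (f : V -> R) (v y : V).

Definition Av v f y : R := 2^-1 * (f (y + v) + f (y - v)).

Lemma Av_iter m v f y : iter m (Av v) f y =
  \sum_(t < m.+1) bet R m t * f (y + (v *+ (2 * t) - v *+ m)).
Proof.
elim: m y => [|m IH] y.
  rewrite big_ord1 /bet bin0 expr0 invr1 !mul1r muln0 !mulr0n subr0 addr0 //.
rewrite iterS /Av !IH [RHS]big_ord_recl /=.
pose G t := f (y + (v *+ (2 * t) - v *+ m.+1)).
have e1 t : f (y + v + (v *+ (2 * t) - v *+ m)) = G t.+1.
  rewrite /G; congr f; rewrite (_ : 2 * t.+1 = (2 * t).+2)%N; last lia.
  rewrite !mulrS opprD -!addrA; congr (_ + _).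
  by rewrite [_ *+ _ + (- v + _)]addrCA addNKr.
have e2 t : f (y - v + (v *+ (2 * t) - v *+ m)) = G t.
  by rewrite /G; congr f; rewrite mulrS opprD -!addrA; congr (_ + _); rewrite addrCA.
under eq_bigr do rewrite e1.
under [X in _ * (_ + X)]eq_bigr do rewrite e2.
rewrite -[f (y + _)]/(G 0%N).
have -> : \sum_(i < m.+1) bet R m.+1 (bump 0 i) * f (y + (v *+ (2 * bump 0 i) - v *+ m.+1)) =
   \sum_(i < m.+1) 2^-1 * (bet R m i.+1 + bet R m i) * G i.+1.
  apply: eq_bigr => i _; rewrite /bump /= add1n -/(G _); congr (_ * _).
  by rewrite /bet binS natrD exprS invfM; ring.
have -> : bet R m.+1 0 = 2^-1 * bet R m 0 by rewrite /bet !bin0 exprS invfM; ring.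
have -> : \sum_(i < m.+1) bet R m i * G i =
    bet R m 0 * G 0%N + \sum_(i < m.+1) bet R m i.+1 * G i.+1.
  have b0 : bet R m m.+1 = 0 by rewrite /bet bin_small // mul0r.
  rewrite big_ord_recl /= [in RHS]big_ord_recr /= b0 mul0r addr0.
  by congr (_ + _); apply: eq_bigr.
rewrite !mulrDr !mulr_sumr addrCA mulrA; congr (_ + _).
by rewrite -big_split; apply: eq_bigr => i _ /=; ring.
Qed.

Context (I : eqType) (r : seq I) (th : I -> R) (th_ge0 : forall z, 0 <= th z)
  (th_sum : \sum_(z <- r) th z = 1) (io : I -> V)
  (th_sym : forall f y, \sum_(z <- r) th z * f (y - io z) = \sum_(z <- r) th z * f (y + io z)).

Local Notation T := (Tr r th io).

(** By symmetry the step operator is a mixture of averages over pairs of opposite steps, from which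
    single directions can be isolated. *)
Lemma TrAv f y : T f y = \sum_(z <- r) th z * Av (io z) f y.
Proof.
have e : T f y = 2^-1 * (T f y + \sum_(z <- r) th z * f (y - io z)).
  by rewrite th_sym -/(T f y); field.
by rewrite e -big_split mulr_sumr; apply: eq_bigr => z _; rewrite /Av /=; ring.
Qed.

Lemma Tr_le f S y : (forall y, f y <= S) -> T f y <= S.
Proof.
move=> fS; rewrite -[S]mul1r -th_sum mulr_suml; apply: ler_sum => z _.
by apply: ler_wpM2l.
Qed.

Lemma Av_le v f S y : (forall y, f y <= S) -> Av v f y <= S.
Proof. by move=> fS; rewrite /Av; have := fS (y + v); have := fS (y - v); lra. Qed.

(** Only the direction z keeps its average; all other directions are bounded by the supremum. *)
Lemma Tr_split z f S y : z \in r -> (forall y, f y <= S) ->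
  T f y <= th z * Av (io z) f y + (1 - th z) * S.
Proof.
move=> zr fS; rewrite TrAv (perm_big _ (perm_to_rem zr)) /= big_cons lerD2l.
have -> : 1 - th z = \sum_(z' <- rem z r) th z'.
  by rewrite -th_sum (perm_big _ (perm_to_rem zr)) big_cons addrC addKr.
rewrite mulr_suml; apply: ler_sum => z' _; apply: ler_wpM2l => //.
exact: Av_le.
Qed.

Lemma Av_Tr v f y : Av v (T f) y = T (Av v f) y.
Proof.
rewrite /Av /Tr -big_split mulr_sumr; apply: eq_bigr => z _ /=.
have -> : y + v + io z = y + io z + v by rewrite addrAC.
have -> : y - v + io z = y + io z - v by rewrite addrAC.
ring.
Qed.

Lemma iterAv_Tr v m f : iter m (Av v) (T f) = T (iter m (Av v) f).
Proof.
elim: m f => // m IH f; rewrite !iterS IH; apply/funext => y; exact: Av_Tr.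
Qed.

Definition AvL (L : seq (V * nat)) f := foldr (fun vm g => iter vm.2 (Av vm.1) g) f L.

Lemma AvL_Tr L f : AvL L (T f) = T (AvL L f).
Proof. by elim: L => // -[v m] L /= ->; rewrite iterAv_Tr. Qed.

Lemma AvL_iterTr L f l : AvL L (iter l T f) = iter l T (AvL L f).
Proof. by elim: l => // l IH; rewrite !iterS AvL_Tr IH. Qed.

Lemma iterTr_le f S l y : (forall y, f y <= S) -> iter l T f y <= S.
Proof. by move=> fS; elim: l y => // l IH y; apply: Tr_le. Qed.

Definition binavg (q : R) (S : nat -> R) l := \sum_(m < l.+1) 'C(l, m)%:R * q ^+ m * (1 - q) ^+ (l - m) * S m.

Lemma binavgS q S l : binavg q S l.+1 = q * binavg q (fun m => S m.+1) l + (1 - q) * binavg q S l.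
Proof.
rewrite /binavg big_ord_recl /=.
pose G m := q ^+ m.+1 * (1 - q) ^+ (l - m) * S m.+1.
have -> : \sum_(i < l.+1) 'C(l.+1, bump 0 i)%:R * q ^+ bump 0 i * (1 - q) ^+ (l.+1 - bump 0 i) * S (bump 0 i)
  = \sum_(i < l.+1) ('C(l, i.+1)%:R * G i + 'C(l, i)%:R * G i).
  by apply: eq_bigr => i _; rewrite /bump /= add1n binS natrD subSS /G; ring.
rewrite big_split /= addrA addrC; congr (_ + _).
  by rewrite mulr_sumr; apply: eq_bigr => i _; rewrite /G exprS; ring.
rewrite [in RHS]big_ord_recl /= mulrDr !subn0 !bin0; congr (_ + _); first by rewrite exprS; ring.
rewrite big_ord_recr /= bin_small // mul0r addr0 mulr_sumr; apply: eq_bigr => i _.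
rewrite /bump /= add1n /G.
have -> : (l - i = (l - i.+1).+1)%N by have := ltn_ord i; lia.
by rewrite (exprS (1 - q)); ring.
Qed.

(** Each of the l steps is kept as an average along z with weight [th z], raising the argument of
    [S] by one, and is otherwise bounded away; the number of kept steps is binomial, hence
    [binavg]. *)
Lemma iterTr_block z f S : z \in r -> th z <= 1 ->
  (forall m y, iter m (Av (io z)) f y <= S m) ->
  forall l m y, iter m (Av (io z)) (iter l T f) y <= binavg (th z) (fun i => S (m + i)%N) l.
Proof.
move=> zr z1 hS; elim=> [|l IH] m y.
  by rewrite /binavg big_ord1 bin0 !expr0 !mul1r addn0.
rewrite iterS iterAv_Tr binavgS.
apply: le_trans (Tr_split (S := binavg (th z) (fun i => S (m + i)%N) l) _ zr _) _; first exact: IH.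
rewrite lerD2r; apply: ler_wpM2l => //.
rewrite -[Av _ (iter m _ _) y]/(iter m.+1 (Av (io z)) (iter l T f) y).
have -> : (fun i => S (m + i.+1)%N) = (fun i => S (m.+1 + i)%N).
  by apply/funext => i; rewrite addSnnS.
exact: IH.
Qed.

Lemma iterTr_blockm z f S l y : z \in r -> th z <= 1 ->
  (forall m y, iter m (Av (io z)) f y <= S m) -> iter l T f y <= binavg (th z) S l.
Proof. by move=> zr z1 hS; have := iterTr_block zr z1 hS l 0 y. Qed.

End Averaging.

Section Decoupling.
Context (R : realType) (d : nat) (V Z : zmodType) (coo : 'I_d -> V -> Z)
  (cooD : forall i x y, coo i (x + y) = coo i x + coo i y)
  (cooN : forall i x, coo i (- x) = - coo i x)
  (v : 'I_d -> V) (e : Z) (coov : forall i j, coo i (v j) = if i == j then e else 0).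

(** [v j] moves only the coordinate [coo j], so averaging along it acts on a single factor of the
    product. *)
Lemma iterAv_prod j m (h : 'I_d -> Z -> R) y :
  iter m (Av (v j)) (fun y => \prod_i h i (coo i y)) y =
  \prod_i (if i == j then iter m (Av e) (h j) else h i) (coo i y).
Proof.
have E (K : Z -> R) y' : \prod_i (if i == j then K else h i) (coo i y') =
    K (coo j y') * \prod_(i | i != j) h i (coo i y').
  rewrite (bigD1 j) //= eqxx; congr (_ * _).
  by apply: eq_bigr => i ij; rewrite (negbTE ij).
elim: m y => [|m IH] y; first by rewrite E /= (bigD1 j).
rewrite iterS /Av !IH !E.
have e1 (c : V) : (forall i, i != j -> coo i c = 0) ->
   \prod_(i | i != j) h i (coo i (y + c)) = \prod_(i | i != j) h i (coo i y).
  by move=> hc; apply: eq_bigr => i ij; rewrite cooD hc // addr0.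
rewrite !e1; last 2 first.
- by move=> i ij; rewrite cooN coov (negbTE ij) oppr0.
- by move=> i ij; rewrite coov (negbTE ij).
by rewrite !cooD cooN coov eqxx -mulrDl mulrA.
Qed.

Lemma AvL_prod (L : seq 'I_d) (m : 'I_d -> nat) (h : 'I_d -> Z -> R) y : uniq L ->
  AvL [seq (v i, m i) | i <- L] (fun y => \prod_i h i (coo i y)) y =
  \prod_i (if i \in L then iter (m i) (Av e) (h i) else h i) (coo i y).
Proof.
elim: L y => [|j L IH] y //= /andP[jL uL].
pose h' i := if i \in L then iter (m i) (Av e) (h i) else h i.
have -> : AvL [seq (v i, m i) | i <- L] (fun y => \prod_i h i (coo i y)) =
  fun y => \prod_i h' i (coo i y) by apply/funext => y'; apply: IH.
rewrite iterAv_prod; apply: eq_bigr => i _; rewrite inE /h'.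
by case: eqP => [->|//]; rewrite (negbTE jL).
Qed.

End Decoupling.

Section TorusHeat.
Context (R : realType) (d : nat) (theta : 'rV[int]_d -> R) (sl : seq 'rV[int]_d).
Context (th_ge0 : forall z, 0 <= theta z) (th_sum : \sum_(z <- sl) theta z = 1).
Context (M : 'M[int]_d) (Msl : forall i, row i M \in sl) (Mth : forall i, 0 < theta (row i M))
  (detM : \det M != 0).

Section FixN.
Context (N : nat) (N_gt1 : (1 < N)%N).
Context (th_sym : forall (f : torus d N -> R) y,
  \sum_(z <- sl) theta z * f (y - torus_proj N z) =
  \sum_(z <- sl) theta z * f (y + torus_proj N z)).

Local Notation V := (torus d N).
Local Notation T := (Tr sl theta (@torus_proj d N)).
Let D := absz (\det M).

(* The adjugate decouples the directions [row i M] up to the factor det M. *)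
Definition coo (i : 'I_d) (x : V) : 'Z_N := (x *m map_mx intr (\adj M)) 0 i.
Let v i : V := torus_proj N (row i M).

Lemma cooD i x y : coo i (x + y) = coo i x + coo i y.
Proof. by rewrite /coo mulmxDl mxE. Qed.

Lemma cooN i x : coo i (- x) = - coo i x.
Proof. by rewrite /coo mulNmx mxE. Qed.

Lemma coov i j : coo i (v j) = if i == j then (\det M)%:~R else 0.
Proof.
rewrite /coo /v /torus_proj -map_mxM -row_mul mul_mx_adj !mxE.
by rewrite eq_sym; case: (i == j); rewrite ?mulr1n ?mulr0n.
Qed.

(** Bound for the atoms of m symmetric steps of size det M on Z/N: an equidistributed part of order
    1/N and a diffusive part. *)
Definition sM (m : nat) : R := 4 * D%:R / N%:R + 2 / Num.sqrt m.+1%:R.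

Lemma D_gt0 : (0 < D)%N.
Proof. by rewrite /D absz_gt0. Qed.

Lemma sM_ge0 m : 0 <= sM m.
Proof. by rewrite addr_ge0 // divr_ge0 ?mulr_ge0 ?sqrtr_ge0. Qed.

Lemma dvd_of_Z (n : nat) : (\det M)%:~R *+ n = 0 :> 'Z_N -> (N %| D * n)%N.
Proof.
have e : (\det M)%:~R *+ n = 0 :> 'Z_N -> (D * n)%:R = 0 :> 'Z_N.
  rewrite /D natrM; case: (\det M) => k /=.
    by rewrite -pmulrn -[_ *+ n]mulr_natr.
  by rewrite NegzE mulrNz -pmulrn mulNrn => /eqP; rewrite oppr_eq0 => /eqP; rewrite -[_ *+ n]mulr_natr.
move=> /e /(congr1 (@nat_of_ord _)); rewrite val_Zp_nat // => h.
by rewrite /dvdn h.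
Qed.

(** Two numbers t < t' of positive steps leading to the same point satisfy N | 2D(t' - t), so they
    are at least N / (2D) apart, and [bet_separated] applies with this gap. *)
Lemma iterAv_delta (c s : 'Z_N) m :
  iter m (Av (\det M)%:~R) (fun s => (s == c)%:R) s <= sM m.
Proof.
rewrite Av_iter.
pose P (t : nat) := s + ((\det M)%:~R *+ (2 * t) - (\det M)%:~R *+ m) == c.
pose g := maxn 1 (N %/ (2 * D)).
have g0 : (0 < g)%N by rewrite leq_max.
have D0 := D_gt0.
have sep t t' : P t -> P t' -> (t < t')%N -> (t + g <= t')%N.
  move=> /eqP pt /eqP pt' tt'.
  have : (\det M)%:~R *+ (2 * (t' - t)) = 0 :> 'Z_N.
    rewrite mulnBr mulrnBr; last by rewrite leq_mul2l ltnW.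
    apply/eqP; rewrite subr_eq0; apply/eqP.
    by move: pt'; rewrite -pt => /addrI /addIr.
  move/dvd_of_Z => /dvdn_leq h; have {h} : (N <= D * (2 * (t' - t)))%N.
    by apply: h; rewrite !muln_gt0 D0 subn_gt0.
  move=> h; rewrite -leq_subRL ?(ltnW tt') // geq_max subn_gt0 tt' /=.
  rewrite -(@leq_pmul2r (2 * D)) ?muln_gt0 ?D0 //.
  by apply: leq_trans (leq_trunc_div _ _) _; apply: leq_trans h _; have -> : (D * (2 * (t' - t)) = (t' - t) * (2 * D))%N by ring.
apply: (@le_trans _ _ (\sum_(t < m.+1 | P t) bet R m t)).
  rewrite [leRHS]big_mkcond /=; apply: ler_sum => t _; rewrite -/(P t).
  by case: (P t); rewrite ?mulr1 ?mulr0.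
apply: le_trans (@bet_separated R m P g g0 sep m.+1) _; rewrite lerD2r.
have NR : 0 < N%:R :> R by rewrite ltr0n ltnW.
have gR : 0 < g%:R :> R by rewrite ltr0n.
rewrite -[leLHS]mul1r ler_pdivrMr // mulrAC ler_pdivlMr // mul1r -!natrM ler_nat.
rewrite /g; have := ltn_ceil N (isT : (0 < 1)%N) => _.
have := ltn_ceil N (d := 2 * D); rewrite muln_gt0 D0 => /(_ isT).
case: (N %/ _)%N => [|x] h; first by rewrite maxn0; lia.
by rewrite (maxn_idPr _) //; apply: leq_trans (ltnW h) _; nia.
Qed.

Lemma binavg_sM q l : 0 < q -> q <= 1 ->
  binavg q sM l <= 4 * D%:R / N%:R + 2 / Num.sqrt (l.+1%:R * q).
Proof.
move=> q0 q1; have p0 : 0 <= 1 - q by rewrite subr_ge0.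
have qp : q + (1 - q) = 1 by rewrite addrC subrK.
have -> : binavg q sM l = 4 * D%:R / N%:R *
     (\sum_(m < l.+1) 'C(l, m)%:R * q ^+ m * (1 - q) ^+ (l - m)) +
   2 * \sum_(m < l.+1) 'C(l, m)%:R * q ^+ m * (1 - q) ^+ (l - m) / Num.sqrt m.+1%:R.
  rewrite !mulr_sumr -big_split; apply: eq_bigr => m _.
  by rewrite /sM /=; ring.
rewrite binom_sum1 // mulr1 lerD2l; apply: ler_wpM2l => //.
exact: binom_invsqrt_sum.
Qed.

Let beta l i : R := 4 * D%:R / N%:R + 2 / Num.sqrt (l.+1%:R * theta (row i M)).

Lemma beta_ge0 l i : 0 <= beta l i.
Proof. by rewrite addr_ge0 // divr_ge0 ?mulr_ge0 ?sqrtr_ge0. Qed.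

Lemma th_le1 i : theta (row i M) <= 1.
Proof.
rewrite -th_sum (perm_big _ (perm_to_rem (Msl i))) big_cons lerDl.
by apply: sumr_ge0.
Qed.

Lemma heat_blocks (a : V) l (e1 e2 : seq 'I_d) (m : 'I_d -> nat) y :
  e1 ++ e2 = enum 'I_d ->
  AvL [seq (v i, m i) | i <- e2] (iter (size e1 * l) T (fun y => (y == a)%:R)) y <=
  (\prod_(i <- e1) beta l i) * \prod_(i <- e2) sM (m i).
Proof.
elim/last_ind: e1 e2 m y => [|e1 i IH] e2 m y.
  rewrite big_nil mul1r cat0s => ->; rewrite mul0n /=.
  have le1 (y' : V) : (y' == a)%:R <= \prod_i (coo i y' == coo i a)%:R :> R.
    case: eqP => [->|_]; last by apply: prodr_ge0.
    by rewrite big1 // => i _; rewrite eqxx.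
  have mono (L : seq (V * nat)) (f g : V -> R) y' : (forall y, f y <= g y) -> AvL L f y' <= AvL L g y'.
    move=> fg; elim: L y' => [|[w k] L IHL] y' //=.
    elim: k y' => [|k IHk] y' //=; rewrite /Av.
    by have := IHk (y' + w); have := IHk (y' - w); lra.
  apply: le_trans (mono _ _ _ _ le1) _.
  rewrite (AvL_prod cooD cooN coov m (fun i s => (s == coo i a)%:R)) ?enum_uniq //.
  rewrite big_enum /=; apply: ler_prod => i _.
  rewrite mem_enum /= iterAv_delta andbT.
  elim: (m i) (coo i y) => // k IHk s /=; rewrite /Av.
  by have := IHk (s + (\det M)%:~R); have := IHk (s - (\det M)%:~R); lra.
rewrite cat_rcons => e; rewrite size_rcons mulSn iterD AvL_iterTr big_rcons /=.
pose S k := (\prod_(i <- e1) beta l i) * (sM k * \prod_(i <- e2) sM (m i)).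
apply: (@le_trans _ _ (binavg (theta (row i M)) S l)).
  apply: (@iterTr_blockm _ _ _ sl theta th_ge0 th_sum (@torus_proj d N) th_sym (row i M)) => //.
    exact: th_le1.
  move=> k y'; have iN : i \notin e2.
    have := enum_uniq 'I_d; rewrite -e cat_uniq /= => /and3P[_ _].
    by case/andP.
  have := IH (i :: e2) (fun i' => if i' == i then k else m i') y' e.
  rewrite /= eqxx big_cons eqxx.
  have -> : [seq (v i', if i' == i then k else m i') | i' <- e2] = [seq (v i', m i') | i' <- e2].
    by apply/eq_in_map => i' i'e; case: eqP => // ii; move: iN; rewrite -ii i'e.
  have -> : \prod_(j <- e2) sM (if j == i then k else m j) = \prod_(j <- e2) sM (m j).
    by apply: eq_big_seq => i' i'e; case: eqP => // ii; move: iN; rewrite -ii i'e.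
  by [].
have -> : binavg (theta (row i M)) S l = (\prod_(i <- e1) beta l i) * (\prod_(i <- e2) sM (m i)) * binavg (theta (row i M)) sM l.
  by rewrite /binavg mulr_sumr; apply: eq_bigr => k _; rewrite /S; ring.
rewrite [leRHS]mulrAC; apply: ler_wpM2l; last exact: binavg_sM (Mth i) (th_le1 i).
by apply: mulr_ge0; apply: prodr_ge0 => j _; [exact: beta_ge0|exact: sM_ge0].
Qed.

Lemma EA_blocks (a y : V) l j : (d * l <= j)%N ->
  EA sl theta (@torus_proj d N) (pred1 a) j y <= \prod_(i < d) beta l i.
Proof.
move=> lj; rewrite /EA -(subnK lj) iterD.
apply: (iterTr_le th_ge0 th_sum) => z.
have := heat_blocks a l (e1 := enum 'I_d) (e2 := [::]) (fun=> 0%N) z (cats0 _).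
by rewrite /= big_nil mulr1 size_enum_ord big_enum.
Qed.

End FixN.

Lemma EA_bound (d0 : (0 < d)%N) : exists2 C, 0 < C & forall N, (1 < N)%N ->
  (forall (f : torus d N -> R) y,
     \sum_(z <- sl) theta z * f (y - torus_proj N z) =
     \sum_(z <- sl) theta z * f (y + torus_proj N z)) ->
  forall (a y : torus d N) j, (0 < j)%N ->
  EA sl theta (@torus_proj d N) (pred1 a) j y <=
    C * ((Num.sqrt (j%:R : R))^-1 ^+ d + N%:R ^- d).
Proof.
pose D : R := (absz (\det M))%:R.
pose C0 := 4 * D + \sum_i 2 * Num.sqrt (d%:R / theta (row i M)).
have C00 : 0 < C0.
  apply: ltr_wpDr; first by apply: sumr_ge0 => i _; rewrite mulr_ge0 ?sqrtr_ge0.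
  by rewrite mulr_gt0 // ltr0n absz_gt0.
exists ((2 * C0) ^+ d); first by rewrite exprn_gt0 // mulr_gt0.
move=> N N1 sym a y j j0; set l := (j %/ d)%N.
have lj : (d * l <= j)%N by rewrite mulnC leq_trunc_div.
apply: le_trans (EA_blocks N1 sym a y lj) _.
set s := (Num.sqrt (j%:R : R))^-1.
have jR : 0 < j%:R :> R by rewrite ltr0n.
have NR : 0 < N%:R :> R by rewrite ltr0n ltnW.
have s0 : 0 <= s by rewrite invr_ge0 sqrtr_ge0.
have b i : 4 * (absz (\det M))%:R / N%:R + 2 / Num.sqrt (l.+1%:R * theta (row i M)) <= C0 * (s + N%:R^-1).
  rewrite mulrDr addrC; apply: lerD; last first.
    rewrite ler_pM2r ?invr_gt0 // /C0 lerDl; apply: sumr_ge0 => k _.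
    by rewrite mulr_ge0 ?sqrtr_ge0.
  apply: (@le_trans _ _ (2 * Num.sqrt (d%:R / theta (row i M)) * s)); last first.
    apply: ler_wpM2r => //; rewrite /C0 (bigD1 i) //= addrCA lerDl addr_ge0 ?mulr_ge0 //.
    by apply: sumr_ge0 => k _; rewrite mulr_ge0 ?sqrtr_ge0.
  have t0 := Mth i; have lR : 0 < l.+1%:R :> R by rewrite ltr0n.
  rewrite -mulrA ler_pM2l // -[leLHS]mul1r ler_pdivrMr ?sqrtr_gt0 ?mulr_gt0 //.
  rewrite mulrAC ler_pdivlMr ?sqrtr_gt0 // mul1r -sqrtrM; last by rewrite divr_ge0 // ltW.
  rewrite ler_wsqrtr // (_ : d%:R / theta (row i M) * (l.+1%:R * theta (row i M)) = (l.+1 * d)%:R); last first.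
    by rewrite natrM; field; rewrite gt_eqF.
  by rewrite ler_nat ltnW // ltn_ceil.
apply: (@le_trans _ _ (\prod_(i < d) (C0 * (s + N%:R^-1)))).
  by apply: ler_prod => i _; rewrite b andbT addr_ge0 // divr_ge0 ?mulr_ge0 ?sqrtr_ge0.
rewrite prodr_const card_ord !exprMn [2 ^+ d * _]mulrC -mulrA ler_pM2l ?exprn_gt0 //.
have n0 : 0 <= N%:R^-1 :> R by rewrite invr_ge0 ltW.
have [sn|ns] := leP s (N%:R^-1).
  apply: (@le_trans _ _ ((2 * N%:R^-1) ^+ d)).
    rewrite lerXn2r ?nnegrE ?addr_ge0 ?mulr_ge0 //; lra.
  by rewrite exprMn ler_pM2l ?exprn_gt0 // exprVn lerDr exprn_ge0.
apply: (@le_trans _ _ ((2 * s) ^+ d)).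
  rewrite lerXn2r ?nnegrE ?addr_ge0 ?mulr_ge0 //; lra.
by rewrite exprMn ler_pM2l ?exprn_gt0 // lerDl invr_ge0 exprn_ge0.
Qed.

End TorusHeat.

(** * Escape probabilities up to a given distance *)

Section MassDom.
Context (R : realType).

Lemma mass_dom (u v : fps R) m : 0 <=p u -> u <=p v -> mass v m ->
  mass u (limn (psum u)) /\ 0 <= limn (psum u) <= m.
Proof.
move=> u0 uv vm; have v0 := fle_trans u0 uv.
have nd : nondecreasing_seq (psum u) by move=> i j; apply: psum_le.
have ub n : psum u n <= m.
  by apply: le_trans (mass_le n v0 vm); apply: ler_sum => i _; apply: uv.
have cv : cvgn (psum u) by apply: nondecreasing_is_cvgn => //; exists m => _ [n _ <-].
split=> //; apply/andP; split; last by apply: limr_le => //; apply: nearW.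
by apply: limr_ge => //; apply: nearW => n; apply: psum_ge0.
Qed.

Lemma mass_uniq (u : fps R) a b : mass u a -> mass u b -> a = b.
Proof. by move=> ua ub; rewrite -(cvg_lim (@Rhausdorff R) ua) (cvg_lim (@Rhausdorff R) ub). Qed.

Lemma eq_mass (u v : fps R) m : (forall c, u c = v c) -> mass u m -> mass v m.
Proof. by move=> /funext ->. Qed.

End MassDom.

Section Escape.
Context (R : realType) (mu : fps R) (mu_ge0 : 0 <=p mu) (mu1 : mass mu 1)
  (muD : mass (fD mu) 1).

(** [Fs] and [Ks] with X and T replaced by 1. [Kr a] is the chance that all siblings after the
    special child survive, when the number of children is size-biased, the special one uniform, and
    each sibling survives with probability a. *)
Definition Fr (a : R) : R := limn (psum (fun c => mu c * a ^+ c)).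
Definition Kr (a : R) : R := limn (psum (fun c => mu c * \sum_(i < c) a ^+ i)).

Lemma FrP a : 0 <= a <= 1 ->
  mass (fun c => mu c * a ^+ c) (Fr a) /\ 0 <= Fr a <= 1.
Proof.
case/andP => a0 a1; apply: (mass_dom (v := mu)) => // c.
  by rewrite mulr_ge0 ?exprn_ge0 ?mu_ge0.
by rewrite ler_piMr ?mu_ge0 // exprn_ile1.
Qed.

Lemma KrP a : 0 <= a <= 1 ->
  mass (fun c => mu c * \sum_(i < c) a ^+ i) (Kr a) /\ 0 <= Kr a <= 1.
Proof.
case/andP => a0 a1; apply: (mass_dom (v := fD mu)) => // c.
  by rewrite mulr_ge0 ?mu_ge0 // sumr_ge0 // => i _; rewrite exprn_ge0.
rewrite /fD mulrC; apply: ler_wpM2r; first exact: mu_ge0.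
apply: (@le_trans _ _ (\sum_(i < c) 1)); last by rewrite sumr_const card_ord.
by apply: ler_sum => i _; rewrite exprn_ile1.
Qed.

Context (I : eqType) (r : seq I) (th : I -> R) (th_ge0 : forall z, 0 <= th z)
  (th_sum : \sum_(z <- r) th z = 1) (V : zmodType) (io : I -> V) (A : pred V).

Definition killr (f : V -> R) y := if A y then 0 else f y.
(* [GS] is the G_b of the introduction, [gS] its analogue for the normal vertices. *)
Definition gS (b : nat) : V -> R :=
  iter b (fun g => Tr r th io (killr (fun p => Fr (g p)))) (fun=> 1).
Fixpoint GS (b : nat) : V -> R :=
  if b is b'.+1 then Tr r th io (killr (fun p => Kr (gS b' p) * GS b' p)) else fun=> 1.

Lemma Tr_bound (f : V -> R) y : (forall y, 0 <= f y <= 1) -> 0 <= Tr r th io f y <= 1.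
Proof.
move=> f01; apply/andP; split.
  by apply: sumr_ge0 => z _; apply: mulr_ge0 => //; case/andP: (f01 (y + io z)).
rewrite -th_sum; apply: ler_sum => z _; rewrite -[leRHS]mulr1; apply: ler_wpM2l => //.
by case/andP: (f01 (y + io z)).
Qed.

Lemma gS_bound b y : 0 <= gS b y <= 1.
Proof.
elim: b y => [|b IH] y; first by rewrite ler01 lexx.
apply: Tr_bound => p; rewrite /killr; case: (A p); first by rewrite lexx ler01.
by have [] := FrP (IH p).
Qed.

End Escape.

(** * Coefficient asymptotics *)

Section Tannery.
Context (R : realType).

(** Dominated convergence when the range of summation grows with n: a fixed initial part converges
    termwise, and the rest is dominated by the tail of [d]. *)
Lemma tannery (x : nat -> nat -> R) (y d : fps R) D S n0 :
  (forall c n, (n0 <= n)%N -> 0 <= x c n <= d c) -> mass d D -> mass y S ->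
  (forall c, x c @ \oo --> y c) ->
  (fun n => \sum_(c < n.+3) x c n) @ \oo --> S.
Proof.
move=> xd dD yS xy; apply/cvgrPdist_le => e e0.
have e3 : 0 < e / 3 by rewrite divr_gt0.
have d0 : 0 <=p d by move=> c; have /andP[h0 h1] := xd c _ (leqnn n0); apply: le_trans h1.
have [M1 _ hM1] := (cvgrPdist_le (FF := eventually_filter) _ _).1 dD _ e3.
have [M2 _ hM2] := (cvgrPdist_le (FF := eventually_filter) _ _).1 yS _ e3.
pose M := maxn M1 M2.
have hs : (fun n => \sum_(c < M) x c n) @ \oo --> psum y M.
  rewrite /psum; elim: (M) => [|m IH].
    rewrite big_ord0 (_ : (fun _ => _) = fun=> 0); first exact: cvg_cst.
    by apply/funext => n; rewrite big_ord0.
  rewrite big_ord_recr /= (_ : (fun _ => _) = (fun n => \sum_(c < m) x c n) \+ x m).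
    exact: cvgD.
  by apply/funext => n; rewrite big_ord_recr.
have [M3 _ hM3] := (cvgrPdist_le (FF := eventually_filter) _ _).1 hs _ e3.
exists (maxn (maxn n0 M) M3) => // n /=; rewrite !geq_max => /andP[/andP[n0n Mn] M3n].
have Mn3 : (M <= n.+3)%N by lia.
have := hM1 M (leq_maxl _ _); have := hM2 M (leq_maxr _ _); have := hM3 n M3n.
rewrite /= => h3 h2 h1.
rewrite -(big_mkord xpredT (x ^~ n)) (big_cat_nat (n := M)) //=.
have t0 : 0 <= \sum_(M <= c < n.+3) x c n.
  by apply: sumr_ge0 => c _; case/andP: (xd c n n0n).
have t1 : \sum_(M <= c < n.+3) x c n <= D - psum d M.
  rewrite lerBrDr; apply: le_trans (mass_le n.+3 d0 dD).
  rewrite /psum -!(big_mkord xpredT d) [leRHS](big_cat_nat (n := M)) //= addrC.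
  apply: lerD => //.
  by apply: ler_sum => c _; case/andP: (xd c n n0n).
rewrite [X in S - (X + _)]big_mkord; move: h1 h2 h3 t0 t1; rewrite !ler_norml => /andP[? ?] /andP[? ?] /andP[? ?] ? ?.
by apply/andP; split; lra.
Qed.

Lemma cvg_succ (f : nat -> R) (l : R) : (fun n => f n.+1) @ \oo --> l -> f @ \oo --> l.
Proof. by rewrite -[X in _ -> X](cvg_shiftS f). Qed.

Lemma cvg_eventually_eq (f g : nat -> R) (l : R) n0 :
  (forall n, (n0 <= n)%N -> f n = g n) -> f @ \oo --> l -> g @ \oo --> l.
Proof.
move=> fg /cvgrPdist_le h; apply/cvgrPdist_le => e e0.
have [M _ hM] := h e e0; exists (maxn M n0) => // n /=; rewrite geq_max => /andP[Mn nn].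
by rewrite -fg //; apply: hM.
Qed.

End Tannery.

Section Limit.
Context (R : realType) (mu : fps R) (mu_ge0 : 0 <=p mu) (mu1 : mass mu 1)
  (muD : mass (fD mu) 1).
Context (T : fps R) (T_ge0 : 0 <=p T) (TE : T = @fX R * Fs mu T).
Local Notation W := (Wd mu).
Context (c0 C0 : R) (c0_gt0 : 0 < c0) (C0_gt0 : 0 < C0) (n0 : nat)
  (Wlo : forall n, (n0 <= n)%N -> c0 / Num.sqrt n%:R <= W n 1)
  (Wup : forall n L, W n L <= C0 / Num.sqrt n.+1%:R)
  (Wra : forall a L, (fun n => W (n - a)%N L / W n 1) @ \oo --> (1 : R)).

Local Notation wS := (wS mu T).

Definition bounded_by (kap : fps R) C :=
  0 <=p kap /\ forall L n, (T ^+ L * kap) n <= C / Num.sqrt n.+1%:R.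

(** All powers of T are included so that the property survives multiplication by series of trees;
    the bound, uniform in L, provides the domination for [tannery]. *)
Definition limit_at (kap : fps R) (v : R) := (exists2 C, 0 <= C & bounded_by kap C) /\
  forall L, (fun n => (T ^+ L * kap) n / W n 1) @ \oo --> v.

(** Heuristically [a] contributes only its value g at X = 1, because the large index n is carried by
    [kap]. *)
Definition mult_by (a : fps R) (g : R) := 0 <=p a /\
  forall kap v, limit_at kap v -> limit_at (a * kap) (g * v).

Lemma bounded_TM a kap C : 0 <=p a -> a <=p T -> bounded_by kap C -> bounded_by (a * kap) C.
Proof.
move=> a0 aT [k0 h]; split=> [|L n]; first exact: fle0M.
apply: le_trans (h L.+1 n); rewrite exprSr -mulrA.
by apply: fleM2l; [exact: fle0X|exact: fleM2r].
Qed.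

Lemma bounded_XM kap C : 0 <= C -> bounded_by kap C -> bounded_by (@fX R * kap) (2 * C).
Proof.
move=> C0' [k0 h]; split=> [|L n]; first by apply: fle0M => //; apply: fle0fX.
rewrite mulrCA; case: n => [|n].
  by rewrite fXM0; apply: divr_ge0; rewrite ?sqrtr_ge0 //; lra.
rewrite fXMS; apply: le_trans (h L n) _.
rewrite [2 * C]mulrC -mulrA; apply: ler_wpM2l => //.
have s2 : Num.sqrt n.+2%:R <= 2 * Num.sqrt n.+1%:R :> R.
  rewrite -[leRHS]ger0_norm ?mulr_ge0 ?sqrtr_ge0 // -sqrtr_sqr; apply: ler_wsqrtr.
  rewrite exprMn sqr_sqrtr ?ler0n // -natrX -natrM ler_nat; lia.
by rewrite ler_pdivlMr ?sqrtr_gt0 ?ltr0n // mulrC ler_pdivrMr ?sqrtr_gt0 ?ltr0n.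
Qed.

Lemma W1_gt0 n : (n0 < n)%N -> 0 < W n 1.
Proof.
move=> nn; apply: lt_le_trans (Wlo (ltnW nn)).
by rewrite divr_gt0 // sqrtr_gt0 ltr0n; apply: leq_ltn_trans nn.
Qed.

Lemma limit_atD k v k' v' : limit_at k v -> limit_at k' v' -> limit_at (k + k') (v + v').
Proof.
move=> [[C C0' [k0 h]] l] [[C' C0'' [k0' h']] l']; split.
  exists (C + C'); first exact: addr_ge0.
  split=> [|L n]; first exact: fle0D.
  by rewrite mulrDr fpsD mulrDl; apply: lerD.
move=> L; rewrite (_ : (fun n => _) = (fun n => (T ^+ L * k) n / W n 1) \+
  (fun n => (T ^+ L * k') n / W n 1)); first exact: cvgD.
by apply/funext => n; rewrite mulrDr fpsD mulrDl.
Qed.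

Lemma limit_atC a k v : 0 <= a -> limit_at k v -> limit_at (fC a * k) (a * v).
Proof.
move=> a0 [[C C0' [k0 h]] l]; split.
  exists (a * C); first exact: mulr_ge0.
  split=> [|L n]; first by apply: fle0M => //; apply: fle0fC.
  by rewrite fMC -mulrA; apply: ler_wpM2l.
move=> L; rewrite (_ : (fun n => _) = (fun n => a * ((T ^+ L * k) n / W n 1))).
  by apply: cvgMr; apply: l.
by apply/funext => n; rewrite fMC mulrA.
Qed.

Lemma limit_at0 : limit_at 0 0.
Proof.
split; first by exists 0 => //; split=> // L n; rewrite mulr0 mul0r.
move=> L; rewrite (_ : (fun n => _) = fun=> 0); first exact: cvg_cst.
by apply/funext => n; rewrite mulr0 mul0r.
Qed.

Lemma limit_at_sum (J : eqType) (s : seq J) (F : J -> fps R) v :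
  (forall j, limit_at (F j) (v j)) -> limit_at (\sum_(j <- s) F j) (\sum_(j <- s) v j).
Proof.
move=> h; elim: s => [|j s IH]; first by rewrite !big_nil; apply: limit_at0.
by rewrite !big_cons; apply: limit_atD.
Qed.

Lemma mult_byM a g a' g' : mult_by a g -> mult_by a' g' -> mult_by (a * a') (g * g').
Proof.
move=> [a0 h] [a0' h']; split=> [|k v kv]; first exact: fle0M.
by rewrite -!mulrA; apply: h; apply: h'.
Qed.

Lemma mult_byT : mult_by T 1.
Proof.
split=> // k v [[C C0' b] l]; split.
  by exists C => //; apply: bounded_TM.
by move=> L; rewrite mul1r mulrA -exprSr; apply: l.
Qed.

Lemma mult_by1 : mult_by 1 1.
Proof. by split=> [|k v kv]; [exact: fle01|rewrite !mul1r]. Qed.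

Lemma mult_byX a g n : mult_by a g -> mult_by (a ^+ n) (g ^+ n).
Proof.
move=> h; elim: n => [|n IH]; first by rewrite !expr0; apply: mult_by1.
by rewrite !exprS; apply: mult_byM.
Qed.

Lemma mult_by0 : mult_by 0 0.
Proof. by split=> // k v _; rewrite !mul0r; apply: limit_at0. Qed.

Lemma mult_byD a g a' g' : mult_by a g -> mult_by a' g' -> mult_by (a + a') (g + g').
Proof.
move=> [a0 h] [a0' h']; split=> [|k v kv]; first exact: fle0D.
by rewrite !mulrDl; apply: limit_atD; [apply: h|apply: h'].
Qed.

Lemma mult_byC x a g : 0 <= x -> mult_by a g -> mult_by (fC x * a) (x * g).
Proof.
move=> x0 [a0 h]; split=> [|k v kv]; first by apply: fle0M => //; apply: fle0fC.
by rewrite -!mulrA; apply: limit_atC => //; apply: h.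
Qed.

Lemma mult_by_sum (J : eqType) (s : seq J) (F : J -> fps R) v :
  (forall j, mult_by (F j) (v j)) -> mult_by (\sum_(j <- s) F j) (\sum_(j <- s) v j).
Proof.
move=> h; elim: s => [|j s IH]; first by rewrite !big_nil; apply: mult_by0.
by rewrite !big_cons; apply: mult_byD.
Qed.

Lemma mult_byfX : mult_by (@fX R) 1.
Proof.
split=> [|k v [[C C0' b] l]]; first exact: fle0fX.
split; first by exists (2 * C); [rewrite mulr_ge0|exact: bounded_XM].
move=> L; rewrite mul1r; apply: cvg_succ.
have h : (fun n => W n 1 / W n.+1 1) @ \oo --> (1 : R).
  have := Wra 1 1; rewrite -(cvg_shiftS (fun n => W (n - 1)%N 1 / W n 1)).
  have -> // : [sequence W (n.+1 - 1)%N 1 / W n.+1 1]_n = (fun n => W n 1 / W n.+1 1).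
  by apply/funext => n; rewrite /= subn1.
have h' : (fun n => (T ^+ L * k) n / W n 1 * (W n 1 / W n.+1 1)) @ \oo --> v.
  by rewrite -[v]mulr1; apply: cvgM.
apply: (cvg_eventually_eq (n0 := n0.+1) _ h') => n nn; apply/esym; rewrite mulrCA fXMS /=.
have W0 := W1_gt0 nn; have W0' := W1_gt0 (leqW nn).
by rewrite mulrA divfK // gt_eqF.
Qed.

(** Dominated convergence in the number c of children. [w c] bounds the effect of [u c]: it is 1 for
    [Fs] and c for [Ks], where the mean of [mu] makes the sum finite. *)
Lemma mult_by_fsumm (u : nat -> fps R) (h w : nat -> R) D S :
  summable (fun c => fC (mu c) * u c) -> (forall c, mult_by (u c) (h c)) ->
  (forall c kap C, 0 <= C -> bounded_by kap C -> bounded_by (u c * kap) (w c * C)) ->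
  (forall c, 0 <= w c) ->
  mass (fun c => mu c * w c) D -> mass (fun c => mu c * h c) S ->
  mult_by (fsumm (fun c => fC (mu c) * u c)) S.
Proof.
move=> su hu wu w0 mw mh; split=> [|k v [[C C0' bk] lk]].
  apply: fle0_fsumm => c; apply: fle0M; first exact: fle0fC (mu_ge0 c).
  by case: (hu c).
have fE L n : (T ^+ L * (fsumm (fun c => fC (mu c) * u c) * k)) n =
    \sum_(c < n.+3) mu c * (T ^+ L * (u c * k)) n.
  rewrite mulrCA mulrC fsummM // /fsumm; apply: eq_bigr => c _.
  by rewrite mulrCA fCM; congr (_ * _ n); rewrite [RHS]mulrCA mulrC.
have D0 : 0 <= D by apply: mass_ge0 mw => c; apply: mulr_ge0 => //; apply: mu_ge0.
have mw0 : 0 <=p (fun c => mu c * w c : R) by move=> c; apply: mulr_ge0 => //; apply: mu_ge0.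
split.
  exists (D * C); first exact: mulr_ge0.
  split=> [|L n].
    apply: fle0M; last by case: bk.
    apply: fle0_fsumm => c; apply: fle0M; first exact: fle0fC (mu_ge0 c).
    by case: (hu c).
  rewrite fE -mulrA; apply: le_trans (_ : psum (fun c => mu c * w c) n.+3 * (C / Num.sqrt n.+1%:R) <= _).
    rewrite /psum mulr_suml; apply: ler_sum => c _; rewrite -mulrA; apply: ler_wpM2l; first exact: mu_ge0.
    by rewrite (mulrA (w c)); have [_ /(_ L n)] := wu c k C C0' bk.
  apply: ler_wpM2r; first by rewrite divr_ge0 ?sqrtr_ge0.
  exact: mass_le.
move=> L; rewrite (_ : (fun n => _) = fun n => \sum_(c < n.+3) (mu c * ((T ^+ L * (u c * k)) n / W n 1))); last first.
  by apply/funext => n; rewrite fE mulr_suml; apply: eq_bigr => c _; rewrite -mulrA.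
apply: (tannery (d := fun c => mu c * w c * (C / c0)) (y := fun c => mu c * h c * v) (D := D * (C / c0)) (n0 := n0.+1)
  (x := fun c n => mu c * ((T ^+ L * (u c * k)) n / W n 1))).
- move=> c n nn; have W0 := W1_gt0 nn.
  have [b0 bb] := wu c k C C0' bk.
  have n1 : 0 < Num.sqrt (n%:R : R) by rewrite sqrtr_gt0 ltr0n; lia.
  apply/andP; split.
    apply: mulr_ge0; first exact: mu_ge0.
    by apply: divr_ge0 (ltW W0); apply: fle0M; [exact: fle0X|].
  rewrite -mulrA; apply: ler_wpM2l; first exact: mu_ge0.
  rewrite ler_pdivrMr //; apply: le_trans (bb L n) _.
  apply: (@le_trans _ _ (w c * C / Num.sqrt n%:R)).
    apply: ler_wpM2l; first exact: mulr_ge0.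
    rewrite lef_pV2 ?posrE ?sqrtr_gt0 ?ltr0n //; last by lia.
    by apply: ler_wsqrtr; rewrite ler_nat.
  have -> : w c * C / Num.sqrt n%:R = w c * (C / c0) * (c0 / Num.sqrt n%:R) by field; rewrite !gt_eqF.
  apply: ler_wpM2l; first by rewrite mulr_ge0 // divr_ge0 // ltW.
  by apply: Wlo; apply: ltnW.
- rewrite [D * _]mulrC; apply: (eq_mass _ (massC (c := C / c0) mw)) => c.
  by rewrite fCM [LHS]mulrC.
- rewrite [S * _]mulrC; apply: (eq_mass _ (massC (c := v) mh)) => c.
  by rewrite fCM [LHS]mulrC.
- move=> c; rewrite -mulrA; apply: cvgMr; have [_ huc] := hu c.
  have lkv : limit_at k v by split=> //; exists C.
  by have [_] := huc k v lkv; apply.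
Qed.

Lemma bounded_TX a kap C i : 0 <=p a -> a <=p T -> bounded_by kap C -> bounded_by (a ^+ i * kap) C.
Proof.
move=> a0 aT bk; elim: i => [|i IH]; first by rewrite mul1r.
by rewrite exprS -mulrA; apply: bounded_TM.
Qed.

Lemma boundedD k k' C C' : bounded_by k C -> bounded_by k' C' -> bounded_by (k + k') (C + C').
Proof.
move=> [k0 h] [k0' h']; split=> [|L n]; first exact: fle0D.
by rewrite mulrDr fpsD mulrDl; apply: lerD.
Qed.

Lemma mult_byFs a g : mult_by a g -> a <=p T -> 0 <= g <= 1 -> mult_by (Fs mu a) (Fr mu g).
Proof.
move=> ag aT g01; have [a0 _] := ag.
have [mF _] := FrP mu_ge0 mu1 g01.
apply: (mult_by_fsumm (u := fun c => a ^+ c) (h := fun c => g ^+ c) (w := fun=> 1) (D := 1)) => //.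
- by apply: (summable_pow mu); apply: ford1_le a0 aT (ford1T TE).
- by move=> c; apply: mult_byX.
- by move=> c k C _ bk; rewrite mul1r; apply: bounded_TX.
- by apply: eq_mass mu1 => c; rewrite mulr1.
Qed.

Lemma mult_byKs a g : mult_by a g -> a <=p T -> 0 <= g <= 1 -> mult_by (Ks mu T a) (Kr mu g).
Proof.
move=> ag aT g01; have [a0 _] := ag.
have [mK _] := KrP mu_ge0 muD g01.
apply: (mult_by_fsumm (u := fun c => \sum_(i < c) a ^+ i * T ^+ (c.-1 - i))
  (h := fun c => \sum_(i < c) g ^+ i) (w := fun c => c%:R) (D := 1)) => //.
- by apply: (summableK TE); apply: ford1_le a0 aT (ford1T TE).
- move=> c; apply: mult_by_sum => i; rewrite -[g ^+ i]mulr1 -(expr1n R (c.-1 - i)).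
  by apply: mult_byM; apply: mult_byX => //; apply: mult_byT.
- move=> c k C C0' bk; rewrite mulr_suml.
  have -> : c%:R * C = \sum_(i < c) C by rewrite sumr_const card_ord mulr_natl.
  apply: (big_ind2 bounded_by) => [|x1 x2 y1 y2|i _].
  + by split=> // L n; rewrite mulr0 mul0r.
  + exact: boundedD.
  by rewrite -mulrA; apply: bounded_TX => //; exact: bounded_TX.
- by apply: eq_mass muD => c; rewrite /fD mulrC.
Qed.

Lemma limit_at_wS : limit_at wS 1.
Proof.
split.
  exists C0; first exact: ltW.
  split=> [|L n]; first exact: wS_ge0.
  by rewrite TL_wS.
move=> L; have := Wra 0 L; rewrite (_ : (fun n => _) = (fun n => (T ^+ L * wS) n / W n 1)) //.
by apply/funext => n; rewrite subn0 TL_wS.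
Qed.

Lemma n_TL L n : n%:R * (T ^+ L) n = L%:R * W n L.
Proof.
rewrite -[LHS]/(fD (T ^+ L) n) fDX (fD_T TE) -mulrA.
case: L => [|L]; first by rewrite !mul0r.
by rewrite (mulrA (T ^+ L)) -exprSr fnM (TL_wS TE).
Qed.

(** The coefficient of T^L is (L/n) W n L, smaller than W by a factor n: paths that stop contribute
    nothing in the limit, and only the infinite spine survives. *)
Lemma limit_at1 : limit_at 1 0.
Proof.
have w1 : 1 <=p wS.
  rewrite (wSE mu T); apply/fsubr_ge0; rewrite addrC addKr.
  by apply: fle0M; [exact: phi_ge0|exact: wS_ge0].
split.
  exists C0; first exact: ltW.
  split=> [|L n]; first exact: fle01.
  apply: le_trans (Wup n L); rewrite -(TL_wS TE).
  by apply: fleM2l => //; apply: fle0X.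
move=> L; have h := Wra 0 L.
have h' : (fun n => L%:R * (n%:R : R)^-1 * (W (n - 0)%N L / W n 1)) @ \oo --> (L%:R * 0 * 1 : R).
  apply: cvgM => //; apply: cvgMr; apply: cvg_succ; exact: cvg_harmonic.
rewrite mulr0 mul0r in h'; 
apply: (cvg_eventually_eq (n0 := 1%N) _ h') => n n1; apply/esym; rewrite subn0 mulr1 mulrA; congr (_ / _).
have n0' : n%:R != 0 :> R by rewrite pnatr_eq0; lia.
by apply: (mulfI n0'); rewrite n_TL; field.
Qed.

Context (I : eqType) (r : seq I) (th : I -> R) (th_ge0 : forall z, 0 <= th z)
  (th_sum : \sum_(z <- r) th z = 1) (V : zmodType) (io : I -> V) (A : pred V).

Lemma mult_by_alphaS b y : mult_by (alphaS mu T r th io A b y) (gS mu r th io A b y).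
Proof.
elim: b y => [|b IH] y; first exact: mult_byT.
apply: mult_by_sum => z; apply: mult_byC => //; rewrite /kill /killr; case: ifP => _.
  exact: mult_by0.
rewrite -[X in mult_by _ X]mul1r; apply: mult_byM; first exact: mult_byfX.
apply: mult_byFs; first exact: IH.
- by have [] := alphaS_bound mu_ge0 T_ge0 TE th_ge0 th_sum io A b (y + io z).
- exact: gS_bound.
Qed.

Lemma limit_at_SpS b y : limit_at (SpS mu T r th io A b y) (GS mu r th io A b y).
Proof.
elim: b y => [|b IH] y; first exact: limit_at_wS.
rewrite -[X in limit_at _ X]add0r; apply: limit_atD; first exact: limit_at1.
apply: limit_at_sum => z; apply: limit_atC => //; rewrite /kill /killr; case: ifP => _.
  exact: limit_at0.
have [_ h] : mult_by (@fX R * Ks mu T (alphaS mu T r th io A b (y + io z)))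
    (1 * Kr mu (gS mu r th io A b (y + io z))).
  apply: mult_byM; first exact: mult_byfX.
  apply: mult_byKs; first exact: mult_by_alphaS.
  - by have [] := alphaS_bound mu_ge0 T_ge0 TE th_ge0 th_sum io A b (y + io z).
  - exact: gS_bound.
by rewrite -[Kr _ _]mul1r; apply: h.
Qed.

Lemma SpS_lim b y : (fun n => (T * SpS mu T r th io A b y) n / W n 1) @ \oo -->
  GS mu r th io A b y.
Proof. by have [_ /(_ 1%N)] := limit_at_SpS b y; rewrite expr1. Qed.

End Limit.

(** * The walk indexed by the infinite tree *)

Section Env.
Context (disp : measure_display) (Omega : measurableType disp) (R : realType)
  (P : probability Omega R) (d : nat) (mu : nat -> R)
  (theta : 'rV[int]_d -> R) (E : branching_env P mu theta).

Definition pr (A : set Omega) : R := fine (P A).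

Lemma prE A : measurable A -> P A = (pr A)%:E.
Proof. by move=> mA; rewrite /pr fineK // fin_num_measure. Qed.

Lemma pr_ge0 A : 0 <= pr A.
Proof. exact: fine_ge0. Qed.

Lemma prU A B : measurable A -> measurable B -> A `&` B = set0 ->
  pr (A `|` B) = pr A + pr B.
Proof.
move=> mA mB AB; apply: EFin_inj; rewrite EFinD -!prE //; last exact: measurableU.
by rewrite measureU.
Qed.

Lemma pr_le A B : measurable A -> measurable B -> A `<=` B -> pr A <= pr B.
Proof. by move=> mA mB AB; rewrite -lee_fin -!prE // le_measure ?inE. Qed.

Lemma pr_set0 : pr set0 = 0.
Proof. by rewrite /pr measure0. Qed.

Lemma pr_setT : pr setT = 1.
Proof. by rewrite /pr probability_setT. Qed.

Lemma pr_bigcup (F : nat -> set Omega) : (forall i, measurable (F i)) ->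
  trivIset setT F -> mass (fun c => pr (F c)) (pr (\bigcup_c F c)).
Proof.
move=> mF tF.
have mU : measurable (\bigcup_c F c) by apply: bigcupT_measurable.
have h : (fun n => (\sum_(0 <= i < n) P (F i))%E) @ \oo --> (pr (\bigcup_c F c))%:E.
  by rewrite -prE //; exact: measure_sigma_additive.
have e : psum (fun c => pr (F c)) = fine \o (fun n => (\sum_(0 <= i < n) P (F i))%E).
  apply/funext => n /=; rewrite big_mkord /psum.
  have -> : (\sum_(i < n) P (F i) = \sum_(i < n) (pr (F i))%:E)%E.
    by apply: eq_bigr => i _; rewrite prE.
  by rewrite sumEFin.
by rewrite /mass e; exact: fine_cvg h.
Qed.

Lemma pr_split_nat (X : Omega -> nat) Q : measurable Q ->
  (forall c, measurable (X @^-1` [set c])) ->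
  mass (fun c => pr (Q `&` X @^-1` [set c])) (pr Q).
Proof.
move=> mQ mX.
have -> : pr Q = pr (\bigcup_c (Q `&` X @^-1` [set c])).
  congr pr; apply/seteqP; split=> [w Qw|w [c _ []]//].
  by exists (X w).
apply: pr_bigcup => [i|]; first exact: measurableI.
apply/trivIsetP => i j _ _ /eqP ij; apply/seteqP; split=> // w [[_ /= Xi] [_ /= Xj]].
by apply: ij; rewrite -Xi -Xj.
Qed.

Lemma pr_null A B : measurable A -> measurable B -> A `<=` B -> P B = 0%E -> pr A = 0.
Proof.
move=> mA mB AB B0; apply/eqP; rewrite eq_le pr_ge0 andbT.
by rewrite -[0]/(fine 0%E) -B0; apply: pr_le.
Qed.

Lemma pr_split_list (T : choiceType) (X : Omega -> T) (s : seq T) Q : uniq s ->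
  measurable Q -> (forall B, measurable (X @^-1` B)) ->
  P (X @^-1` [set t | t \notin s]) = 0%E ->
  pr Q = \sum_(z <- s) pr (Q `&` X @^-1` [set z]).
Proof.
move=> us mQ mX X0.
have -> : pr Q = pr (Q `&` X @^-1` [set t | t \in s]).
  have {1}-> : Q = (Q `&` X @^-1` [set t | t \in s]) `|` (Q `&` X @^-1` [set t | t \notin s]).
    apply/seteqP; split=> [w Qw|w [[]|[]]//].
    by case: (boolP (X w \in s)) => h; [left|right].
  rewrite prU; last 3 first.
  - exact: measurableI.
  - exact: measurableI.
  - by apply/seteqP; split=> // w [[_ /= h] [_ /=]]; rewrite h.
  have -> : pr (Q `&` X @^-1` [set t | t \notin s]) = 0; last by rewrite addr0.
  by apply: (pr_null _ _ _ X0); [exact: measurableI|exact: mX|move=> w []].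
elim: s us {X0} => [|z s IH] /=.
  rewrite big_nil => _; rewrite (_ : _ `&` _ = set0) ?pr_set0 //.
  by apply/seteqP; split=> // w [].
case/andP=> zs us; rewrite big_cons -IH // -prU; last 3 first.
- exact: measurableI.
- exact: measurableI.
- by apply/seteqP; split=> // w [[_ /= ->] [_ /=]]; rewrite (negbTE zs).
congr pr; apply/seteqP; split=> [w [Qw /=]|w [[Qw /= ->]|[Qw /= h]]].
- by rewrite inE => /orP[/eqP ->|h]; [left|right].
- by split=> //=; rewrite inE eqxx.
- by split=> //=; rewrite inE h orbT.
Qed.

Local Notation nn := (normal_nb E).
Local Notation sp := (special_pair E).
Local Notation inc := (incr E).

Definition wev u A B C : set Omega :=
  nn u @^-1` A `&` sp u @^-1` B `&` inc u @^-1` C.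
Definition cyl (J : {fset seq nat}) A B C : set Omega :=
  \bigcap_(u in [set` J]) wev u (A u) (B u) (C u).

Lemma measurable_wev u A B C : measurable (wev u A B C).
Proof.
apply: measurableI; last exact: env_measurable_incr.
by apply: measurableI; [exact: env_measurable_normal|exact: env_measurable_special].
Qed.

Lemma measurable_cyl J A B C : measurable (cyl J A B C).
Proof.
apply: fin_bigcap_measurable => [|u _]; first exact: finite_fset.
exact: measurable_wev.
Qed.

Lemma pr_cyl J A B C : pr (cyl J A B C) =
  \prod_(u <- J) (pr (nn u @^-1` A u) * pr (sp u @^-1` B u) * pr (inc u @^-1` C u)).
Proof.
apply: EFin_inj; rewrite -prE; last exact: measurable_cyl.
rewrite (env_independent E) (big_morph EFin EFinM erefl); apply: eq_bigr => u _.
rewrite !EFinM -!prE //.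
- exact: env_measurable_incr.
- exact: env_measurable_special.
- exact: env_measurable_normal.
Qed.

Lemma cyl1 u A B C : cyl [fset u]%fset (fun=> A) (fun=> B) (fun=> C) = wev u A B C.
Proof.
apply/seteqP; split=> [w /(_ u)|w h v /=]; first by apply; rewrite /= inE.
by rewrite inE => /eqP ->.
Qed.

(* [Q] is independent of the choices attached to the words of [U]. *)
Definition free (Q : set Omega) (U : set (seq nat)) :=
  measurable Q /\ forall J A B C, (forall u, u \in J -> U u) ->
    pr (Q `&` cyl J A B C) = pr Q * pr (cyl J A B C).

Lemma freeT U : free setT U.
Proof. by split=> // J A B C _; rewrite setTI pr_setT mul1r. Qed.

Lemma freeS Q U U' : U' `<=` U -> free Q U -> free Q U'.
Proof. by move=> UU [mQ h]; split=> // J A B C JU; apply: h => u /JU /UU. Qed.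

Lemma free_cyl Q U U' J A B C : free Q U -> (forall u, u \in J -> U u) ->
  (forall u, U' u -> U u /\ u \notin J) -> free (Q `&` cyl J A B C) U'.
Proof.
move=> [mQ fQ] JU U'U; split; first by apply: measurableI => //; apply: measurable_cyl.
move=> J' A' B' C' J'U'.
have dis : [disjoint J & J']%fset.
  apply/fdisjointP => u uJ; apply/negP => /J'U' /U'U [_]; by rewrite uJ.
have merge : cyl J A B C `&` cyl J' A' B' C' = cyl (J `|` J')%fset
    (fun u => if u \in J then A u else A' u) (fun u => if u \in J then B u else B' u)
    (fun u => if u \in J then C u else C' u).
  apply/seteqP; split=> [w [h h'] u /=|w h].
    rewrite inE; case: ifPn => [uJ _|uJ /=]; first exact: h.
    by move=> uJ'; apply: h'.
  split=> u /= uJ; first by have := h u; rewrite /= inE uJ => /(_ isT).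
  have := h u; rewrite /= inE uJ orbT => /(_ isT).
  suff /negbTE -> : u \notin J by [].
  by apply/negP => /(fdisjointP dis); rewrite uJ.
have JJ'U u : u \in (J `|` J')%fset -> U u.
  by rewrite inE => /orP[/JU//|/J'U' /U'U []].
rewrite -setIA merge (fQ _ _ _ _ JJ'U) (fQ _ _ _ _ JU) -mulrA; congr (_ * _).
rewrite !pr_cyl.
have pJ : perm_eq (J `|` J')%fset (enum_fset J ++ enum_fset J').
  apply: uniq_perm; rewrite ?fset_uniq //.
    rewrite cat_uniq !fset_uniq /= andbT; apply/hasPn => u uJ'.
    by apply/negP => /(fdisjointP dis); rewrite uJ'.
  by move=> u; rewrite inE mem_cat.
rewrite (perm_big _ pJ) big_cat /=; congr (_ * _); apply: eq_big_seq => u uJ.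
  by rewrite uJ.
suff /negbTE -> : u \notin J by [].
by apply/negP => /(fdisjointP dis); rewrite uJ.
Qed.

Lemma free_word Q (U U' : set (seq nat)) u A B C : free Q U -> U u ->
  (forall v, U' v -> U v /\ v <> u) ->
  free (Q `&` wev u A B C) U' /\ pr (Q `&` wev u A B C) =
    pr Q * (pr (nn u @^-1` A) * pr (sp u @^-1` B) * pr (inc u @^-1` C)).
Proof.
move=> fQ Uu U'U; rewrite -cyl1.
have uU v : v \in [fset u]%fset -> U v by rewrite inE => /eqP ->.
split; first by apply: free_cyl fQ uU _ => v /U'U [? ?]; split=> //; rewrite inE; apply/eqP.
by case: fQ => _ ->//; rewrite pr_cyl big_seq_fset1.
Qed.

Context (sl : seq 'rV[int]_d) (sl_uniq : uniq sl)
  (sl_supp : forall z, z \notin sl -> theta z = 0).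
Context (mu_ge0 : 0 <=p mu) (mu1 : mass mu 1) (muD : mass (fD mu) 1)
  (th_ge0 : forall z, 0 <= theta z) (th_sum : \sum_(z <- sl) theta z = 1).
Context (K : {fset 'rV[int]_d}).

(** y is the position of the parent of u, so the increment at u belongs to the event; [okA] follows
    normal vertices for b generations from u on, [okS] the spine with the later siblings. *)
Fixpoint okA (b : nat) (u : seq nat) (y : 'rV[int]_d) (w : Omega) : Prop :=
  if b is b'.+1 then
    let p := y + inc u w in
    p \notin K /\ forall j, (j < nn u w)%N -> okA b' (rcons u j) p w
  else True.

Fixpoint okS (b : nat) (u : seq nat) (y : 'rV[int]_d) (w : Omega) : Prop :=
  if b is b'.+1 then
    let p := y + inc u w in
    [/\ p \notin K,
      forall j, (special_idx E u w < j < special_nb E u w)%N -> okA b' (rcons u j) p w &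
      okS b' (rcons u (special_idx E u w)) p w]
  else True.

Lemma measurable_dep (T : countType) (X : Omega -> T) (A : T -> set Omega) :
  (forall t, measurable (X @^-1` [set t])) -> (forall t, measurable (A t)) ->
  measurable [set w | A (X w) w].
Proof.
move=> mX mA; have -> : [set w | A (X w) w] = \bigcup_t (X @^-1` [set t] `&` A t).
  by apply/seteqP; split=> [w h|w [t _ [/= -> ]]//]; exists (X w).
apply: countable_bigcupT_measurable => [|t]; last exact: measurableI.
exact: countableP.
Qed.

Lemma measurable_all (A : nat -> set Omega) (Q : pred nat) :
  (forall j, measurable (A j)) -> measurable [set w | forall j, Q j -> A j w].
Proof.
move=> mA; have -> : [set w | forall j, Q j -> A j w] = \bigcap_(j in [set j | Q j]) A j.
  by apply/seteqP; split=> w h j; apply: h.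
exact: bigcap_measurableType.
Qed.

Lemma measurable_okA b u y : measurable [set w | okA b u y w].
Proof.
elim: b u y => [|b IH] u y.
  by rewrite (_ : [set _ | _] = setT) //; apply/seteqP; split.
apply: (@measurable_dep _ (inc u) (fun z => [set w | y + z \notin K /\
   forall j, (j < nn u w)%N -> okA b (rcons u j) (y + z) w])) => z.
  exact: env_measurable_incr.
rewrite (_ : [set w | _] = if y + z \notin K then [set w | forall j, (j < nn u w)%N -> okA b (rcons u j) (y + z) w] else set0); last first.
  by case: ifP => _; apply/seteqP; split=> // w [].
case: ifP => // _.
apply: (@measurable_dep _ (nn u) (fun c => [set w | forall j, (j < c)%N -> okA b (rcons u j) (y + z) w])) => c.
  exact: env_measurable_normal.
by apply: (@measurable_all (fun j => [set w | okA b (rcons u j) (y + z) w])) => j.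
Qed.

Lemma measurable_okS b u y : measurable [set w | okS b u y w].
Proof.
elim: b u y => [|b IH] u y.
  by rewrite (_ : [set _ | _] = setT) //; apply/seteqP; split.
apply: (@measurable_dep _ (inc u) (fun z => [set w | [/\ y + z \notin K,
      forall j, (special_idx E u w < j < special_nb E u w)%N -> okA b (rcons u j) (y + z) w &
      okS b (rcons u (special_idx E u w)) (y + z) w]])) => z.
  exact: env_measurable_incr.
apply: (@measurable_dep _ (sp u) (fun kj => [set w | [/\ y + z \notin K,
      forall j, (kj.2 < j < kj.1)%N -> okA b (rcons u j) (y + z) w &
      okS b (rcons u kj.2) (y + z) w]])) => kj.
  exact: env_measurable_special.
rewrite (_ : [set w | _] = if y + z \notin K then
   [set w | forall j, (kj.2 < j < kj.1)%N -> okA b (rcons u j) (y + z) w] `&`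
   [set w | okS b (rcons u kj.2) (y + z) w] else set0); last first.
  by case: ifP => _; apply/seteqP; split=> // w []//.
case: ifP => // _; apply: measurableI => //.
apply: (@measurable_all (fun j => [set w | okA b (rcons u j) (y + z) w])) => j.
exact: measurable_okA.
Qed.

Lemma pr_nn u c : pr (nn u @^-1` [set c]) = mu c.
Proof. by rewrite /pr env_law_normal. Qed.

Lemma pr_inc u z : pr (inc u @^-1` [set z]) = theta z.
Proof. by rewrite /pr env_law_incr. Qed.

Lemma pr_sp u k j : pr (sp u @^-1` [set (k, j)]) = if (j < k)%N then mu k else 0.
Proof.
rewrite /pr env_law_special /=; case: ltnP => // jk.
by rewrite /size_biased mulrAC mulfV ?mul1r // pnatr_eq0 -lt0n; apply: leq_ltn_trans jk.
Qed.

Lemma null_bigcup (T : countType) (F : T -> set Omega) :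
  (forall t, measurable (F t)) -> (forall t, P (F t) = 0%E) -> P (\bigcup_t F t) = 0%E.
Proof.
move=> mF F0.
pose G i := if (choice.unpickle i : option T) is Some t then F t else set0.
have -> : \bigcup_t F t = \bigcup_i G i.
  apply/seteqP; split=> [w [t _ h]|w [i _]]; last by rewrite /G; case: choice.unpickle => // t h; exists t.
  by exists (choice.pickle t) => //; rewrite /G choice.pickleK.
have mG i : measurable (G i) by rewrite /G; case: choice.unpickle.
apply: measure_negligible; first exact: bigcupT_measurable.
apply: negligible_bigcup => i; apply/negligibleP => //.
by rewrite /G; case: choice.unpickle => //; rewrite measure0.
Qed.

Lemma inc_supp u : P (inc u @^-1` [set t | t \notin sl]) = 0%E.
Proof.
pose F (t : 'rV[int]_d) := if t \notin sl then inc u @^-1` [set t] else set0.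
have -> : inc u @^-1` [set t | t \notin sl] = \bigcup_t F t.
  apply/seteqP; split=> [w h|w [t _]]; first by exists (inc u w) => //=; rewrite /F ifT.
  by rewrite /F; case: ifP => // h /= wt; rewrite wt.
apply: null_bigcup => t; rewrite /F; case: ifP => // h.
- exact: env_measurable_incr.
- by rewrite env_law_incr sl_supp.
Qed.

Local Notation gK := (gS (mu : fps R) sl theta id (fun y => y \in K)).
Local Notation GK := (GS (mu : fps R) sl theta id (fun y => y \in K)).

Definition okA_law b := forall u y Q, free Q [set v | prefix u v] ->
  pr (Q `&` [set w | okA b u y w]) = pr Q * gK b y.

Lemma free_okA b : okA_law b -> forall Q (U U' : set (seq nat)) u y, free Q U ->
  (forall v, prefix u v -> U v) -> (forall v, U' v -> U v /\ ~~ prefix u v) ->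
  free (Q `&` [set w | okA b u y w]) U'.
Proof.
move=> IH Q U U' u y fQ uU U'U; have [mQ _] := fQ; split.
  by apply: measurableI => //; apply: measurable_okA.
move=> J A B C JU'.
have JU v : v \in J -> U v by move=> /JU' /U'U [].
have fJ : free (Q `&` cyl J A B C) [set v | prefix u v].
  apply: free_cyl fQ JU _ => v uv; split; first exact: uU.
  by apply/negP => /JU' /U'U [_]; rewrite uv.
rewrite setIAC IH // IH; last by apply: freeS fQ => v; apply: uU.
by case: fQ => _ -> //; ring.
Qed.

Definition below (u : seq nat) (i n : nat) : set (seq nat) :=
  [set v | exists2 j, (i <= j < i + n)%N & prefix (rcons u j) v].

Lemma prefix_rcons_inj (u v : seq nat) i j : prefix (rcons u i) v -> prefix (rcons u j) v -> i = j.
Proof.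
move=> /prefixP [s ->] /prefixP [s']; rewrite !cat_rcons => /eqP.
by rewrite eqseq_cat // => /andP[_ /eqP []].
Qed.

Lemma prefix_rcons_self (u : seq nat) i : ~~ prefix (rcons u i) u.
Proof.
by apply/negP => /prefixP [s] /(congr1 size); rewrite size_cat size_rcons; lia.
Qed.

Lemma prefix_rconsW (u v : seq nat) i : prefix (rcons u i) v -> prefix u v.
Proof. by move=> /prefixP [s ->]; apply/prefixP; exists (i :: s); rewrite cat_rcons. Qed.

(** The cones of the children are disjoint, so their events can be absorbed into Q one after the
    other. *)
Lemma children b : okA_law b -> forall n i Q (U U' : set (seq nat)) u y, free Q U ->
  below u i n `<=` U -> (forall v, U' v -> U v /\ ~ below u i n v) ->
  let Q' := Q `&` [set w | forall j, (i <= j < i + n)%N -> okA b (rcons u j) y w] in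
  free Q' U' /\ pr Q' = pr Q * gK b y ^+ n.
Proof.
move=> IH; elim=> [|n IHn] i Q U U' u y fQ bU U'U Q'.
  have -> : Q' = Q.
    apply/seteqP; split=> [w []//|w Qw]; split=> // j; lia.
  by rewrite expr0 mulr1; split=> //; apply: freeS fQ => v /U'U [].
have QE : Q' = (Q `&` [set w | okA b (rcons u i) y w]) `&`
    [set w | forall j, (i.+1 <= j < i.+1 + n)%N -> okA b (rcons u j) y w].
  apply/seteqP; split=> [w [Qw h]|w [[Qw h0] h]].
    by split=> [|j jn]; [split=> //; apply: h; lia|apply: h; lia].
  split=> // j jn; have [->//|ij] := eqVneq j i; apply: h; lia.
pose U1 : set (seq nat) := [set v | U v /\ ~~ prefix (rcons u i) v].
have pU v : prefix (rcons u i) v -> U v by move=> pv; apply: bU; exists i => //; lia.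
have f1 : free (Q `&` [set w | okA b (rcons u i) y w]) U1.
  by apply: (free_okA IH) fQ pU _ => v [].
have [] := IHn i.+1 _ U1 U' u y f1.
- move=> v [j jn jv]; split; first by apply: bU; exists j => //; lia.
  by apply/negP => iv; have := prefix_rcons_inj iv jv; lia.
- move=> v /U'U [Uv nb]; split; first split=> //.
    by apply/negP => iv; apply: nb; exists i => //; lia.
  by move=> [j jn jv]; apply: nb; exists j => //; lia.
rewrite QE => f2 ->; split=> //.
rewrite IH; last by apply: freeS fQ => v; apply: pU.
by rewrite exprS; ring.
Qed.

Lemma pr_okA b : okA_law b.
Proof.
elim: b => [|b IH] u y Q fQ.
  rewrite (_ : [set _ | _] = setT); last by apply/seteqP; split.
  by rewrite setIT mulr1.
have [mQ _] := fQ.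
have mO := measurable_okA b.+1 u y.
rewrite (@pr_split_list _ (inc u) sl) //; last 3 first.
- exact: measurableI.
- by move=> B; apply: env_measurable_incr.
- exact: inc_supp.
rewrite -[gK b.+1 y]/(Tr _ _ _ _ _) /Tr mulr_sumr; apply: eq_bigr => z _.
set Qz := Q `&` [set w | okA b.+1 u y w] `&` inc u @^-1` [set z].
have mQz : measurable Qz.
  by apply: measurableI; [exact: measurableI|exact: env_measurable_incr].
rewrite /killr; case: ifPn => pK.
  rewrite (_ : Qz = set0) ?pr_set0 ?mulr0 //; apply/seteqP; split=> // w [[_ /= h] /= wz].
  by move: h; rewrite wz => -[]; rewrite pK.
have [g0 g1] := andP (gS_bound mu_ge0 mu1 th_ge0 th_sum id (fun y => y \in K) b (y + z)).
have g01 : 0 <= gK b (y + z) <= 1 by rewrite g0 g1.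
have h1 := pr_split_nat mQz (fun c => env_measurable_normal E u [set c]).
have [h2 _] := FrP mu_ge0 mu1 g01.
have h3 := massC (c := pr Q * theta z) h2.
have -> : pr Q * (theta z * Fr mu (gK b (y + id z))) =
  pr Q * theta z * Fr mu (gK b (y + z)) by rewrite /=; ring.
apply: (mass_uniq h1); apply: (eq_mass _ h3) => c; rewrite fCM; apply/esym.
set W := wev u [set c] setT [set z].
have QzE : Qz `&` nn u @^-1` [set c] = (Q `&` W) `&`
   [set w | forall j, (0 <= j < 0 + c)%N -> okA b (rcons u j) (y + z) w].
  apply/seteqP; split=> [w [[[Qw [_ h]] /= wz] /= wc]|w [[Qw [[/= wc _] /= wz]] h]].
    by split=> //= j jc; rewrite -wz; apply: h; rewrite wc.
  split=> //; split=> //; split=> //; split; rewrite ?wz //.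
  by move=> j jc; apply: h; rewrite -wc.
have [f1 p1] := free_word (U' := [set v | prefix u v /\ v <> u]) [set c] setT [set z] fQ (prefix_refl u) (fun v h => h).
have [||_] := @children b IH c 0%N _ [set v | prefix u v /\ v <> u] set0 u (y + z) f1.
- move=> v [j _ jv]; split; first exact: prefix_rconsW jv.
  by move=> vu; move: jv; rewrite vu (negbTE (prefix_rcons_self _ _)).
- by [].
rewrite -/W QzE => ->; rewrite p1 pr_nn pr_inc preimage_setT pr_setT; ring.
Qed.

Lemma sp_null k u : P [set w | special_nb E u w = k /\ (k <= special_idx E u w)%N] = 0%E.
Proof.
have -> : [set w | special_nb E u w = k /\ (k <= special_idx E u w)%N] =
  \bigcup_j (sp u @^-1` [set (k, (k + j)%N)]).
  apply/seteqP; split=> [w [/= e h]|w [j _ [/= -> ->]]].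
    by exists (special_idx E u w - k)%N => //; rewrite /= /special_pair e subnKC.
  by rewrite leq_addr.
apply: null_bigcup => j; first exact: env_measurable_special.
by rewrite env_law_special ltnNge leq_addr.
Qed.

(** The special index is below the number of children only almost surely ([sp_null]), so the split
    over pairs with j < k holds for probabilities. *)
Lemma pr_split_sp u Q : measurable Q ->
  mass (fun k => \sum_(j < k) pr (Q `&` sp u @^-1` [set (k, j : nat)])) (pr Q).
Proof.
move=> mQ; have mS B := env_measurable_special E u B.
have mn k : measurable (special_nb E u @^-1` [set k]).
  rewrite (_ : _ @^-1` _ = sp u @^-1` [set kj | kj.1 = k]) //.
apply: (eq_mass _ (pr_split_nat mQ mn)) => k.
have mQk : measurable (Q `&` special_nb E u @^-1` [set k]) by exact: measurableI.
have mi B : measurable (special_idx E u @^-1` B).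
  by rewrite (_ : _ @^-1` _ = sp u @^-1` [set kj | B kj.2]).
have e : Q `&` special_nb E u @^-1` [set k] =
   (Q `&` special_nb E u @^-1` [set k] `&` special_idx E u @^-1` [set j | (j < k)%N]) `|`
   (Q `&` special_nb E u @^-1` [set k] `&` special_idx E u @^-1` [set j | (k <= j)%N]).
  rewrite -setIUr -preimage_setU (_ : _ `|` _ = setT) ?preimage_setT ?setIT //.
  by apply/seteqP; split=> // j _ /=; case: (ltnP j k); [left|right].
rewrite e prU; last 3 first.
- exact: measurableI.
- exact: measurableI.
- by apply/seteqP; split=> // w [[_ /= jk] [_ /= kj]]; move: jk; rewrite ltnNge kj.
rewrite [X in _ + X](_ : _ = 0) ?addr0; last first.
  apply: (pr_null (B := [set w | special_nb E u w = k /\ (k <= special_idx E u w)%N])).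
  - exact: measurableI.
  - rewrite (_ : [set w | _] = special_nb E u @^-1` [set k] `&` special_idx E u @^-1` [set j | (k <= j)%N]) //.
    exact: measurableI.
  - by move=> w [[_ ?]].
  - exact: sp_null.
have st n : (n <= k)%N -> pr (Q `&` special_nb E u @^-1` [set k] `&` special_idx E u @^-1` [set j | (j < n)%N]) =
   \sum_(j < n) pr (Q `&` sp u @^-1` [set (k, j : nat)]).
  elim: n => [|n IH] nk.
    by rewrite big_ord0 (_ : _ `&` _ = set0) ?pr_set0 //; apply/seteqP; split=> // w [].
  rewrite big_ord_recr /= -IH; last exact: ltnW.
  rewrite -prU; last 3 first.
  - exact: measurableI.
  - exact: measurableI.
  - by apply/seteqP; split=> // w [[_ /= h1] [_ /= [_ h2]]]; move: h1; rewrite h2 ltnn.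
  congr pr; apply/seteqP; split=> [w [[Qw /= wk] /= h]|w [[[Qw /= wk] /= h]|[Qw [/= h1 h2]]]].
  - move: h; rewrite ltnS leq_eqVlt => /orP[/eqP h|h]; last by left.
    by right; split=> //=; rewrite /special_pair wk h.
  - by split=> //=; apply: leqW.
  - by split=> //=; rewrite h2.
by rewrite st.
Qed.

Lemma pr_okS b u y Q : free Q [set v | prefix u v] ->
  pr (Q `&` [set w | okS b u y w]) = pr Q * GK b y.
Proof.
elim: b u y Q => [|b IH] u y Q fQ.
  rewrite (_ : [set _ | _] = setT); last by apply/seteqP; split.
  by rewrite setIT mulr1.
have [mQ _] := fQ.
have mO := measurable_okS b.+1 u y.
rewrite (@pr_split_list _ (inc u) sl) //; last 3 first.
- exact: measurableI.
- by move=> B; apply: env_measurable_incr.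
- exact: inc_supp.
rewrite -[GK b.+1 y]/(Tr _ _ _ _ _) /Tr mulr_sumr; apply: eq_bigr => z _.
set Qz := Q `&` [set w | okS b.+1 u y w] `&` inc u @^-1` [set z].
have mQz : measurable Qz.
  by apply: measurableI; [exact: measurableI|exact: env_measurable_incr].
rewrite /killr; case: ifPn => pK.
  rewrite (_ : Qz = set0) ?pr_set0 ?mulr0 //; apply/seteqP; split=> // w [[_ /= h] /= wz].
  by move: h; rewrite wz => -[]; rewrite pK.
have g01 := gS_bound mu_ge0 mu1 th_ge0 th_sum id (fun y => y \in K) b (y + z).
have h1 := pr_split_sp u mQz.
have [h2 _] := KrP mu_ge0 muD g01.
have h3 := massC (c := pr Q * theta z * GK b (y + z)) h2.
have -> : pr Q * (theta z * (Kr mu (gK b (y + id z)) * GK b (y + id z))) =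
  pr Q * theta z * GK b (y + z) * Kr mu (gK b (y + z)) by rewrite /=; ring.
apply: (mass_uniq h1); apply: (eq_mass _ h3) => k; rewrite fCM mulrCA mulr_sumr mulr_sumr.
(* Reversal turns the index j of the special child into the number k - j - 1 of its later siblings,
   which is the exponent in [Kr]. *)
rewrite (reindex_inj rev_ord_inj) /=; apply: eq_bigr => j _; apply/esym.
set W := wev u setT [set (k, j : nat)] [set z].
set n := (k - j.+1)%N.
have QzE : Qz `&` sp u @^-1` [set (k, j : nat)] = ((Q `&` W) `&`
   [set w | forall i, (j.+1 <= i < j.+1 + n)%N -> okA b (rcons u i) (y + z) w]) `&`
   [set w | okS b (rcons u j) (y + z) w].
  have kn : (j.+1 + n = k)%N by rewrite /n subnKC.
  rewrite kn.
  apply/seteqP; split=> [w [[[Qw [_ ha hs]] /= wz] /= [wk wj]]|w [[[Qw [[_ /= [wk wj]] /= wz]] ha] hs]].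
    split; first split=> //=.
    - by split=> //; split=> //; split=> //=; rewrite /special_pair wk wj.
    - by move=> i ij; rewrite -wz; apply: ha; rewrite wj wk.
    - by rewrite /= -wz -wj.
  split; last by rewrite /= /special_pair wk wj.
  split=> //; split=> //; split; rewrite ?wz ?wj //.
  by rewrite wk.
pose U1 : set (seq nat) := [set v | prefix u v /\ v <> u].
have [f1 p1] := free_word (U' := U1) setT [set (k, j : nat)] [set z] fQ (prefix_refl u) (fun v h => h).
have [||f2 p2] := @children b (@pr_okA b) n j.+1 _ U1 [set v | prefix (rcons u j) v] u (y + z) f1.
- move=> v [i _ iv]; split; first exact: prefix_rconsW iv.
  by move=> vu; move: iv; rewrite vu (negbTE (prefix_rcons_self _ _)).
- move=> v jv; split; last by move=> [i ij iv]; have := prefix_rcons_inj iv jv; lia.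
  split; first exact: prefix_rconsW jv.
  by move=> vu; move: jv; rewrite /= vu (negbTE (prefix_rcons_self _ _)).
rewrite QzE IH // p2 -/W p1 pr_sp ltn_ord pr_inc preimage_setT pr_setT.
ring.
Qed.

Local Notation idx := (special_idx E).
Local Notation nb := (special_nb E).

Definition dm (T : countType) (X : Omega -> T) := forall B : set T, measurable (X @^-1` B).

Lemma dm_dep (T T' : countType) (X : Omega -> T) (Y : T -> Omega -> T') :
  dm X -> (forall t, dm (Y t)) -> dm (fun w => Y (X w) w).
Proof.
move=> mX mY B; apply: (measurable_dep (X := X) (A := fun t => Y t @^-1` B)) => t //.
exact: mY.
Qed.

Lemma dm_comp (T T' : countType) (X : Omega -> T) (f : T -> T') : dm X -> dm (f \o X).
Proof. by move=> mX B; exact: (mX (f @^-1` B)). Qed.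

Lemma dm_cst (T : countType) (t : T) : dm (fun=> t).
Proof. by move=> B; rewrite preimage_cst; case: ifP. Qed.

Lemma dm_nn u : dm (nn u).
Proof. by move=> B; apply: env_measurable_normal. Qed.

Lemma dm_inc u : dm (inc u).
Proof. by move=> B; apply: env_measurable_incr. Qed.

Lemma dm_nb u : dm (nb u).
Proof. by move=> B; apply: (env_measurable_special E u [set kj | B kj.1]). Qed.

Lemma dm_idx u : dm (idx u).
Proof. by move=> B; apply: (env_measurable_special E u [set kj | B kj.2]). Qed.

Lemma dm_spine m : dm ((spine E)^~ m).
Proof.
case: m => [|m]; first exact: dm_cst.
elim: m => [|m IH]; first exact: (dm_comp (fun c => [:: c]) (dm_nn [::])).
apply: (dm_dep (Y := fun s w => rcons s (idx s w)) IH) => s.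
exact: (dm_comp (rcons s) (dm_idx s)).
Qed.

Lemma dm_inf_nb u : dm (fun w => inf_nb_children E w u).
Proof.
rewrite /inf_nb_children /is_special; case: eqP => _; first exact: (dm_comp S (dm_nn u)).
apply: (dm_dep (Y := fun s w => if u == s then nb u w else nn u w) (dm_spine (size u))) => s.
by case: (u == s); [exact: (dm_nb u)|exact: (dm_nn u)].
Qed.

Lemma dm_walk (x : 'rV[int]_d) v : dm (fun w => walk x (inc^~ w) v).
Proof.
rewrite /walk; move: (index_iota _ _) => r; apply: (dm_comp (fun z => x + z)).
elim: r => [|m r IH].
  by rewrite (_ : (fun _ => _) = fun=> 0); [exact: dm_cst|apply/funext => w; rewrite big_nil].
rewrite (_ : (fun _ => _) = fun w => inc (take m v) w + \sum_(m <- r) inc (take m v) w); last first.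
  by apply/funext => w; rewrite big_cons.
apply: (dm_dep (Y := fun z w => z + \sum_(m <- r) inc (take m v) w) (dm_inc _)) => z.
exact: (dm_comp (fun t => z + t)).
Qed.

Lemma measurable_past v : measurable [set w | past E w v].
Proof.
have -> : [set w | past E w v] = [set w | inf_tree E w v] `&` \bigcup_m [set w |
    let s := spine E w m.+1 in v = s \/ exists2 j, (idx s w < j)%N & prefix (rcons s j) v].
  by apply/seteqP; split=> [w [tv [m h]]|w [tv [m _ h]]]; split=> //; exists m.
apply: measurableI.
  apply: (@measurable_all (fun i => [set w | (nth 0 v i < inf_nb_children E w (take i v))%N])
    (fun i => (i < size v)%N)) => i.
  exact: (dm_inf_nb (take i v) [set c | (nth 0 v i < c)%N]).
apply: bigcupT_measurable => m.
apply: (measurable_dep (X := (spine E)^~ m.+1) (A := fun s => [set w |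
   v = s \/ exists2 j, (idx s w < j)%N & prefix (rcons s j) v])) => s.
  exact: dm_spine.
exact: (dm_idx s [set i | v = s \/ exists2 j, (i < j)%N & prefix (rcons s j) v]).
Qed.

Definition escapes x : set Omega :=
  [set w | forall v, past E w v -> walk x (fun u => inc u w) v \notin K].

Lemma measurable_escapes x : measurable (escapes x).
Proof.
have -> : escapes x = ~` \bigcup_v ([set w | past E w v] `&`
    [set w | walk x (inc^~ w) v \in K]).
  apply/seteqP; split=> [w h [v _ [/= pv]]|w h v pv].
    by have /= := h v pv => /negP.
  by apply/negP => vK; apply: h; exists v.
apply: measurableC; apply: countable_bigcupT_measurable => [|v]; first exact: countableP.
apply: measurableI; first exact: measurable_past.
exact: (dm_walk x v [set z | z \in K]).
Qed.

(** The almost sure event on which every special index names an actual child, so that the spine lies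
    in the tree. *)
Definition nice : set Omega := [set w | forall u, (idx u w < nb u w)%N].

Lemma niceE : ~` nice =
  \bigcup_(uk : (seq nat * nat)%type) [set w | nb uk.1 w = uk.2 /\ (uk.2 <= idx uk.1 w)%N].
Proof.
apply/seteqP; split=> [w /existsNP [u /negP h]|w [[u k] _ [/= <- h]] /(_ u)].
  by exists (u, nb u w) => //=; rewrite leqNgt.
by rewrite ltnNge h.
Qed.

Lemma measurable_null u k : measurable [set w | nb u w = k /\ (k <= idx u w)%N].
Proof. exact: (env_measurable_special E u [set kj | kj.1 = k /\ (k <= kj.2)%N]). Qed.

Lemma measurable_nice : measurable nice.
Proof.
rewrite -(setCK nice) niceE; apply: measurableC.
by apply: countable_bigcupT_measurable => // -[u k]; exact: measurable_null.
Qed.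

Lemma pr_nice Q : measurable Q -> pr Q = pr (Q `&` nice).
Proof.
move=> mQ; have mG := measurable_nice.
have {1}-> : Q = (Q `&` nice) `|` (Q `&` ~` nice) by rewrite -setIUr setUv setIT.
have mC := measurableC mG.
rewrite prU; [|exact: measurableI|exact: measurableI|]; last first.
  by rewrite setIACA setICr setI0.
rewrite [X in _ + X](_ : _ = 0) ?addr0 //.
apply: (pr_null (B := ~` nice)) => //; first exact: measurableI.
rewrite niceE; apply: (null_bigcup (F := fun uk : (seq nat * nat)%type =>
  [set w | nb uk.1 w = uk.2 /\ (uk.2 <= idx uk.1 w)%N])) => -[u k].
  exact: measurable_null.
exact: sp_null.
Qed.

(** The word [[:: nn [::] w]] is the last child of the root, hence the first special vertex; the
    root itself, at x, is not tested. *)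
Definition esc x b : set Omega := [set w | okS b [:: nn [::] w] x w].

Lemma measurable_esc x b : measurable (esc x b).
Proof.
apply: (measurable_dep (X := nn [::]) (A := fun c => [set w | okS b [:: c] x w])) => c.
  exact: dm_nn.
exact: measurable_okS.
Qed.

Lemma pr_esc x b : pr (esc x b) = GK b x.
Proof.
have h := pr_split_nat (measurable_esc x b) (fun c => dm_nn [::] [set c]).
have h3 := massC (c := GK b x) mu1; rewrite mulr1 in h3.
apply: (mass_uniq h); apply: (eq_mass _ h3) => c; rewrite fCM.
have [f1 p1] := free_word (U' := [set v | v <> [::]]) [set c] setT setT
  (@freeT setT) (I : [set: seq nat] [::]) (fun v h => conj I h).
have -> : esc x b `&` nn [::] @^-1` [set c] =
    (setT `&` wev [::] [set c] setT setT) `&` [set w | okS b [:: c] x w].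
  rewrite setTI; apply/seteqP; split=> [w [h0 /= wc]|w [[[/= wc _] _] h0]].
    by split=> //=; rewrite -wc.
  by split=> //; rewrite /esc /= wc.
rewrite pr_okS; last by apply: freeS f1 => v /= /prefixP [s ->].
by rewrite p1 pr_nn !preimage_setT pr_setT; ring.
Qed.

Lemma okA_S b u y w : okA b.+1 u y w -> okA b u y w.
Proof.
elim: b u y => [|b IH] u y //; move=> [pK h]; split=> // j jc.
by apply: IH; apply: h.
Qed.

Lemma okS_S b u y w : okS b.+1 u y w -> okS b u y w.
Proof.
elim: b u y => [|b IH] u y //; move=> [pK h hs]; split=> //.
  by move=> j jc; apply: okA_S; apply: h.
exact: IH.
Qed.

Lemma walk_rcons (x : 'rV[int]_d) w u j :
  walk x (inc^~ w) (rcons u j) = walk x (inc^~ w) u + inc (rcons u j) w.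
Proof.
rewrite /walk size_rcons big_nat_recr //= addrA; congr (_ + _ + _).
  by rewrite !big_nat; apply: eq_bigr => m /andP[_ mu']; rewrite -cats1 takel_cat.
by rewrite take_oversize // size_rcons.
Qed.

Lemma okAP x w u y : y + inc u w = walk x (inc^~ w) u ->
  (forall b, okA b u y w) <->
  (forall s, (forall i, (i < size s)%N -> (nth 0 s i < nn (u ++ take i s) w)%N) ->
     walk x (inc^~ w) (u ++ s) \notin K).
Proof.
move=> yu; split=> [h s|h b].
  move: (h (size s).+1); elim: s u y yu {h} => [|j s IH] u y yu [pK h] v.
    by rewrite cats0 -yu.
  rewrite -cat_rcons; apply: (IH _ (y + inc u w)).
  - by rewrite walk_rcons yu.
  - by apply: h; have := v 0%N isT; rewrite /= cats0.
  - by move=> i si; have := v i.+1 si; rewrite /= cat_rcons.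
elim: b u y yu h => // b IH u y yu h; split.
  by have := h [::]; rewrite cats0 yu; apply.
move=> j jc; apply: IH => [|s v]; first by rewrite walk_rcons yu.
by rewrite cat_rcons; apply: h => -[|i] si /=; rewrite ?cats0 // -cat_rcons; apply: v.
Qed.

Lemma spineSS w m : spine E w m.+2 = rcons (spine E w m.+1) (idx (spine E w m.+1) w).
Proof. by []. Qed.

Lemma size_spine w m : size (spine E w m) = m.
Proof. by case: m => [|m] //; elim: m => // m IH; rewrite spineSS size_rcons IH. Qed.

Lemma take_spine w i m : (i <= m)%N -> take i (spine E w m) = spine E w i.
Proof.
case: m => [|m]; first by rewrite leqn0 => /eqP ->.
elim: m => [|m IH]; first by case: i => [|[|i]].
rewrite leq_eqVlt => /orP[/eqP ->|im]; first by rewrite take_oversize // size_spine.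
by rewrite spineSS -cats1 takel_cat ?IH // size_spine.
Qed.

Lemma spine_child w i m : nice w -> (i < m)%N ->
  (nth 0 (spine E w m) i < inf_nb_children E w (spine E w i))%N.
Proof.
move=> nw im; rewrite -(@nth_take i.+1) // take_spine //.
case: i im => [|i] im; first by rewrite /= /inf_nb_children eqxx.
rewrite spineSS nth_rcons size_spine ltnn eqxx /inf_nb_children.
rewrite /is_special size_spine eqxx andbT.
have -> : spine E w i.+1 == [::] = false by apply/negP => /eqP /(congr1 size); rewrite size_spine.
by rewrite /=; apply: nw.
Qed.

Lemma off_spine w m j s : j != idx (spine E w m.+1) w ->
  is_special E w (rcons (spine E w m.+1) j ++ s) = false.
Proof.
move=> ji; apply/negP => /andP[_ /eqP h].
have sz : size (rcons (spine E w m.+1) j) = m.+2 by rewrite size_rcons size_spine.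
have := congr1 (take m.+2) h; rewrite take_spine; last first.
  by rewrite size_cat sz leq_addr.
rewrite -{1}sz take_size_cat // spineSS => /eqP; rewrite eqseq_rcons eqxx /=.
by rewrite (negbTE ji).
Qed.

Lemma branchP w m j s : nice w -> j != idx (spine E w m.+1) w ->
  inf_tree E w (rcons (spine E w m.+1) j ++ s) <->
  (j < nb (spine E w m.+1) w)%N /\
  (forall i, (i < size s)%N -> (nth 0 s i < nn (rcons (spine E w m.+1) j ++ take i s) w)%N).
Proof.
move=> nw ji; set u := spine E w m.+1; have su : size u = m.+1 by exact: size_spine.
have u0 : u == [::] = false by apply/negP => /eqP /(congr1 size); rewrite su.
have nbu : inf_nb_children E w u = nb u w.
  by rewrite /inf_nb_children u0 /is_special u0 su eqxx.
have off i : inf_nb_children E w (rcons u j ++ take i s) = nn (rcons u j ++ take i s) w.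
  rewrite /inf_nb_children off_spine //.
  by case: eqP => // /(congr1 size); rewrite size_cat size_rcons.
have nl i : (m.+2 + i < m.+2)%N = false by apply/negP; lia.
rewrite /inf_tree /=; split=> [h|[jn v] i].
  split.
    have := h m.+1; rewrite size_cat size_rcons su => /(_ (leq_addr _ _)).
    by rewrite cat_rcons nth_cat su ltnn subnn -su take_size_cat // nbu.
  move=> i si; have := h (m.+2 + i)%N; rewrite size_cat size_rcons su ltn_add2l => /(_ si).
  by rewrite nth_cat take_cat size_rcons su nl addKn off.
rewrite size_cat size_rcons su => im.
have [im1|im1|->] := ltngtP i m.+1.
- rewrite cat_rcons nth_cat su im1 takel_cat ?su ?(ltnW im1) // take_spine ?(ltnW im1) //.
  exact: spine_child.
- have -> : i = (m.+2 + (i - m.+2))%N by lia.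
  by rewrite nth_cat take_cat size_rcons su nl addKn off; apply: v; lia.
- by rewrite cat_rcons nth_cat su ltnn subnn -su take_size_cat // nbu.
Qed.

Lemma spine_tree w m : nice w -> inf_tree E w (spine E w m).
Proof.
move=> nw i; rewrite size_spine => im; rewrite take_spine; last exact: ltnW.
exact: spine_child.
Qed.

(** Unfolding [okS] along the spine asks that each spine vertex and the cones of its later children
    avoid K; [branchP] and [okAP] identify these cones with the words of the tree. *)
Lemma escP x w : nice w -> (forall b, esc x b w) <-> escapes x w.
Proof.
move=> nw; set W := walk x (inc^~ w).
have H : (forall b, esc x b w) <-> forall m, let u := spine E w m.+1 in W u \notin K /\
    forall j, (idx u w < j < nb u w)%N -> forall b, okA b (rcons u j) (W u) w.
  split=> [h m|h b].
    have [y yu hm] : exists2 y, y + inc (spine E w m.+1) w = W (spine E w m.+1) &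
        forall b, okS b (spine E w m.+1) y w.
      elim: m => [|m [y yu IH]].
        exists x; last exact: h.
        by rewrite -[spine E w 1]/(rcons [::] (nn [::] w)) /W walk_rcons /walk big_geq ?addr0.
      exists (W (spine E w m.+1)); first by rewrite spineSS /W walk_rcons.
      by move=> b; have [_ _] := IH b.+1; rewrite yu spineSS.
    split; first by have [] := hm 1%N; rewrite yu.
    by move=> j jn b; have [_ /(_ j jn)] := hm b.+1; rewrite yu.
  suff H m y : y + inc (spine E w m.+1) w = W (spine E w m.+1) -> okS b (spine E w m.+1) y w.
    apply: (H 0%N); rewrite -[spine E w 1]/(rcons [::] (nn [::] w)) /W walk_rcons.
    by rewrite /walk big_geq ?addr0.
  elim: b m y => // b IH m y yu; have [h1 h2] := h m; split.
  - by rewrite yu.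
  - by move=> j jn; rewrite yu; apply: h2.
  - by rewrite yu -spineSS; apply: IH; rewrite spineSS /W walk_rcons.
rewrite H; split=> {H} [h v [tv [m]]|h m u].
  have [h1 h2] := h m; set u := spine E w m.+1 in h1 h2 *.
  move=> [->//|[j uj /prefixP [s vE]]].
  have ju : j != idx u w by rewrite neq_ltn uj orbT.
  move: tv; rewrite vE => /(branchP s nw ju) [jn v'].
  have := h2 j; rewrite uj jn => /(_ isT).
  rewrite (okAP (x := x)); last by rewrite /W walk_rcons.
  exact.
split.
  by apply: h; split; [exact: spine_tree|exists m; left].
move=> j /andP[uj jn].
have ju : j != idx u w by rewrite neq_ltn uj orbT.
rewrite (okAP (x := x)); last by rewrite /W walk_rcons.
move=> s v; apply: h; split; first by apply/branchP.
by exists m; right; exists j => //; apply: prefix_prefix.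
Qed.

(** Continuity from above: the events [esc x b] decrease in b, and on [nice] their intersection is
    the escape event. *)
Lemma escape_prob_lim x : (GK ^~ x) @ \oo --> escape_prob E K x.
Proof.
have mE := measurable_esc x.
have -> : escape_prob E K x = pr (\bigcap_b esc x b).
  rewrite -[LHS]/(pr (escapes x)) pr_nice; last exact: measurable_escapes.
  rewrite [RHS]pr_nice; last exact: bigcapT_measurable.
  congr pr; apply/seteqP; split=> [w [h nw]|w [h nw]]; split=> //.
    by move=> b _; move/(escP x nw): h; apply.
  by apply/(escP x nw) => b; apply: h.
have nE : nonincreasing_seq (esc x).
  apply/nonincreasing_seqP => b; apply/subsetPset => w; exact: okS_S.
have mI : measurable (\bigcap_b esc x b) by exact: bigcapT_measurable.
have h := nonincreasing_cvg_mu (mu := P) _ mE mI nE.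
have {}h : (P \o esc x) @ \oo --> P (\bigcap_b esc x b).
  by apply: h; rewrite (le_lt_trans (probability_le1 _ _)) ?ltry.
move: h; rewrite prE // => /fine_cvg.
have -> // : fine \o (P \o esc x) = GK ^~ x.
by apply/funext => b; exact: (pr_esc x b).
Qed.

End Env.

(** * Plane trees as binary trees *)

(* [B l r] is the plane forest whose first tree has the forest l above its root
   and whose other trees form r; a plane tree is a root above a forest. *)
Inductive bt := E | B of bt & bt.
HB.instance Definition _ := gen_eqMixin bt.

Fixpoint bsize a : nat := if a is B l r then (bsize l + bsize r).+1 else 0.
Fixpoint len a : nat := if a is B l r then (len r).+1 else 0.

(** Places a vertex of the forest r inside [B l r]: the index of its tree grows by one. *)
Definition sh (v : seq nat) := if v is i :: v' then i.+1 :: v' else [::].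

Fixpoint words a : seq (seq nat) :=
  if a is B l r then [:: 0%N] :: map (cons 0%N) (words l) ++ map sh (words r) else [::].

Fixpoint inb a (v : seq nat) : bool :=
  if v is i :: v' then
    if a is B l r then (if i is j.+1 then inb r (j :: v') else inb l v') else false
  else true.

Fixpoint kids a (u : seq nat) : nat :=
  if u is i :: u' then
    if a is B l r then (if i is j.+1 then kids r (j :: u') else kids l u') else 0
  else len a.

Lemma inb0 a : inb a [::] = true.
Proof. by case: a. Qed.

Lemma kids0 a : kids a [::] = len a.
Proof. by case: a. Qed.

Lemma sh_inj : injective sh.
Proof. by move=> [|i u] [|j v] //= [-> ->]. Qed.

Lemma words_neq0 a v : v \in words a -> v <> [::].
Proof.
elim: a v => [|l IHl r IHr] v //=; rewrite inE mem_cat => /or3P[/eqP ->//|/mapP[u _ ->]//|/mapP[u]].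
by move=> /IHr; case: u => // i u _ ->.
Qed.

Lemma mem_words a v : (v \in words a) = (v != [::]) && inb a v.
Proof.
elim: a v => [|l IHl r IHr] v; first by case: v => [|i v]; rewrite in_nil.
rewrite /= inE mem_cat.
have z v' : (0%N :: v' \in [seq sh i | i <- words r]) = false.
  by apply/negP => /mapP[[|]].
have s i v' : (i.+1 :: v' \in [seq 0%N :: i | i <- words l]) = false.
  by apply/negP => /mapP[].
case: v => [|[|i] v].
- by rewrite /=; apply/negP => /orP[/mapP[]//|/mapP[[|//] /words_neq0]].
- by rewrite z orbF mem_map => [|? ? []//]; rewrite IHl eqseq_cons /=; case: v => //; rewrite inb0.
- by rewrite s -[_ :: v]/(sh (i :: v)) (mem_map sh_inj) IHr.
Qed.

Lemma words_uniq a : uniq (words a).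
Proof.
elim: a => //= l IHl r IHr.
rewrite cat_uniq !map_inj_uniq ?IHl ?IHr //; [|exact: sh_inj|by move=> ? ? []].
rewrite mem_cat negb_or !andbT -andbA; apply/and3P; split=> //.
- by apply/negP => /mapP[u /words_neq0 u0 [ue]]; apply: u0.
- by apply/negP => /mapP[[|]].
- by apply/hasPn => u /mapP[[|i v] /words_neq0 // _ ->]; apply/negP => /mapP[].
Qed.

Lemma size_words a : size (words a) = bsize a.
Proof. by elim: a => //= l IHl r IHr; rewrite size_cat !size_map IHl IHr. Qed.

Definition toset a : {fset seq nat} := [fset v in [::] :: words a]%fset.

Lemma mem_toset a v : (v \in toset a) = inb a v.
Proof. by rewrite !inE /= mem_words; case: v => [|i v] //; rewrite inb0. Qed.

Lemma nil_words a : [::] \notin words a.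
Proof. by rewrite mem_words. Qed.

Lemma perm_toset a : perm_eq (toset a) ([::] :: words a).
Proof.
apply: uniq_perm; rewrite ?fset_uniq //= ?nil_words ?words_uniq //.
by move=> v; rewrite !inE.
Qed.

Lemma card_toset a : #|` toset a| = (bsize a).+1.
Proof. by rewrite (perm_size (perm_toset a)) /= size_words. Qed.

Lemma inb_rcons a u i : inb a (rcons u i) = (i < kids a u)%N.
Proof.
elim: a u i => [|l IHl r IHr] [|[|k] u] [|i] //=.
- by rewrite inb0.
- by rewrite (IHr [::]) kids0.
- by rewrite (IHr (k :: u)).
- by rewrite (IHr (k :: u)).
Qed.

Lemma kids_gt0 a u : (0 < kids a u)%N -> inb a u.
Proof.
elim: a u => [|l IHl r IHr] [|[|k] u] //; first exact: IHl.
exact: (IHr (k :: u)).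
Qed.

Lemma plane_toset a : plane_tree (toset a).
Proof.
split=> [|u i]; first by rewrite mem_toset inb0.
rewrite !mem_toset inb_rcons => iu; split; first by apply: kids_gt0; apply: leq_ltn_trans iu.
by move=> j ji; rewrite mem_toset inb_rcons; apply: ltn_trans iu.
Qed.

Lemma parent_rcons u i : parent (rcons u i) = u.
Proof. by rewrite /parent size_rcons -cats1 take_size_cat. Qed.

Lemma nb_children_toset a u : nb_children (toset a) u = kids a u.
Proof.
rewrite /nb_children.
have -> : [fset v in toset a | (v != [::]) && (parent v == u)]%fset =
    [fset v in [seq rcons u i | i <- iota 0 (kids a u)]]%fset.
  apply/fsetP => v; have tv := mem_toset a v; move: (toset a) tv => t tv.
  rewrite !inE /= tv {tv}; apply/idP/mapP.
    case/lastP: v => [|v i]; first by rewrite andbF.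
    rewrite parent_rcons => /andP[vt /andP[_ /eqP vu]].
    exists i; last by rewrite vu.
    by rewrite mem_iota /= add0n -inb_rcons -vu.
  move=> [i]; rewrite mem_iota /= add0n => iu ->.
  by rewrite parent_rcons eqxx andbT -size_eq0 size_rcons andbT inb_rcons.
rewrite card_fseq undup_id ?size_map ?size_iota // map_inj_uniq ?iota_uniq // => i j.
by move/rcons_inj => [].
Qed.

(* inverse of [toset]; n bounds [size v + sumn v] over the vertices v of the tree p *)
Fixpoint ofpred n (p : seq nat -> bool) : bt :=
  if n is n'.+1 then
    if p [:: 0%N] then B (ofpred n' (fun v => p (0%N :: v))) (ofpred n' (p \o sh)) else E
  else E.

Definition plane_pred (p : seq nat -> bool) :=
  p [::] /\ forall u i, p (rcons u i) -> p u /\ forall j, (j < i)%N -> p (rcons u j).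

Lemma plane_pred_cat p u v : plane_pred p -> p (u ++ v) -> p u.
Proof.
move=> [_ pp]; elim/last_ind: v => [|v i IH]; first by rewrite cats0.
by rewrite -rcons_cat => /pp [/IH].
Qed.

Lemma inb_ofpred n p : plane_pred p -> (forall v, p v -> (size v + sumn v <= n)%N) ->
  forall v, inb (ofpred n p) v = p v.
Proof.
elim: n p => [|n IH] p pp pn v.
  case: v => [|i v] /=; first by case: pp.
  by case: i => [|i]; apply/esym/negP => /pn.
have [p0 pr] := pp; rewrite /=; case: ifPn => p1; last first.
  case: v => [|i v] /=; first by rewrite p0.
  apply/esym/negP => piv; move/negP: p1; apply.
  have pi : p [:: i] by apply: (@plane_pred_cat p [:: i] v).
  by case: i pi {piv} => // i pi; have [_] := pr [::] i.+1 pi; apply.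
have IHl := IH (fun v => p (0%N :: v)); have IHr := IH (p \o sh).
case: v => [|[|i] v] /=; first by rewrite p0.
  apply: IHl => [|v' /pn]; last by rewrite /= add0n addSn.
  by split=> // u i /(pr (0%N :: u) i).
rewrite (IHr _ _ (i :: v)) // => [|[|j v'] //].
  split=> // -[|k u] j /=; first by move=> /(pr [::] j.+1)[_ h]; split=> // j' jj; apply: (h j'.+1).
  by move=> /(pr (k.+1 :: u) j).
by move=> /pn /=; rewrite addSn addnS.
Qed.

Lemma toset_inj : injective toset.
Proof.
move=> a b /fsetP ab; have {}ab v : inb a v = inb b v by rewrite -!mem_toset ab.
elim: a b ab => [|l IHl r IHr] [|l' r'] ab //.
- by have := ab [:: 0%N]; rewrite /= inb0.
- by have := ab [:: 0%N]; rewrite /= inb0.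
congr B; first by apply: IHl => v; exact: (ab (0%N :: v)).
by apply: IHr => -[|i v]; [rewrite !inb0|exact: (ab (i.+1 :: v))].
Qed.

Lemma toset_surj t : plane_tree t -> exists a, toset a = t.
Proof.
move=> [t0 pt]; exists (ofpred (\max_(v <- t) (size v + sumn v)) (fun v => v \in t)).
apply/fsetP => v; rewrite mem_toset inb_ofpred // => u ut.
exact: (leq_bigmax_seq (F := fun v => (size v + sumn v)%N)).
Qed.

(** * Generating series of weighted forests *)

(** The bound m on the size makes the recursion structural; [layerE] removes it. *)
Fixpoint layer m k : seq bt :=
  if m is m'.+1 then
    if k is k'.+1 then
      flatten [seq [seq B l r | l <- layer m' i, r <- layer m' (k' - i)%N] | i <- iota 0 k]
    else [:: E]
  else if k is _.+1 then [::] else [:: E].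
Definition forests k := layer k k.

Lemma layerS m k : layer m.+1 k.+1 =
  flatten [seq [seq B l r | l <- layer m i, r <- layer m (k - i)%N] | i <- iota 0 k.+1].
Proof. by []. Qed.

Lemma mem_layer m k a : (k <= m)%N -> (a \in layer m k) = (bsize a == k).
Proof.
elim: m k a => [|m IH] [|k] a //.
- by case: a => *; rewrite mem_seq1; apply/eqP.
- by case: a => *; rewrite mem_seq1; apply/eqP.
move=> km; rewrite layerS; apply/flatten_mapP/eqP => [[i]|].
  rewrite mem_iota => /andP[_ ik] /allpairsP[[l r] /= []].
  rewrite !IH; [|lia|lia] => /eqP li /eqP rk ->; rewrite /= li rk; lia.
case: a => [//|l r] [lr]; exists (bsize l); first by rewrite mem_iota; lia.
apply/allpairsP; exists (l, r); split=> //=; rewrite IH; lia.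
Qed.

Lemma layer_uniq m k : (k <= m)%N -> uniq (layer m k).
Proof.
elim: m k => [|m IH] [|k] // km; rewrite layerS.
have : forall j, j \in iota 0 k.+1 -> (j <= k)%N by move=> j; rewrite mem_iota.
have := iota_uniq 0 k.+1; elim: (iota 0 k.+1) => //= i s IHs /andP[nis us] sk.
have {}IHs := IHs us (fun j js => sk j (mem_behead (s := i :: s) js)).
rewrite cat_uniq IHs andbT; have ik := sk i (mem_head _ _).
apply/andP; split.
  by apply: allpairs_uniq => [||[l r] [l' r'] _ _ [-> ->]] //; apply: IH; lia.
apply/hasPn => a /flatten_mapP[j js] /allpairsP[[l r] /= [lj _ ->]].
apply/negP => /allpairsP[[l' r'] /= [li _ [ll' _]]].
have jk : (j <= k)%N by apply: sk; rewrite inE js orbT.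
move: lj li; rewrite -ll' !mem_layer; [|lia|lia] => /eqP lj /eqP li.
by move: nis; rewrite -li lj js.
Qed.

Lemma layerE m k : (k <= m)%N -> layer m k = forests k.
Proof.
rewrite /forests; elim: m {-2}m (leqnn m) k => [|M IH] [|m] mM [|k] // km.
rewrite !layerS; congr flatten; apply/eq_in_map => i; rewrite mem_iota => ik.
by congr allpairs_dep; [|apply/funext => _]; rewrite (IH m) ?(IH k) //; lia.
Qed.

Lemma mem_forests k a : (a \in forests k) = (bsize a == k).
Proof. exact: mem_layer. Qed.

Lemma forests_uniq k : uniq (forests k).
Proof. exact: layer_uniq. Qed.

Lemma sum_forestsS (R : zmodType) (G : bt -> R) k :
  \sum_(a <- forests k.+1) G a =
  \sum_(i < k.+1) \sum_(l <- forests i) \sum_(r <- forests (k - i)) G (B l r).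
Proof.
rewrite {1}/forests layerS big_flatten big_map -(big_mkord xpredT (fun i =>
  \sum_(l <- forests i) \sum_(r <- forests (k - i)) G (B l r))) /index_iota subn0.
apply: eq_big_seq => i; rewrite mem_iota => ik; rewrite big_allpairs_dep.
by rewrite !layerE //; lia.
Qed.

Lemma len_le a : (len a <= bsize a)%N.
Proof. elim: a => //= l _ r IH; lia. Qed.

Section ForestSeries.
Context (R : realType) (mu : nat -> R).
Context (om tau : bt -> R) (omE : om E = 1) (omB : forall l r, om (B l r) = tau l * om r).

Definition tser : fps R := fX R * (fun k => \sum_(l <- forests k) tau l).

(** A forest of c trees is a sequence of c trees: [omB] makes the weight multiplicative along it,
    and the root of each tree accounts for one factor X. *)
Lemma tser_pow c k : (tser ^+ c) k = \sum_(a <- forests k | len a == c) om a.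
Proof.
elim: c k => [|c IH] k.
  rewrite expr0 fps1; case: k => [|k].
    by rewrite /forests big_cons big_nil /= omE addr0.
  rewrite big_seq_cond big1 // => a; rewrite mem_forests => /andP[/eqP ak].
  by case: a ak.
rewrite exprS /tser -mulrA; case: k => [|k].
  by rewrite fXM0 /forests big_cons big_nil.
rewrite fXMS fpsM [RHS]big_mkcond sum_forestsS; apply: eq_bigr => i _.
rewrite mulr_suml; apply: eq_bigr => l _; rewrite IH mulr_sumr [LHS]big_mkcond.
apply: eq_bigr => r _; rewrite /= eqSS; case: ifP => _; last by [].
by rewrite omB.
Qed.

Lemma Fs_tser k : Fs mu tser k = \sum_(a <- forests k) mu (len a) * om a.
Proof.
rewrite /Fs /fsumm; under eq_bigr => c _ do rewrite fCM tser_pow mulr_sumr.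
rewrite (exchange_big_dep xpredT) //=; apply: eq_big_seq => a; rewrite mem_forests => /eqP ak.
have ac : (len a < k.+3)%N by have := len_le a; lia.
rewrite (bigD1 (Ordinal ac)) //= big1 ?addr0 // => c /andP[/eqP ac' cn].
by move: cn; rewrite -val_eqE /= ac' eqxx.
Qed.

End ForestSeries.

(** * Independent increments as iterated sums *)

Definition upd (T : eqType) (V : Type) (u : T) (z : V) (xi : T -> V) : T -> V :=
  fun v => if v == u then z else xi v.

Section IteratedSum.
Context (R : comNzRingType) (V : finZmodType) (p : V -> R).

(* expectation over independent increments with law p at the words of s *)
Fixpoint Ex (T : eqType) (s : seq T) (f : (T -> V) -> R) : R :=
  if s is u :: s' then \sum_z p z * Ex s' (fun xi => f (upd u z xi)) else f (fun=> 0).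

Lemma eq_Ex (T : eqType) (s : seq T) (f g : (T -> V) -> R) :
  (forall xi, f xi = g xi) -> Ex s f = Ex s g.
Proof. by move=> /funext ->. Qed.

Lemma ExZ (T : eqType) (s : seq T) a f : Ex s (fun xi => a * f xi) = a * Ex s f.
Proof.
elim: s f => //= u s IH f; rewrite mulr_sumr; apply: eq_bigr => z _.
by rewrite IH mulrCA.
Qed.

Lemma ExB (T : eqType) (s : seq T) f g : Ex s (fun xi => f xi - g xi) = Ex s f - Ex s g.
Proof.
elim: s f g => //= u s IH f g; rewrite -sumrB; apply: eq_bigr => z _.
by rewrite IH mulrBr.
Qed.

Lemma Ex1 (T : eqType) (s : seq T) : \sum_z p z = 1 -> Ex s (fun=> 1) = 1.
Proof.
move=> p1; elim: s => //= u s IH; under eq_bigr do rewrite IH mulr1.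
by [].
Qed.

Lemma Ex_map (T T' : eqType) (h : T -> T') (s : seq T) f : injective h ->
  Ex (map h s) (fun xi => f (xi \o h)) = Ex s f.
Proof.
move=> hi; elim: s f => //= u s IH f; apply: eq_bigr => z _; congr (_ * _).
rewrite -IH; apply: eq_Ex => xi; congr f; apply/funext => v.
by rewrite /upd /= (inj_eq hi).
Qed.

Definition indep (T : eqType) (f : (T -> V) -> R) u := forall z xi, f (upd u z xi) = f xi.

Lemma indep_upd (T : eqType) (f : (T -> V) -> R) u v z : indep f v ->
  indep (fun xi => f (upd u z xi)) v.
Proof.
move=> fv z' xi; have [->|vu] := eqVneq v u.
  by congr f; apply/funext => w; rewrite /upd; case: eqP.
rewrite -(fv z' (upd u z xi)); congr f; apply/funext => w; rewrite /upd.
by case: (eqVneq w u) => // ->; rewrite eq_sym (negbTE vu).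
Qed.

Lemma Ex_indep (T : eqType) (s : seq T) f g : (forall u, u \in s -> indep f u) ->
  Ex s (fun xi => f xi * g xi) = f (fun=> 0) * Ex s g.
Proof.
elim: s f g => //= u s IH f g fs; rewrite mulr_sumr; apply: eq_bigr => z _.
rewrite (@eq_Ex _ _ _ (fun xi => f xi * g (upd u z xi))); last first.
  by move=> xi; rewrite fs ?mem_head.
rewrite IH; last by move=> v vs; apply: fs; rewrite inE vs orbT.
by rewrite mulrCA.
Qed.

Lemma Ex_cat (T : eqType) (s1 s2 : seq T) f g :
  (forall u, u \in s2 -> indep f u) -> (forall u, u \in s1 -> indep g u) ->
  Ex (s1 ++ s2) (fun xi => f xi * g xi) = Ex s1 f * Ex s2 g.
Proof.
elim: s1 f => [|u s IH] f fs gs /=; first exact: Ex_indep.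
rewrite mulr_suml; apply: eq_bigr => z _.
rewrite (@eq_Ex _ _ _ (fun xi => f (upd u z xi) * g xi)); last first.
  by move=> xi; rewrite gs ?mem_head.
rewrite IH ?mulrA // => v vs; last by apply: gs; rewrite inE vs orbT.
by apply: indep_upd; apply: fs.
Qed.

(** The functions are forced to be 0 off the list l, so that the induction can release one word at a
    time; [Ex_ffun] is the case where l enumerates S. *)
Lemma Ex_ffun_sub (S : {fset seq nat}) (l : seq (seq nat)) (f : (seq nat -> V) -> R) :
  uniq l -> {subset l <= S} ->
  \sum_(xi : {ffun S -> V} | [forall v, (val v \notin l) ==> (xi v == 0)])
    f (ext0 xi) * \prod_(v | val v \in l) p (xi v) = Ex l f.
Proof.
elim: l f => [|u l IH] f /=.
  move=> _ _; rewrite (big_pred1 [ffun=> 0]) => [|xi].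
    rewrite big_pred0 // mulr1; congr f; apply/funext => v; rewrite /ext0.
    by case: insub => //= w; rewrite ffunE.
  apply/forallP/eqP => [h|-> v]; last by rewrite ffunE eqxx.
  by apply/ffunP => v; rewrite ffunE; apply/eqP; have := h v.
case/andP=> ul us lS; have uS : u \in S by apply: lS; rewrite mem_head.
pose u' : S := [` uS]%fset.
pose ff z (xi : {ffun S -> V}) : {ffun S -> V} := [ffun v => if v == u' then z else xi v].
rewrite (partition_big (fun xi : {ffun S -> V} => xi u') xpredT) //=.
apply: eq_bigr => z _; rewrite -IH //; last by move=> v vl; apply: lS; rewrite inE vl orbT.
rewrite mulr_sumr (reindex_onto (ff z) (ff 0)) /=; last first.
  move=> xi /andP[_ /eqP xz]; apply/ffunP => v; rewrite !ffunE.
  by case: eqP => // ->.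
have vu (v : S) : (val v == u) = (v == u') by [].
apply: eq_big => [xi|xi _].
  rewrite ffunE eqxx eqxx andbT; apply/andP/forallP => [[/forallP h /eqP h0] v|h].
    have := h v; rewrite inE vu ffunE negb_or; case: (eqVneq v u') => // -> _.
    by apply/implyP => _; rewrite -h0 !ffunE eqxx.
  split.
    apply/forallP => v; have := h v; rewrite inE vu ffunE negb_or.
    by case: (eqVneq v u').
  apply/eqP/ffunP => v; rewrite !ffunE; case: eqP => // ->.
  by have := h u'; rewrite ul => /eqP.
rewrite mulrCA; congr (_ * _).
  congr f; apply/funext => v; rewrite /ext0 /upd; case: insubP => [w _ <-|] /=.
    by rewrite vu ffunE.
  by case: eqP => // ->; rewrite uS.
rewrite (bigD1 u') /=; last by rewrite mem_head.
rewrite ffunE eqxx; congr (_ * _); apply: eq_big => [v|v].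
  by rewrite inE vu; case: (eqVneq v u') => [->|]; rewrite ?andbF ?andbT ?(negbTE ul).
by case/andP=> _ /negbTE vu'; rewrite ffunE vu'.
Qed.

Lemma Ex_ffun (S : {fset seq nat}) (l : seq (seq nat)) (f : (seq nat -> V) -> R) :
  uniq l -> l =i S ->
  \sum_(xi : {ffun S -> V}) f (ext0 xi) * \prod_v p (xi v) = Ex l f.
Proof.
move=> ul lS; rewrite -(@Ex_ffun_sub S) // => [|v]; last by rewrite lS.
apply: eq_big => [xi|xi _].
  by apply/esym/forallP => v; rewrite lS fsvalP.
by congr (_ * _); apply: eq_bigl => v; rewrite lS fsvalP.
Qed.

End IteratedSum.

(** * Avoidance by the walk indexed by a forest *)

Section Avoid.
Context (V : zmodType).
Implicit Types (y : V) (xi : seq nat -> V).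

Lemma eq_walk y xi xi' v : (forall u, u <> [::] -> xi u = xi' u) ->
  walk y xi v = walk y xi' v.
Proof.
move=> h; rewrite /walk !big_nat; congr (_ + _); apply: eq_bigr => m /andP[m0 mv].
by apply: h => /(congr1 size); rewrite size_takel //=; lia.
Qed.

Lemma walk_cons0 y xi v :
  walk y xi (0%N :: v) = walk (y + xi [:: 0%N]) (xi \o cons 0%N) v.
Proof.
by rewrite /walk /= big_nat_recl //= take0 addrA big_add1.
Qed.

Lemma walk_sh y xi v : v <> [::] -> walk y xi (sh v) = walk y (xi \o sh) v.
Proof.
case: v => // i v _; rewrite /walk /=; congr (_ + _).
by rewrite !big_nat; apply: eq_bigr => -[|m] // _.
Qed.

Lemma walk0 y xi : walk y xi [::] = y.
Proof. by rewrite /walk big_geq ?addr0. Qed.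

End Avoid.

Section AvoidProb.
Context (R : comNzRingType) (V : finZmodType) (p : V -> R) (A : pred V).

Definition avoids y (xi : seq nat -> V) a := all (fun v => ~~ A (walk y xi v)) (words a).

Fixpoint av a y : R :=
  if a is B l r then
    (\sum_z p z * if A (y + z) then 0 else av l (y + z)) * av r y
  else 1.

Lemma eq_avoids y xi xi' a : (forall u, u <> [::] -> xi u = xi' u) ->
  avoids y xi a = avoids y xi' a.
Proof. by move=> h; apply: eq_all => v; rewrite (eq_walk _ _ h). Qed.

Lemma avoids_B y xi l r : avoids y xi (B l r) =
  [&& ~~ A (y + xi [:: 0%N]), avoids (y + xi [:: 0%N]) (xi \o cons 0%N) l &
     avoids y (xi \o sh) r].
Proof.
rewrite /avoids /= all_cat !all_map walk_cons0 walk0; congr [&& _, _ & _].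
  by apply: eq_all => v /=; rewrite walk_cons0.
by apply: eq_in_all => v /words_neq0 v0 /=; rewrite walk_sh.
Qed.

(** The forests l and r use disjoint sets of words, those beginning with 0 and those moved by [sh],
    so the expectation factors. *)
Lemma Ex_avoids a y : Ex p (words a) (fun xi => (avoids y xi a)%:R) = av a y.
Proof.
elim: a y => [|l IHl r IHr] y //=.
rewrite mulr_suml; apply: eq_bigr => z _; rewrite -mulrA; congr (_ * _).
pose f (xi : seq nat -> V) : R := (~~ A (y + z) && avoids (y + z) (xi \o cons 0%N) l)%:R.
pose g (xi : seq nat -> V) : R := (avoids y (xi \o sh) r)%:R.
rewrite (@eq_Ex _ _ _ _ _ _ (fun xi => f xi * g xi)); last first.
  move=> xi; rewrite avoids_B /f /g /upd eqxx -natrM mulnb andbA.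
  congr (nat_of_bool (_ && _ && _))%:R; apply: eq_avoids => -[|i u] // _.
have c0 : injective (cons 0%N : seq nat -> seq nat) by move=> ? ? [].
rewrite Ex_cat; last 2 first.
- move=> u /mapP[v /words_neq0]; case: v => // i v _ -> z' xi; rewrite /f.
  by congr (nat_of_bool (_ && _))%:R; apply: eq_avoids => w _.
- move=> u /mapP[v _ -> z' xi]; rewrite /g.
  by congr (nat_of_bool _)%:R; apply: eq_avoids => -[|i w].
rewrite /f /g (Ex_map p (words r) (fun xi => (avoids y xi r)%:R) sh_inj) IHr.
congr (_ * _).
rewrite (Ex_map p (words l) (fun xi => (~~ A (y + z) && avoids (y + z) xi l)%:R) c0).
case: (A (y + z)) => /=; last exact: IHl.
rewrite (@eq_Ex _ _ _ _ _ _ (fun xi => 0 * (avoids (y + z) xi l)%:R)) ?ExZ ?mul0r //.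
by move=> xi; rewrite mul0r.
Qed.

End AvoidProb.

(** * Weighted trees and the series of the hitting probability *)

Section TreeLaw.
Context (R : realType) (mu : nat -> R) (mu_ge0 : forall c, 0 <= mu c).

(** The root below the forest is left out; its own factor [mu (len a)] appears in [gw_law_toset]. *)
Fixpoint wt a : R := if a is B l r then mu (len l) * wt l * wt r else 1.

Lemma wt_ge0 a : 0 <= wt a.
Proof. by elim: a => //= l IHl r IHr; rewrite !mulr_ge0. Qed.

Lemma prod_kids a : \prod_(u <- words a) mu (kids a u) = wt a.
Proof.
elim: a => [|l IHl r IHr]; first by rewrite big_nil.
rewrite /= big_cons big_cat !big_map kids0 -mulrA; congr (_ * (_ * _)).
  by rewrite -IHl; apply: eq_bigr.
rewrite -IHr; apply: eq_big_seq => u /words_neq0.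
by case: u.
Qed.

Lemma gw_law_toset a : gw_law mu (toset a) = mu (len a) * wt a.
Proof.
rewrite /gw_law (perm_big _ (perm_toset a)) big_cons nb_children_toset kids0.
by congr (_ * _); rewrite -prod_kids; apply: eq_bigr => u _; rewrite nb_children_toset.
Qed.

Lemma plane_treesE n : plane_trees n.+1 = [set` map toset (forests n)].
Proof.
apply/seteqP; split=> [t [pt tn]|t /mapP[a]].
  have [a ta] := toset_surj pt; apply/mapP; exists a; last by [].
  by rewrite mem_forests -eqSS -card_toset ta tn.
rewrite mem_forests => /eqP an ->; split; first exact: plane_toset.
by rewrite card_toset an.
Qed.

Lemma sum_plane_trees (F : {fset seq nat} -> R) n :
  \sum_(t \in plane_trees n.+1) F t = \sum_(a <- forests n) F (toset a).
Proof.
rewrite plane_treesE -fsbig_seq ?big_map //.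
by rewrite (map_inj_uniq toset_inj) forests_uniq.
Qed.

Definition Tser : fps R := tser (fun a => mu (len a) * wt a).

Lemma TserE : Tser = fX R * Fs mu Tser.
Proof.
congr (_ * _); apply/funext => k.
by rewrite (@Fs_tser _ mu wt).
Qed.

Lemma tser_ge0 (tau : bt -> R) : (forall a, 0 <= tau a) -> 0 <=p tser tau.
Proof.
by move=> t0; apply: fle0M; [exact: fle0fX|move=> k; apply: sumr_ge0].
Qed.

Lemma Tser_ge0 : 0 <=p Tser.
Proof. by apply: tser_ge0 => a; rewrite mulr_ge0 ?wt_ge0. Qed.

Lemma sum_gw n : \sum_(t \in plane_trees n.+1) gw_law mu t = Tser n.+1.
Proof.
by rewrite sum_plane_trees /Tser /tser fXMS; apply: eq_bigr => a _; rewrite gw_law_toset.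
Qed.

Section WalkLaw.
Context (V : finZmodType) (p : V -> R) (p_ge0 : forall z, 0 <= p z) (p_sum : \sum_z p z = 1)
  (A : pred V).
Context (I : eqType) (r : seq I) (th : I -> R) (io : I -> V)
  (pE : forall g : V -> R, \sum_z p z * g z = \sum_(z <- r) th z * g (io z)).

Lemma av_bound a y : 0 <= av p A a y <= 1.
Proof.
elim: a y => [|l IHl q IHq] y /=; first by rewrite ler01 lexx.
have /andP[q0 q1] := IHq y.
have h z : 0 <= (if A (y + z) then 0 else av p A l (y + z)) <= 1.
  by case: ifP => _; rewrite ?lexx ?ler01.
apply/andP; split.
  apply: mulr_ge0 => //; apply: sumr_ge0 => z _; apply: mulr_ge0 => //.
  by case/andP: (h z).
apply: mulr_ile1 => //.
  by apply: sumr_ge0 => z _; apply: mulr_ge0 => //; case/andP: (h z).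
rewrite -p_sum; apply: ler_sum => z _; rewrite ler_piMr //.
by case/andP: (h z).
Qed.

(** The exact series [al]: a tree reached from y through one random edge and avoiding A, its root
    included. *)
Definition alser (y : V) : fps R := tser (fun a => mu (len a) * wt a *
  \sum_z p z * if A (y + z) then 0 else av p A a (y + z)).

Lemma Fs_alser y k : Fs mu (alser y) k = \sum_(a <- forests k) mu (len a) * wt a * av p A a y.
Proof.
rewrite (@Fs_tser _ mu (fun a => wt a * av p A a y)) /=.
- by apply: eq_bigr => a _; rewrite mulrA.
- by rewrite mulr1.
- by move=> l q; ring.
Qed.

Lemma alserE y : alser y = Tf r th io (kill A (fun p => fX R * Fs mu (alser p))) y.
Proof.
apply/funext => -[|k].
  rewrite /alser /tser fXM0 /Tf fps_sum big1 // => z _; rewrite fCM /kill.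
  by case: ifP => _; rewrite ?fXM0 mulr0.
rewrite {1}/alser /tser fXMS /Tf fps_sum.
under [RHS]eq_bigr => z _.
  rewrite fCM; have -> : kill A (fun p => fX R * Fs mu (alser p)) (y + io z) k.+1 =
    \sum_(a <- forests k) mu (len a) * wt a * if A (y + io z) then 0 else av p A a (y + io z).
    rewrite /kill; case: ifP => _; last by rewrite fXMS Fs_alser.
    by rewrite big1 // => a _; rewrite mulr0.
  rewrite mulr_sumr; over.
rewrite exchange_big; apply: eq_bigr => a _ /=.
rewrite (pE (fun z => if A (y + z) then 0 else av p A a (y + z))) mulr_sumr.
by apply: eq_bigr => z _; rewrite mulrCA.
Qed.

Lemma alser_tau_ge0 a y : 0 <= \sum_z p z * (if A (y + z) then 0 else av p A a (y + z)) <= 1.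
Proof.
have h z : 0 <= (if A (y + z) then 0 else av p A a (y + z)) <= 1.
  by case: ifP => _; rewrite ?lexx ?ler01 ?av_bound.
apply/andP; split.
  by apply: sumr_ge0 => z _; apply: mulr_ge0 => //; case/andP: (h z).
by rewrite -p_sum; apply: ler_sum => z _; rewrite ler_piMr //; case/andP: (h z).
Qed.

Lemma alser_ge0 y : 0 <=p alser y.
Proof.
apply: tser_ge0 => a; rewrite !mulr_ge0 ?wt_ge0 //.
by case/andP: (alser_tau_ge0 a y).
Qed.

Lemma alser_le y : alser y <=p Tser.
Proof.
apply: fleM2l; first exact: fle0fX.
move=> k; apply: ler_sum => a _; rewrite ler_piMr ?mulr_ge0 ?wt_ge0 //.
by case/andP: (alser_tau_ge0 a y).
Qed.

Lemma HitS_coef y n : HitS mu Tser A alser y n.+1 =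
  \sum_(a <- forests n) mu (len a) * wt a * (1 - (~~ A y)%:R * av p A a y).
Proof.
rewrite /HitS fpsB {1}/Tser /tser fXMS.
have -> : kill A (fun p => fX R * Fs mu (alser p)) y n.+1 =
    \sum_(a <- forests n) mu (len a) * wt a * ((~~ A y)%:R * av p A a y).
  rewrite /kill; case: (A y) => /=.
    by rewrite big1 // => a _; rewrite mul0r mulr0.
  by rewrite fXMS Fs_alser; apply: eq_bigr => a _; rewrite mul1r.
by rewrite -sumrB; apply: eq_bigr => a _; rewrite mulrBr mulr1.
Qed.

End WalkLaw.

Section HitProb.
Context (d N : nat) (theta : 'rV[int]_d -> R) (sl : seq 'rV[int]_d) (sl_uniq : uniq sl)
  (sl_supp : forall z, z \notin sl -> theta z = 0)
  (th_ge0 : forall z, 0 <= theta z) (th_sum : \sum_(z <- sl) theta z = 1)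
  (K : {fset 'rV[int]_d}).

Local Notation p := (@torus_step R d N theta).
Let KK := [fset torus_proj N y | y in K]%fset.
Let A := [pred y | y \in KK].

Lemma torus_stepE y : p y = \sum_(x <- sl | torus_proj N x == y) theta x.
Proof.
rewrite -big_filter fsbig_seq ?filter_uniq // /torus_step.
apply/esym/fsbig_widen => x /=; rewrite mem_filter; first by case/andP => /eqP.
by case=> /eqP -> /negP xs; apply: sl_supp.
Qed.

Lemma torus_step_sum (g : torus d N -> R) :
  \sum_z p z * g z = \sum_(z <- sl) theta z * g (torus_proj N z).
Proof.
under eq_bigr do rewrite torus_stepE mulr_suml.
rewrite (exchange_big_dep xpredT) //=; apply: eq_bigr => x _.
by rewrite (big_pred1 (torus_proj N x)) // => y /=; rewrite eq_sym.
Qed.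

Lemma torus_step_ge0 y : 0 <= p y.
Proof. by rewrite torus_stepE; apply: sumr_ge0. Qed.

Lemma torus_step1 : \sum_z p z = 1.
Proof.
rewrite -th_sum; have := torus_step_sum (fun=> 1).
by under eq_bigr do rewrite mulr1; under [in RHS]eq_bigr do rewrite mulr1.
Qed.

Lemma range_meets a x (xi : seq nat -> torus d N) :
  ((tree_range (toset a) (walk x xi) `&` KK)%fset != fset0) =
  ~~ (~~ A x && avoids A x xi a).
Proof.
rewrite negb_and negbK; apply/fset0Pn/orP.
  move=> [y]; rewrite inE => /andP[/imfsetP[v /= va ->] yK].
  move: va; rewrite mem_toset; case: (eqVneq v [::]) => [v0 _|v0 va].
    by left; rewrite /= -(walk0 x xi) -v0.
  right; apply/allPn; exists v; first by rewrite mem_words v0.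
  by rewrite negbK.
case=> [xK|/allPn[v vw]].
  have {}xK : x \in KK by [].
  exists x; rewrite inE xK andbT; apply/imfsetP; exists [::] => /=.
    by rewrite mem_toset inb0.
  by rewrite walk0.
rewrite negbK => vK; have {}vK : walk x xi v \in KK by [].
exists (walk x xi v); rewrite inE vK andbT.
apply/imfsetP; exists v => //=; rewrite mem_toset.
by move: vw; rewrite mem_words => /andP[].
Qed.

Lemma hit_prob_toset a : hit_prob_given_tree N theta K (toset a) =
  #|{: torus d N}|%:R^-1 * \sum_x (1 - (~~ A x)%:R * av p A a x).
Proof.
rewrite /hit_prob_given_tree mulr_sumr; apply: eq_bigr => x _.
under eq_bigr do rewrite mulrCA.
rewrite -mulr_sumr; congr (_ * _).
have wS : words a =i (toset a `\ [::])%fset.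
  by move=> v; rewrite !inE /= mem_words; case: v.
rewrite (@Ex_ffun _ _ p _ _ (fun xi => ((tree_range (toset a) (walk x xi) `&` KK)%fset != fset0)%:R)
  (words_uniq a) wS).
rewrite (@eq_Ex _ _ p _ _ _ (fun xi => 1 - (~~ A x)%:R * (avoids A x xi a)%:R)); last first.
  move=> xi; rewrite range_meets -natrM mulnb.
  by case: (_ && _); rewrite /= ?subrr ?subr0.
by rewrite ExB ExZ Ex_avoids Ex1 // torus_step1.
Qed.

Lemma hit_prob_series n : hit_prob mu theta n.+1 N K =
  #|{: torus d N}|%:R^-1 * (\sum_y HitS mu Tser A (alser p A) y n.+1) / Tser n.+1.
Proof.
rewrite /hit_prob sum_plane_trees /cond_gw_law sum_gw.
under eq_bigr do rewrite gw_law_toset hit_prob_toset mulrCA -mulrA.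
rewrite -mulr_sumr -mulrA; congr (_ * _).
under [in RHS]eq_bigr do rewrite HitS_coef.
rewrite exchange_big mulr_suml; apply: eq_bigr => a _ /=.
by rewrite -mulr_sumr; ring.
Qed.

End HitProb.
End TreeLaw.

(** * Offspring and step laws *)

Section Offspring.
Context (R : realType) (mu : nat -> R) (hmu : offspring_law mu).

Lemma eseries_mass (f : nat -> R) x : (forall i, 0 <= f i) ->
  (\sum_(0 <= i <oo) (f i)%:E = x%:E)%E -> mass f x.
Proof.
move=> f0 fx.
have h : (fun n => (\sum_(0 <= i < n) (f i)%:E)%E) @ \oo --> x%:E.
  by rewrite -fx; apply: is_cvg_nneseries => i _ _; rewrite lee_fin.
have e : psum f = fine \o (fun n => (\sum_(0 <= i < n) (f i)%:E)%E).
  by apply/funext => n /=; rewrite big_mkord /psum sumEFin.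
by rewrite /mass e; exact: fine_cvg h.
Qed.

Let mu_ge0 : 0 <=p (mu : fps R). Proof. exact: offspring_ge0. Qed.

Lemma offspring_mass : mass mu 1.
Proof. by apply: eseries_mass; [exact: offspring_ge0|exact: offspring_sum]. Qed.

Lemma offspring_massD : mass (fD mu) 1.
Proof.
apply: eseries_mass; last exact: offspring_mean.
by move=> i; rewrite mulr_ge0 ?mu_ge0.
Qed.

(** C(i, 2) (c-1)^2 is one term in the expansion of c^i, so the exponential moment dominates i(i-1),
    and the mean supplies the remaining i. *)
Lemma offspring_massDD : exists s, mass (fD (fD mu)) s.
Proof.
have [c c1 hc] := offspring_exp_moment hmu.
pose f i := c ^+ i * mu i.
have f0 i : 0 <= f i by rewrite mulr_ge0 ?mu_ge0 ?exprn_ge0 //; lra.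
have [x fx] : exists x, mass f x.
  exists (fine (\sum_(0 <= i <oo) (f i)%:E)%E); apply: eseries_mass => //.
  rewrite fineK // ge0_fin_numE //.
  by apply: nneseries_ge0 => i _ _; rewrite lee_fin.
pose dl := c - 1; have dl0 : 0 < dl by rewrite /dl; lra.
have vm := massD (massC (c := 2 / dl ^+ 2) fx) offspring_massD.
exists (limn (psum (fD (fD mu)))); apply: (proj1 (mass_dom _ _ vm)).
  by move=> i; rewrite !mulr_ge0 ?mu_ge0.
move=> i; rewrite fpsD fCM /fD /f !mulrA -mulrDl; apply: ler_wpM2r; first exact: mu_ge0.
have h : 'C(i, 2)%:R * dl ^+ 2 <= c ^+ i.
  have -> : c = 1 + dl by rewrite /dl; ring.
  case: (ltnP i 2) => [i2|i2]; first by rewrite bin_small // mul0r exprn_ge0 // ; lra.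
  have i3 : (2 < i.+1)%N by [].
  rewrite [leRHS]exprDn.
  rewrite (bigD1 (Ordinal i3)) //= expr1n mul1r mulr_natl lerDl.
  by apply: sumr_ge0 => j _; rewrite expr1n mul1r mulrn_wge0 // exprn_ge0 // ltW.
have -> : i%:R * i%:R = 2 * 'C(i, 2)%:R + i%:R :> R.
  rewrite -natrM -[2 * _]natrM -natrD; congr _%:R.
  by elim: i {h} => // i IH; rewrite binS bin1; nia.
rewrite lerD2r -(ler_pM2r (_ : 0 < dl ^+ 2)); last by rewrite exprn_gt0.
by rewrite -mulrA mulrAC divfK ?gt_eqF ?exprn_gt0 // ; nra.
Qed.

(** If mu(0) = 0, the terms (i-1) mu(i) are nonnegative with sum 0 by mean one, which forces the
    Dirac mass at 1. *)
Lemma offspring_mu0 : 0 < mu 0%N.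
Proof.
rewrite lt_neqAle mu_ge0 andbT eq_sym; apply/negP => /eqP m0.
have mf := massD (massC (c := - 1) offspring_mass) offspring_massD.
have f0 : 0 <=p fC (- 1) * (mu : fps R) + fD mu.
  move=> [|i]; rewrite fpsD fCM /fD; first by rewrite m0 !mulr0 addr0.
  by rewrite -mulrDl mulr_ge0 ?mu_ge0 // mulN1r mulrS addKr.
rewrite mulr1 addNr in mf.
have mi i : (2 <= i)%N -> mu i = 0.
  move=> i2; have := mass_le i.+1 f0 mf; rewrite /psum big_ord_recr /=.
  have p0 : 0 <= psum (fC (- 1) * (mu : fps R) + fD mu) i by exact: psum_ge0.
  move: p0; rewrite /psum => p0 h.
  have : (fC (- 1) * (mu : fps R) + fD mu) i <= 0 by lra.
  rewrite fpsD fCM /fD -mulrDl pmulr_rle0; last by rewrite addrC subr_gt0 ltr1n.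
  by move=> h'; apply/eqP; rewrite eq_le h' mu_ge0.
have := mass_uniq offspring_mass (mass_fin mi); rewrite /psum !big_ord_recr big_ord0 /= m0 !add0r.
by move=> /esym m1; have := offspring_not_dirac1 hmu; rewrite m1 eqxx.
Qed.

Let S k := exists r, 0 < ((mu : fps R) ^+ r) k.

Lemma muX_ge0 r : 0 <=p (mu : fps R) ^+ r.
Proof. exact: fle0X. Qed.

Lemma muX_gt0D r s k l : 0 < ((mu : fps R) ^+ r) k -> 0 < ((mu : fps R) ^+ s) l ->
  0 < ((mu : fps R) ^+ (r + s)) (k + l)%N.
Proof.
move=> h1 h2; rewrite exprD fpsM.
have kl : (k < (k + l).+1)%N by lia.
rewrite (bigD1 (Ordinal kl)) //= addKn; apply: ltr_wpDr; last exact: mulr_gt0.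
by apply: sumr_ge0 => i _; apply: mulr_ge0; apply: muX_ge0.
Qed.

Lemma muX_gt0W r s k : (r <= s)%N -> 0 < ((mu : fps R) ^+ r) k -> 0 < ((mu : fps R) ^+ s) k.
Proof.
move=> rs; rewrite -(subnKC rs); elim: (s - r)%N => [|m IH]; first by rewrite addn0.
move=> /IH h; rewrite addnS -addn1 -[k]addn0; apply: muX_gt0D => //.
by rewrite expr1; exact: offspring_mu0.
Qed.

Lemma SD k l : S k -> S l -> S (k + l)%N.
Proof. by move=> [r hr] [s hs]; exists (r + s)%N; apply: muX_gt0D. Qed.

Lemma SM k q : S k -> S (q * k)%N.
Proof.
move=> Sk; elim: q => [|q IH]; first by exists 0%N; rewrite expr0 fps1.
by rewrite mulSn; apply: SD.
Qed.

Lemma S1 i : 0 < mu i -> S i.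
Proof. by exists 1%N; rewrite expr1. Qed.

(** Attainable values form a semigroup. Their least gap g divides every atom i, since otherwise i %%
    g would be a smaller gap, so span 1 gives g = 1. Steps equal to 0 bring k and k + 1 to the same
    number t of steps, and 2t steps then reach 2k, 2k + 1 and 2k + 2. *)
Lemma consecutive_atoms : exists2 r, (0 < r)%N & exists b, [/\ 0 < ((mu : fps R) ^+ r) b,
  0 < ((mu : fps R) ^+ r) b.+1 & 0 < ((mu : fps R) ^+ r) b.+2].
Proof.
have [_ span] := offspring_span1 hmu.
pose D g := `[< (0 < g)%N /\ exists2 k, S k & S (k + g)%N >].
have exD : exists g, D g.
  apply: contrapT => nD; suff : (0 %| 1)%N by [].
  apply: span => i /= mi; rewrite dvd0n; apply/negP => /negP i0; apply: nD; exists i.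
  apply/asboolP; rewrite lt0n; split=> //; exists 0%N; last exact: S1.
  by exists 0%N; rewrite expr0 fps1.
case: (ex_minnP exD) => g /asboolP[g0 [k Sk Skg]] gmin.
have {gmin} g1 : g = 1%N.
  suff gdvd i : 0 < mu i -> (g %| i)%N by apply/eqP; rewrite -dvdn1; apply: span => i /= /gdvd.
  move=> mi; apply/negPn/negP => ng.
  have : D (i %% g)%N.
    apply/asboolP; split; first by rewrite lt0n.
    exists (i %/ g * (k + g))%N; first exact: SM.
    have -> : (i %/ g * (k + g) + i %% g = i %/ g * k + i)%N.
      by rewrite mulnDr -addnA -divn_eq.
    by apply: SD; [exact: SM|exact: S1].
  by move=> /gmin; rewrite leqNgt ltn_pmod.
move: Sk Skg; rewrite {}g1 addn1 => -[r hr] [s hs].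
pose t := (r + s).+1.
have hr' : 0 < ((mu : fps R) ^+ t) k by apply: muX_gt0W hr; rewrite /t; lia.
have hs' : 0 < ((mu : fps R) ^+ t) k.+1 by apply: muX_gt0W hs; rewrite /t; lia.
exists (t + t)%N => //; exists (k + k)%N; split.
- exact: muX_gt0D.
- by rewrite -addnS; apply: muX_gt0D.
- by rewrite -addnS -addSn; apply: muX_gt0D.
Qed.

End Offspring.

Section Step.
Context (R : realType) (d : nat) (theta : 'rV[int]_d -> R) (hth : step_law theta).

Definition step_support : seq 'rV[int]_d := fset_set [set x | theta x != 0].

Lemma mem_step_support x : (x \in step_support) = (theta x != 0).
Proof.
rewrite -[LHS]/(x \in fset_set _) in_fset_set; last exact: step_finite_range hth.
by apply/idP/idP => [/set_mem|h]; [|apply/mem_set].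
Qed.

Lemma step_support_uniq : uniq step_support.
Proof. exact: fset_uniq. Qed.

Lemma step_support0 z : z \notin step_support -> theta z = 0.
Proof. by rewrite mem_step_support negbK => /eqP. Qed.

Lemma step_support_sum : \sum_(z <- step_support) theta z = 1.
Proof.
rewrite -(step_sum hth) fsbig_seq ?step_support_uniq //.
by apply: fsbig_widen => // x [_] /= /negP; exact: step_support0.
Qed.

Lemma step_support_sym (W : lmodType R) (f : 'rV[int]_d -> W) :
  \sum_(z <- step_support) theta z *: f (- z) = \sum_(z <- step_support) theta z *: f z.
Proof.
have pm : perm_eq step_support (map -%R step_support).
  apply: uniq_perm; first exact: step_support_uniq.
    by rewrite map_inj_uniq ?step_support_uniq //; exact: oppr_inj.
  by move=> z; rewrite -[z]opprK (mem_map oppr_inj) opprK !mem_step_support (step_sym hth).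
by rewrite [RHS](perm_big _ pm) big_map; apply: eq_bigr => z _; rewrite (step_sym hth).
Qed.

(** If the support did not span Q^d, the integer points annihilated by its cokernel would form a
    proper subgroup containing it; full rank then allows d independent rows to be selected. *)
Lemma step_basis : exists M : 'M[int]_d, [/\ forall i, row i M \in step_support,
  forall i, 0 < theta (row i M) & \det M != 0].
Proof.
pose sl := step_support; pose m := size sl.
pose X : 'M[rat]_(m, d) := \matrix_(i < m) map_mx intr (nth 0 sl i).
have fX : row_full X.
  rewrite -cokermx_eq0; apply/negPn/negP => c0.
  pose G := [pred x : 'rV[int]_d | map_mx intr x *m cokermx X == (0 : 'rV[rat]_d)].
  have Gz : zmod_closed G.
    split=> [|x y]; rewrite !inE; first by rewrite map_mx0 mul0mx.
    by move=> /eqP hx /eqP hy; rewrite map_mxB mulmxBl hx hy subrr.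
  have all x : x \in G.
    apply: (step_generates hth Gz) => z; rewrite -mem_step_support => zs.
    have iz : (index z sl < m)%N by rewrite index_mem.
    have -> : z = nth 0 sl (Ordinal iz) by rewrite /= nth_index.
    rewrite inE; have := mulmx_coker X => /(congr1 (row (Ordinal iz))).
    by rewrite row_mul rowK row0 => ->.
  move/negP: c0; apply; apply/eqP/row_matrixP => i.
  have := all (delta_mx 0 i); rewrite inE map_delta_mx -rowE => /eqP ->.
  by rewrite row0.
pose f := fullrankfun fX.
pose M : 'M[int]_d := \matrix_(i < d) nth 0 sl (f i).
have Ms i : row i M \in sl by rewrite rowK mem_nth.
exists M; split=> // [i|].
  by rewrite lt_neqAle (step_ge0 hth) andbT eq_sym -mem_step_support; apply: Ms.
have := fullrowsub_unit fX; rewrite unitmxE unitfE.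
have -> : rowsub f X = map_mx intr M.
  by apply/matrixP => i j; rewrite !mxE.
by rewrite det_map_mx intr_eq0.
Qed.

End Step.

(** * The truncation error *)

Section Error.
Context (R : realType).

(** Telescoping comparison with the primitive of x^(-3/2). The exponent 3 is 5 - 2: the decay
    j^(-5/2), available for d >= 5, times the weight j. *)
Lemma sum_inv_sqrt3 b m : (0 < b)%N -> (b <= m)%N ->
  \sum_(b <= g < m) (Num.sqrt (g.+1%:R : R))^-1 ^+ 3 <= 2 * ((Num.sqrt b%:R)^-1 - (Num.sqrt m%:R)^-1).
Proof.
move=> b0; elim: m => [|m IH]; first by move: b0; lia.
rewrite leq_eqVlt => /orP[/eqP <-|]; first by rewrite big_geq // subrr mulr0.
rewrite ltnS => bm; rewrite big_nat_recr //=.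
have m0 : (0 < m)%N by apply: leq_trans bm.
set x := Num.sqrt (m%:R : R); set y := Num.sqrt (m.+1%:R : R).
have x0 : 0 < x by rewrite sqrtr_gt0 ltr0n.
have y0 : 0 < y by rewrite sqrtr_gt0 ltr0n.
have xy : y ^+ 2 = x ^+ 2 + 1 by rewrite !sqr_sqrtr ?ler0n // -natr1.
have xy' : x <= y by rewrite ler_wsqrtr // ler_nat.
suff : y^-1 ^+ 3 <= 2 * (x^-1 - y^-1) by have := IH bm; rewrite -/x; lra.
have -> : 2 * (x^-1 - y^-1) = (2 * y ^+ 2 * (y - x)) / (x * y ^+ 3) by field; rewrite !gt_eqF.
have -> : y^-1 ^+ 3 = x / (x * y ^+ 3) by field; rewrite !gt_eqF.
apply: ler_wpM2r; first by rewrite invr_ge0 mulr_ge0 ?exprn_ge0 ?ltW.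
have e : (y - x) * (y + x) = 1 by rewrite -subr_sqr xy; ring.
have h : 1 <= 2 * y * (y - x) by nra.
apply: le_trans xy' _.
have -> : 2 * y ^+ 2 * (y - x) = y * (2 * y * (y - x)) by ring.
by rewrite ler_peMr // ltW.
Qed.

Context (mu : fps R) (mu_ge0 : 0 <=p mu) (muD : mass (fD mu) 1)
  (s : R) (muDD : mass (fD (fD mu)) s).
Context (T : fps R) (T_ge0 : 0 <=p T) (TE : T = @fX R * Fs mu T).
Local Notation W := (Wd mu).
Context (c0 C0 : R) (c0_gt0 : 0 < c0) (C0_gt0 : 0 < C0) (n0 : nat)
  (Wlo : forall n, (n0 <= n)%N -> c0 / Num.sqrt n%:R <= W n 1)
  (Wup : forall n L, W n L <= C0 / Num.sqrt n.+1%:R).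

Local Notation phi := (phi mu T).
Local Notation wS := (wS mu T).
Local Notation qS := (qS mu T).

(** Multiplying by [phi] keeps C, since the weights c mu(c) have total mass 1, but delays the index
    by one; m records these delays. *)
Definition late_bounded (kap : fps R) (m : nat) C :=
  0 <=p kap /\ forall L n, (T ^+ L * kap) (n + m)%N <= C / Num.sqrt n.+1%:R.

Lemma late_boundedW kap m m' C C' : 0 <= C -> (m <= m')%N -> C <= C' ->
  late_bounded kap m C -> late_bounded kap m' C'.
Proof.
move=> C0' mm CC [k0 h]; split=> // L n.
have -> : (n + m' = (n + (m' - m)) + m)%N by lia.
apply: le_trans (h L _) _; apply: ler_pM => //.
rewrite lef_pV2 ?posrE ?sqrtr_gt0 ?ltr0n //.
by apply: ler_wsqrtr; rewrite ler_nat; lia.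
Qed.

Lemma late_boundedD k k' m C C' : late_bounded k m C -> late_bounded k' m C' ->
  late_bounded (k + k') m (C + C').
Proof.
move=> [k0 h] [k0' h']; split=> [|L n]; first exact: fle0D.
by rewrite mulrDr fpsD mulrDl; apply: lerD.
Qed.

Lemma late_bounded_nat k m C j : late_bounded k m C -> late_bounded (j%:R * k) m (j%:R * C).
Proof.
move=> [k0 h]; split=> [|L n]; first by apply: fle0M => //; exact: fle0n.
by rewrite mulrCA fnM -mulrA; apply: ler_wpM2l.
Qed.

Lemma late_bounded_T k m C : late_bounded k m C -> late_bounded (T * k) m C.
Proof.
move=> [k0 h]; split=> [|L n]; first exact: fle0M.
by rewrite mulrA -exprSr.
Qed.

Lemma late_bounded_step (psi : fps R) (w : nat -> R) D (e : nat -> nat) k m C :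
  0 <=p psi -> (forall c, 0 <= w c) -> (forall n, psum w n <= D) ->
  (forall g n, (psi * g) n.+1 = \sum_(c < n.+3) w c * (T ^+ e c * g) n) -> 0 <= C ->
  late_bounded k m C -> late_bounded (psi * k) m.+1 (D * C).
Proof.
move=> p0 w0 wD pE C0' [k0 h]; split=> [|L n]; first exact: fle0M.
rewrite mulrCA addnS pE -mulrA.
apply: le_trans (_ : psum w (n + m).+3 * (C / Num.sqrt n.+1%:R) <= _).
  rewrite /psum mulr_suml; apply: ler_sum => c _; apply: ler_wpM2l => //.
  by rewrite mulrA -exprD; apply: h.
by apply: ler_wpM2r => //; rewrite divr_ge0 ?sqrtr_ge0.
Qed.

Lemma late_bounded_phi k m C : 0 <= C -> late_bounded k m C -> late_bounded (phi * k) m.+1 C.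
Proof.
move=> C0' h; rewrite -[C]mul1r.
apply: (late_bounded_step (w := fun c => c%:R * mu c) (e := fun c => c.-1)) h => //.
- exact: phi_ge0.
- by move=> c; rewrite mulr_ge0 ?mu_ge0.
- by move=> n; apply: mass_le muD => i; rewrite mulr_ge0 ?mu_ge0.
- by move=> g n; apply: phi_S.
Qed.

Lemma late_bounded_qS k m C : 0 <= C -> late_bounded k m C -> late_bounded (qS * k) m.+1 (s * C).
Proof.
move=> C0' h.
apply: (late_bounded_step (w := fun c => 'C(c, 2)%:R * mu c) (e := fun c => c.-2)) h => //.
- exact: qS_ge0.
- by move=> c; rewrite mulr_ge0 ?mu_ge0.
- move=> n; apply: le_trans (mass_le n _ muDD); last first.
    by move=> i; rewrite !mulr_ge0 ?mu_ge0.
  apply: ler_sum => i _; rewrite /fD mulrA; apply: ler_wpM2r; first exact: mu_ge0.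
  rewrite -natrM ler_nat; elim: (i : nat) => // k' IH; rewrite binS bin1; nia.
- by move=> g n; apply: qS_S.
Qed.

Lemma late_bounded_phiX k m C j : 0 <= C -> late_bounded k m C ->
  late_bounded (phi ^+ j * k) (j + m)%N C.
Proof.
move=> C0' h; elim: j => [|j IH]; first by rewrite expr0 mul1r.
by rewrite exprS -mulrA addSn; apply: late_bounded_phi.
Qed.

Lemma late_bounded_wS : late_bounded wS 0 C0.
Proof. by split=> [|L n]; [exact: wS_ge0|rewrite (TL_wS TE) addn0]. Qed.

Lemma s_ge0 : 0 <= s.
Proof. by apply: mass_ge0 muDD => i; rewrite !mulr_ge0 ?mu_ge0. Qed.

Let C1 := C0 * (1 + s).

Lemma late_bounded_cS j : (0 < j)%N -> late_bounded (cS mu T j) j (j%:R * C1).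
Proof.
have C00 := ltW C0_gt0; have s0 := s_ge0.
case: j => // j _.
have h1 : late_bounded (phi ^+ j.+1 * wS) j.+1 C0.
  by rewrite -[X in late_bounded _ X]addn0; apply: late_bounded_phiX => //; exact: late_bounded_wS.
have h2 : late_bounded (j%:R * (qS * T * wS * phi ^+ j.-1)) j.+1 (j%:R * (s * C0)).
  apply: late_bounded_nat.
  have -> : qS * T * wS * phi ^+ j.-1 = qS * (T * (phi ^+ j.-1 * wS)) by ring.
  apply: (late_boundedW (m := j.-1.+1) (C := s * C0)) => //; [exact: mulr_ge0|lia|].
  apply: late_bounded_qS => //; apply: late_bounded_T.
  by rewrite -[X in late_bounded _ X]addn0; apply: late_bounded_phiX => //; exact: late_bounded_wS.
apply: (late_boundedW (m := j.+1)) (late_boundedD h1 h2) => //.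
  by rewrite addr_ge0 ?mulr_ge0.
have j0 : 0 <= j%:R :> R by rewrite ler0n.
have C0s : 0 <= C0 * s by exact: mulr_ge0.
have jC : 0 <= j%:R * C0 by exact: mulr_ge0.
rewrite /C1 -natr1; nra.
Qed.

(** For 2j <= n the delay j leaves an index of at least n/2, so it only costs the factor 2. *)
Lemma T_cS_le j n : (0 < j)%N -> (2 * j <= n)%N ->
  (T * cS mu T j) n <= 2 * j%:R * C1 / Num.sqrt n%:R.
Proof.
move=> j0 jn; have [_ /(_ 1%N (n - j)%N)] := late_bounded_cS j0.
rewrite expr1 subnK; last by lia.
move=> h; apply: le_trans h _.
have C10 : 0 <= C1 by rewrite mulr_ge0 ?addr_ge0 ?s_ge0 // ltW.
have n0' : 0 < Num.sqrt (n%:R : R) by rewrite sqrtr_gt0 ltr0n; lia.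
have m0 : 0 < Num.sqrt ((n - j).+1%:R : R) by rewrite sqrtr_gt0 ltr0n.
have h : Num.sqrt (n%:R : R) <= 2 * Num.sqrt (n - j).+1%:R.
  rewrite -[leRHS]ger0_norm ?mulr_ge0 ?sqrtr_ge0 // -sqrtr_sqr; apply: ler_wsqrtr.
  rewrite exprMn sqr_sqrtr ?ler0n // -natrX -natrM ler_nat; lia.
rewrite ler_pdivlMr // mulrAC ler_pdivrMr //.
have jC : 0 <= j%:R * C1 by exact: mulr_ge0.
by have := ler_wpM2l jC h; lra.
Qed.

Lemma sum_T_cS_le m n : \sum_(0 <= g < m) (T * cS mu T g.+1) n <= n%:R * W n 1.
Proof.
have := sum_cS_le mu_ge0 T_ge0 TE m n.
rewrite /fD -[T in (T * wS) n]expr1 (TL_wS TE) mulr_sumr fps_sum.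
by rewrite -(big_mkord xpredT (fun g => (T * cS mu T g.+1) n)).
Qed.

(** Three contributions: for 2j <= n, j^(-5/2) against a weight of order j W n 1, which sums to
    b^(-1/2); for 2j > n, j^(-5/2) <= 8 n^(-5/2) against the total weight n W n 1; and the constant
    nu against the same total. *)
Lemma truncation_error (e : nat -> R) (H nu : R) d b m n : (5 <= d)%N ->
  0 <= H -> 0 <= nu -> (0 < b)%N -> (n0 < n)%N -> (1 < n)%N ->
  (forall j, (0 < j)%N -> e j <= H * ((Num.sqrt (j%:R : R))^-1 ^+ d + nu)) ->
  \sum_(b <= g < b + m) e g.+1 * (T * cS mu T g.+1) n <=
    H * (4 * C1 / c0 / Num.sqrt b%:R + 8 / Num.sqrt n%:R + nu * n%:R) * W n 1.
Proof.
move=> d5 H0 nu0 b0 nn0 n1 eH.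
set q := Num.sqrt (n%:R : R).
have q1 : 1 < q by rewrite -[ltLHS]sqrtr1 ltr_sqrt ?ltr0n ?ltr1n //; lia.
have q0 : 0 < q by apply: lt_trans q1.
have qq : q ^+ 2 = n%:R by rewrite sqr_sqrtr.
have Wc : c0 / q <= W n 1 by apply: Wlo; exact: ltnW.
have W0 : 0 < W n 1 by apply: lt_le_trans Wc; rewrite divr_gt0.
have C10 : 0 <= C1 by rewrite mulr_ge0 ?addr_ge0 ?s_ge0 // ltW.
pose t g := (T * cS mu T g.+1) n.
have t0 g : 0 <= t g by apply: fle0M => //; exact: cS_ge0.
pose Kc := 2 * C1 / c0.
have Kc0 : 0 <= Kc by apply: divr_ge0; [exact: mulr_ge0|exact: ltW].
have pt g : e g.+1 * t g <= H * (Kc * (Num.sqrt (g.+1%:R : R))^-1 ^+ 3 * W n 1 +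
    2 ^+ 3 * q^-1 ^+ 5 * t g + nu * t g).
  apply: le_trans (_ : H * ((Num.sqrt (g.+1%:R : R))^-1 ^+ d + nu) * t g <= _).
    by apply: ler_wpM2r => //; apply: eH.
  rewrite -mulrA; apply: ler_wpM2l => //; rewrite mulrDl lerD2r.
  set x := Num.sqrt (g.+1%:R : R).
  have x1 : 1 <= x by rewrite -[leLHS]sqrtr1 ler_wsqrtr // ler1n.
  have x0 : 0 < x by apply: lt_le_trans x1.
  have xx : x ^+ 2 = g.+1%:R by rewrite sqr_sqrtr.
  have xd : x^-1 ^+ d <= x^-1 ^+ 5.
    by apply: ler_wiXn2l => //; [rewrite invr_ge0 ltW|rewrite invf_le1].
  apply: le_trans (ler_wpM2r (t0 g) xd) _.
  have [gn|gn] := leqP (2 * g.+1) n.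
    apply: le_trans (_ : Kc * x^-1 ^+ 3 * W n 1 <= _); last first.
      by rewrite lerDl !mulr_ge0 ?exprn_ge0 ?invr_ge0 // ltW.
    have tg : t g <= 2 * g.+1%:R * C1 / q by apply: T_cS_le.
    have tg' : t g <= Kc * x ^+ 2 * W n 1.
      apply: le_trans tg _; rewrite xx.
      have -> : 2 * g.+1%:R * C1 / q = Kc * g.+1%:R * (c0 / q) by rewrite /Kc; field; rewrite !gt_eqF.
      by apply: ler_wpM2l => //; rewrite mulr_ge0.
    have -> : Kc * x^-1 ^+ 3 * W n 1 = x^-1 ^+ 5 * (Kc * x ^+ 2 * W n 1) by field; rewrite !gt_eqF.
    by apply: ler_wpM2l => //; rewrite exprn_ge0 // invr_ge0 ltW.
  apply: le_trans (_ : 2 ^+ 3 * q^-1 ^+ 5 * t g <= _); last first.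
    by rewrite lerDr mulr_ge0 ?(ltW W0) // mulr_ge0 // exprn_ge0 // invr_ge0 ltW.
  apply: ler_wpM2r => //.
  have qx : q ^+ 2 <= 2 * x ^+ 2 by rewrite qq xx -natrM ler_nat ltnW.
  have q2x : x^-1 <= 2 * q^-1.
    rewrite -(ler_pM2r x0) mulVf ?gt_eqF // mulrAC ler_pdivlMr // mul1r.
    by rewrite -(ler_pXn2r (n := 2)) ?nnegrE ?ltW ?mulr_gt0 //; nra.
  have q2x2 : x^-1 ^+ 2 <= 2 * q^-1 ^+ 2.
    rewrite !exprVn -(ler_pM2r (exprn_gt0 2 x0)) mulVf ?gt_eqF ?exprn_gt0 // mulrAC.
    by rewrite ler_pdivlMr ?exprn_gt0 // mul1r.
  have -> : x^-1 ^+ 5 = x^-1 ^+ 2 * x^-1 ^+ 2 * x^-1 by ring.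
  have -> : 2 ^+ 3 * q^-1 ^+ 5 = 2 * q^-1 ^+ 2 * (2 * q^-1 ^+ 2) * (2 * q^-1) by ring.
  have xi0 : 0 <= x^-1 by rewrite invr_ge0 ltW.
  by apply: ler_pM => //; [rewrite mulr_ge0 ?exprn_ge0|apply: ler_pM; rewrite ?exprn_ge0].
apply: le_trans (ler_sum _ (fun g _ => pt g)) _.
rewrite -mulr_sumr -mulrA; apply: ler_wpM2l => //.
rewrite !big_split /= -!mulr_suml -!mulr_sumr.
have st : \sum_(b <= g < b + m) t g <= n%:R * W n 1.
  apply: le_trans (sum_T_cS_le (b + m) n); rewrite [leRHS](big_cat_nat (n := b)) ?leq_addr //=.
  by rewrite lerDr; apply: sumr_ge0 => g _; apply: t0.
rewrite [leRHS]mulrDl [X in _ <= X + _]mulrDl; apply: lerD; first apply: lerD.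
- apply: ler_wpM2r; first exact: ltW.
  have -> : 4 * C1 / c0 / Num.sqrt b%:R = Kc * (2 / Num.sqrt b%:R).
    by rewrite /Kc; field; rewrite !gt_eqF // sqrtr_gt0 ltr0n.
  apply: ler_wpM2l => //; apply: le_trans (sum_inv_sqrt3 b0 (leq_addr _ _)) _.
  by apply: ler_wpM2l => //; rewrite gerBl invr_ge0 sqrtr_ge0.
- apply: le_trans (ler_wpM2l _ st) _.
    by rewrite mulr_ge0 ?exprn_ge0 ?invr_ge0 // ltW.
  rewrite mulrA; apply: ler_wpM2r; first exact: ltW.
  rewrite -qq; have -> : 2 ^+ 3 * q^-1 ^+ 5 * q ^+ 2 = 8 / q * (q^-1 ^+ 2) by field; rewrite gt_eqF.
  have qi0 : 0 <= q^-1 by rewrite invr_ge0 ltW.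
  have qi1 : q^-1 <= 1 by rewrite invf_le1 // ltW.
  by rewrite ler_piMr ?mulr_ge0 // exprn_ile1.
- by rewrite -mulrA; apply: ler_wpM2l.
Qed.

End Error.

(** * From the torus to the lattice *)

Section Project.
Context (R : realType) (mu : nat -> R) (T : fps R) (I : eqType) (r : seq I) (th : I -> R)
  (V V' : zmodType) (io : I -> V) (io' : I -> V') (ph : V -> V')
  (phD : forall x z, ph (x + io z) = ph x + io' z) (A : pred V) (A' : pred V').

(** Along all paths of at most b steps from x, membership in A and in A' coincide; this is all that
    [SpS b] can see. *)
Fixpoint agree b x : Prop :=
  if b is b'.+1 then
    forall z, z \in r -> A' (ph (x + io z)) = A (x + io z) /\ agree b' (x + io z)
  else True.

Lemma Tf_agree (f : V -> fps R) (f' : V' -> fps R) x :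
  (forall z, z \in r -> A' (ph (x + io z)) = A (x + io z) /\
     f' (ph (x + io z)) = f (x + io z)) ->
  Tf r th io' (kill A' f') (ph x) = Tf r th io (kill A f) x.
Proof.
move=> h; apply: eq_big_seq => z zr; rewrite /kill -phD.
by have [-> ->] := h z zr.
Qed.

Lemma alphaS_agree b x : agree b x ->
  alphaS mu T r th io' A' b (ph x) = alphaS mu T r th io A b x.
Proof.
elim: b x => // b IH x ag; apply: Tf_agree => z zr; have [eA ag'] := ag z zr.
split; [exact: eA|exact: (congr1 (fun a => fX R * Fs mu a) (IH _ ag'))].
Qed.

Lemma SpS_agree b x : agree b x ->
  SpS mu T r th io' A' b (ph x) = SpS mu T r th io A b x.
Proof.
elim: b x => // b IH x ag; congr (1 + _).
apply: (Tf_agree (f := fun p => fX R * Ks mu T (alphaS mu T r th io A b p) * SpS mu T r th io A b p)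
  (f' := fun p => fX R * Ks mu T (alphaS mu T r th io' A' b p) * SpS mu T r th io' A' b p)) => z zr.
have [eA ag'] := ag z zr; split=> //.
by have h1 := IH _ ag'; have h2 := alphaS_agree ag'; rewrite h1 h2.
Qed.

End Project.

Section Eventually.

Lemma eventually_seq (T : eqType) (s : seq T) (Q : T -> nat -> Prop) :
  (forall x, x \in s -> exists N0, forall N, (N0 <= N)%N -> Q x N) ->
  exists N0, forall N, (N0 <= N)%N -> forall x, x \in s -> Q x N.
Proof.
elim: s => [|y s IH] h; first by exists 0%N.
have [N1 h1] := h y (mem_head _ _).
have [|N2 h2] := IH; first by move=> x xs; apply: h; rewrite inE xs orbT.
exists (maxn N1 N2) => N; rewrite geq_max => /andP[n1 n2] x.
by rewrite inE => /orP[/eqP ->|]; [apply: h1|apply: h2].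
Qed.

Lemma intr_Zp_eq0 N (z : int) : (1 < N)%N -> z%:~R = 0 :> 'Z_N -> (N %| absz z)%N.
Proof.
move=> N1; have h n : n%:R = 0 :> 'Z_N -> (N %| n)%N.
  by move=> /(congr1 (@nat_of_ord _)); rewrite val_Zp_nat // /dvdn => ->.
case: z => n; first by rewrite -pmulrn; apply: h.
by rewrite NegzE mulrNz -pmulrn => /eqP; rewrite oppr_eq0 => /eqP; apply: h.
Qed.

Lemma torus_proj_neq d (x y : 'rV[int]_d) : x != y ->
  exists N0, forall N, (N0 <= N)%N -> torus_proj N x != torus_proj N y.
Proof.
move=> xy; have [j xyj] : exists j, x 0 j != y 0 j.
  apply/existsP; apply: contraNT xy => /existsPn h; apply/eqP/rowP => j.
  by apply/eqP; have := h j; rewrite negbK.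
exists (absz (x 0%R j - y 0%R j)).+2 => N hN; apply: contraNN xyj => /eqP /rowP /(_ j).
rewrite !mxE => /eqP; rewrite -subr_eq0 -mulrzBr => /eqP /intr_Zp_eq0 h.
rewrite -subr_eq0 -absz_eq0; apply/negPn/negP => xy0.
have := dvdn_leq _ (h _); rewrite lt0n xy0 => /(_ isT); lia.
Qed.

Context (d : nat) (K : {fset 'rV[int]_d}).
Local Notation KK N := [fset torus_proj N y | y in K]%fset.

Lemma eventually_mem y :
  exists N0, forall N, (N0 <= N)%N -> (torus_proj N y \in KK N) = (y \in K).
Proof.
case: (boolP (y \in K)) => yK; first by exists 0%N => N _; apply: in_imfset.
have [x xK|N0 h] := @eventually_seq _ K (fun x N => torus_proj N y != torus_proj N x).
  by apply: torus_proj_neq; apply: contraNneq yK => ->.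
exists N0 => N /h hN; apply/negP => /imfsetP[x /= xK yx].
by have := hN x xK; rewrite yx eqxx.
Qed.

Lemma eventually_inj :
  exists N0, forall N, (N0 <= N)%N -> {in K &, injective (@torus_proj d N)}.
Proof.
have [[x y] _|N0 h] := @eventually_seq _ [seq (x, y) | x <- K, y <- K]
    (fun xy N => torus_proj N xy.1 = torus_proj N xy.2 -> xy.1 = xy.2).
  have [->|/torus_proj_neq[N0 h]] := eqVneq x y; first by exists 0%N.
  by exists N0 => N /h /eqP.
exists N0 => N /h hN x y xK yK; apply: (hN (x, y)).
by apply/allpairsP; exists (x, y).
Qed.

Lemma eventually_agree (r : seq 'rV[int]_d) b x :
  exists N0, forall N, (N0 <= N)%N ->
    agree r id (@torus_proj d N) (fun y => y \in K) [pred y | y \in KK N] b x.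
Proof.
elim: b x => [|b IH] x; first by exists 0%N.
apply: (eventually_seq (s := r) (Q := fun z N => [pred y | y \in KK N] (torus_proj N (x + id z)) = (x + id z \in K) /\
   agree r id (@torus_proj d N) (fun y => y \in K) [pred y | y \in KK N] b (x + id z))).
move=> z _; have [N1 h1] := eventually_mem (x + z); have [N2 h2] := IH (x + z).
exists (maxn N1 N2) => N; rewrite geq_max => /andP[n1 n2]; split; [exact: h1|exact: h2].
Qed.

End Eventually.

Lemma card_torus d N : (1 < N)%N -> #|{: torus d N}| = (N ^ d)%N.
Proof. by move=> N1; rewrite card_mx card_ord mul1n Zp_cast. Qed.

Lemma torus_projD d N (x y : 'rV[int]_d) :
  torus_proj N (x + y) = torus_proj N x + torus_proj N y.
Proof. by apply/rowP => j; rewrite !mxE mulrzDr. Qed.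

Lemma torus_projN d N (x : 'rV[int]_d) : torus_proj N (- x) = - torus_proj N x.
Proof. by apply/rowP => j; rewrite !mxE mulrNz. Qed.

Lemma powR_large (R : realType) (be A : R) : 0 < be ->
  exists N0, forall N, (N0 <= N)%N -> A <= N%:R `^ be.
Proof.
move=> be0; pose B := Num.max A 0; have B0 : 0 <= B by rewrite le_max lexx orbT.
have [N0 hN0] : exists N0 : nat, B `^ be^-1 <= N0%:R.
  by exists (Num.bound (B `^ be^-1)); rewrite ltW // archi_boundP ?powR_ge0.
exists N0 => N NN; apply: (@le_trans _ _ B); first by rewrite le_max lexx.
have be1 : be != 0 by rewrite gt_eqF.
have -> : B = (B `^ be^-1) `^ be by rewrite -powRrM mulVf // powRr1.
apply: ge0_ler_powR; rewrite ?nnegrE ?powR_ge0 ?ler0n //; first exact: ltW.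
by apply: le_trans hN0 _; rewrite ler_nat.
Qed.

Section HeatSum.
Context (R : realType) (I : eqType) (r : seq I) (th : I -> R) (V : zmodType) (io : I -> V).

Lemma EA_sum (S : seq V) j y : uniq S ->
  EA r th io (fun y => y \in S) j y = \sum_(a <- S) EA r th io (pred1 a) j y.
Proof.
move=> uS; elim: j y => [|j IH] y.
  rewrite /EA /=; case: (boolP (y \in S)) => yS.
    rewrite (bigD1_seq y) //= eqxx big1 ?addr0 // => a ay.
    by rewrite eq_sym (negbTE ay).
  rewrite big_seq big1 // => a aS; case: eqP => // ya.
  by move: yS; rewrite ya aS.
rewrite /EA /= -/(EA _ _ _ _ _) /Tr exchange_big; apply: eq_bigr => z _.
by rewrite -mulr_sumr -IH.
Qed.

End HeatSum.

Lemma cvg_sum_seq (R : realType) (I : Type) (s : seq I) (F : I -> nat -> R) (l : I -> R) :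
  (forall i, F i @ \oo --> l i) ->
  (fun n => \sum_(i <- s) F i n) @ \oo --> \sum_(i <- s) l i.
Proof.
move=> h; elim: s => [|i s IH].
  rewrite big_nil (_ : (fun _ => _) = fun=> 0); first exact: cvg_cst.
  by apply/funext => n; rewrite big_nil.
rewrite big_cons (_ : (fun _ => _) = F i \+ (fun n => \sum_(j <- s) F j n)).
  by apply: cvgD; [exact: h|exact: IH].
by apply/funext => n; rewrite big_cons.
Qed.

(** * The hitting probability compared with the series on the lattice *)

Section Assembly.
Context (R : realType) (d : nat) (mu : nat -> R) (hmu : offspring_law mu)
  (theta : 'rV[int]_d -> R) (hth : step_law theta) (K : {fset 'rV[int]_d}).

Local Notation sl := (step_support theta).
Local Notation T := (Tser mu).
Local Notation W := (Wd mu).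
Local Notation KK N := [fset torus_proj N y | y in K]%fset.
Local Notation AN N := [pred y : torus d N | y \in KK N].
Local Notation al N := (alser mu (@torus_step R d N theta) (AN N)).
Local Notation Sxt N := (SxS mu T sl theta (@torus_proj d N) (AN N) (al N)).
Local Notation Spz := (SpS mu T sl theta id (fun y => y \in K)).

Let mu_ge0 : forall c, 0 <= mu c. Proof. exact: offspring_ge0. Qed.
Let th_ge0 : forall z, 0 <= theta z. Proof. exact: step_ge0. Qed.
Let th_sum := step_support_sum hth.
Let sl_uniq := step_support_uniq theta.
Let sl_supp := step_support0 hth.

Lemma torus_sym N (f : torus d N -> R) y :
  \sum_(z <- sl) theta z * f (y - torus_proj N z) =
  \sum_(z <- sl) theta z * f (y + torus_proj N z).
Proof.
have := step_support_sym hth (fun z => f (y + torus_proj N z) : R^o).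
by under eq_bigr do rewrite torus_projN.
Qed.

Lemma torus_sym_fps N (f : torus d N -> fps R) y :
  \sum_(z <- sl) fC (theta z) * f (y - torus_proj N z) =
  \sum_(z <- sl) fC (theta z) * f (y + torus_proj N z).
Proof.
apply/funext => k; rewrite !fps_sum.
under eq_bigr do rewrite fCM; under [RHS]eq_bigr do rewrite fCM.
exact: (torus_sym (fun y => f y k)).
Qed.

Lemma sum_KK N (F : torus d N -> R) : {in K &, injective (@torus_proj d N)} ->
  \sum_(y | AN N y) F y = \sum_(x <- K) F (torus_proj N x).
Proof.
move=> inj.
have <- : \sum_(y <- KK N) F y = \sum_(x <- K) F (torus_proj N x) by rewrite big_imfset.
by rewrite big_uniq ?fset_uniq.
Qed.

(** N^d cancels the uniform law of the root, and 1/n turns the division by the coefficient of T into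
    one by n T n = W n 1. *)
Lemma hit_prob_SxS N n M : (1 < N)%N -> (0 < n)%N -> (n < M)%N -> W n 1 != 0 ->
  N%:R ^+ d / n%:R * hit_prob mu theta n N K =
  (\sum_(y | AN N y) (T * Sxt N M y) n) / W n 1.
Proof.
case: n => // n N1 _ nM W0.
rewrite (hit_prob_series mu N sl_uniq sl_supp th_sum) card_torus //.
rewrite (@HitS_duality _ _ _ (TserE mu) _ sl theta th_sum _ (@torus_proj d N) (AN N) _ (al N) _ M) //; last 2 first.
- exact: torus_sym_fps.
- by apply: alserE; apply: torus_step_sum.
rewrite -(T_Wd (TserE mu)) natrX in W0 *.
have Nd0 : N%:R ^+ d != 0 :> R by rewrite expf_neq0 // pnatr_eq0; lia.
have n0 : n.+1%:R != 0 :> R by rewrite pnatr_eq0.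
have T0 : T n.+1 != 0 by apply: contraNneq W0 => ->; rewrite mulr0.
move: (\sum_(y | _) _) => S; move: (T n.+1) (n.+1%:R : R) (N%:R ^+ d : R) T0 n0 Nd0 => t a c t0 a0 c0.
by field; rewrite t0 a0 c0.
Qed.

Lemma SxS_near b m N n x CE : (1 < N)%N -> (n < b + m)%N ->
  agree sl id (@torus_proj d N) (fun y => y \in K) (AN N) b x ->
  {in K &, injective (@torus_proj d N)} ->
  (forall (a y : torus d N) j, (0 < j)%N ->
     EA sl theta (@torus_proj d N) (pred1 a) j y <=
       CE * ((Num.sqrt (j%:R : R))^-1 ^+ d + N%:R ^- d)) ->
  exists2 e : nat -> R, (forall j, (0 < j)%N ->
      e j <= (size K)%:R * CE * ((Num.sqrt (j%:R : R))^-1 ^+ d + N%:R ^- d)) &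
    0 <= (T * Spz b x) n - (T * Sxt N (b + m) (torus_proj N x)) n <=
      \sum_(b <= g < b + m) e g.+1 * (T * cS mu T g.+1) n.
Proof.
move=> N1 nm ag inj hE.
have h := SpS_agree mu T theta (io := id) (io' := @torus_proj d N) (@torus_projD d N) ag.
(* The probability of being in phi(K) at time j, summed over its points, which the injectivity of
   the projection on K matches with those of K. *)
exists (fun j => EA sl theta (@torus_proj d N) (AN N) j (torus_proj N x)) => [j j0|].
  rewrite (_ : (fun y => y \in KK N) = AN N) // EA_sum ?fset_uniq // big_imfset //=.
  apply: le_trans (ler_sum _ (fun a _ => hE (torus_proj N a) (torus_proj N x) j j0)) _.
  rewrite big_const_seq count_predT iter_addr_0 -[leLHS]mulr_natl mulrA; exact: lexx.
have p0 := torus_step_ge0 (N := N) sl_uniq sl_supp th_ge0.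
have p1 := torus_step1 N sl_uniq sl_supp th_sum.
rewrite -h; apply/andP; split.
  rewrite subr_ge0; apply: fleM2l; first exact: Tser_ge0.
  apply: (SxS_le_SpS mu_ge0 (Tser_ge0 mu_ge0) (TserE mu) th_ge0 th_sum).
  - exact: alser_ge0.
  - exact: alser_le.
  - by apply: alserE; apply: torus_step_sum.
rewrite -fpsB -mulrBr.
apply: (SpS_coef_err mu_ge0 (Tser_ge0 mu_ge0) (TserE mu) th_ge0 th_sum) => //.
- exact: alser_ge0.
- exact: alser_le.
- by apply: alserE; apply: torus_step_sum.
Qed.

End Assembly.

Theorem theorem15 (R : realType) (d : nat) (hd : (5 <= d)%N)
  (mu : nat -> R) (hmu : offspring_law mu)
  (theta : 'rV[int]_d -> R) (htheta : step_law theta)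
  (disp : measure_display) (Omega : measurableType disp)
  (P : probability Omega R) (E : branching_env P mu theta)
  (alpha1 alpha2 : R)
  (h1 : 0 < alpha1) (h12 : alpha1 < alpha2) (h2 : alpha2 < d%:R)
  (n : nat -> nat)
  (hn : \forall N \near \oo,
     N%:R `^ alpha1 <= (n N)%:R /\ (n N)%:R <= N%:R `^ alpha2)
  (K : {fset 'rV[int]_d}) :
  (fun N : nat => N%:R ^+ d / (n N)%:R * hit_prob mu theta (n N) N K) @ \oo
    --> BCap E K.
Proof.
have mu_ge0 : 0 <=p (mu : fps R) := offspring_ge0 hmu.
have mu1 := offspring_mass hmu; have muD := offspring_massD hmu.
have [s muDD] := offspring_massDD hmu; have mu0 := offspring_mu0 hmu.
have [r r0 [a [a0 a1 a2]]] := consecutive_atoms hmu.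
have [c0 c0_gt0 [n0 Wlo]] := Wd_lower mu_ge0 mu1 muD muDD mu0 r0 a0 a1 a2.
have [C0 C0_gt0 Wup] := Wd_upper mu_ge0 mu1 r0 a0 a1 a2.
have Wra := Wd_ratio mu_ge0 mu1 muD muDD mu0 r0 a0 a1 a2.
have th_ge0 := step_ge0 htheta; have th_sum := step_support_sum htheta.
have [M [Ms Mth detM]] := step_basis htheta.
have [CE CE0 hE] := EA_bound th_ge0 th_sum Ms Mth detM (leq_trans (isT : 0 < 5)%N hd).
have T_ge0 := Tser_ge0 mu_ge0; have TE := TserE mu.
pose sl := step_support theta; pose T := Tser mu.
pose A0 := fun y : 'rV[int]_d => y \in K.
pose Spz := SpS mu T sl theta id A0.
pose k : R := (size K)%:R; have k0 : 0 <= k by rewrite ler0n.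
have esc_lim : (fun b => \sum_(x <- K) GS (mu : fps R) sl theta id A0 b x) @ \oo --> BCap E K.
  apply: (cvg_sum_seq (F := fun x b => GS (mu : fps R) sl theta id A0 b x)) => x.
  exact: (escape_prob_lim (step_support_uniq _) (step_support0 htheta) mu_ge0 mu1 muD th_ge0 th_sum).
have Spz_lim b : (fun m => \sum_(x <- K) ((T * Spz b x) m / Wd mu m 1)) @ \oo -->
    \sum_(x <- K) GS (mu : fps R) sl theta id A0 b x.
  apply: (cvg_sum_seq (F := fun x m => (T * Spz b x) m / Wd mu m 1)) => x.
  exact: (SpS_lim mu_ge0 mu1 muD T_ge0 TE c0_gt0 C0_gt0 Wlo Wup Wra th_ge0 th_sum).
apply/cvgrPdist_le => e e0.
(* One factor k comes from the sum over x in K, the other from the sum over the points of phi(K) in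
   the heat kernel bound. *)
pose H := k * (k * CE) * (4 * (C0 * (1 + s)) / c0).
pose H' := k * (k * CE).
(* Five shares of e: the truncation of the escape probabilities at b, the limit in n for this b, and
   the three terms of [truncation_error]. *)
have e5 : 0 < e / 5 by rewrite divr_gt0.
have inv0 := @cvg_inv_sqrt R.
have [b1 _ hb1] := (cvgrPdist_le (FF := eventually_filter) _ _).1 esc_lim _ e5.
have small (x : R) : exists m0 : nat, forall m, (m0 <= m)%N -> x / Num.sqrt m%:R <= e / 5.
  have h : (fun m : nat => x / Num.sqrt (m%:R : R)) @ \oo --> (0 : R).
    by rewrite -(mulr0 x); apply: cvgMr.
  have [m0 _ hm0] := (cvgrPdist_le (FF := eventually_filter) _ _).1 h _ e5.
  exists m0 => m /hm0 /=; rewrite sub0r normrN; apply: le_trans; exact: ler_norm.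
have [b2 hb2] := small H; have [m1 hm1] := small (H' * 8).
(* b is fixed before n and N, so the thresholds m2 and N2 below may depend on it; the 1 makes b
   positive. *)
pose b := maxn (maxn b1 b2) 1.
have [m2 _ hm2] := (cvgrPdist_le (FF := eventually_filter) _ _).1 (Spz_lim b) _ e5.
have [N1 hN1] := eventually_inj K.
have [N2 hN2] := @eventually_seq _ K (fun x N => agree sl id (@torus_proj d N) A0
   [pred y | y \in [fset torus_proj N y | y in K]%fset] b x) (fun x _ => eventually_agree K sl b x).
have [N3 _ hN3] := hn.
(* All conditions on the size n; they hold for large N because n >= N^alpha1. *)
pose mm := maxn (maxn m1 m2) (maxn n0.+1 2).
have [N4 hN4] := powR_large (mm%:R : R) h1.
have be0 : 0 < d%:R - alpha2 by rewrite subr_gt0.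
have [N5 hN5] := powR_large (H' / (e / 5)) be0.
exists (maxn (maxn (maxn N1 N2) (maxn N3 N4)) (maxn N5 2)) => // N /=.
rewrite !geq_max => /andP[/andP[/andP[NN1 NN2] /andP[NN3 NN4]] /andP[NN5 Ngt1]].
have [nlo nup] := hN3 N NN3.
have nm : (mm <= n N)%N by rewrite -(ler_nat R); apply: le_trans nlo; exact: hN4.
move: nm; rewrite !geq_max => /andP[/andP[nm1 nm2] /andP[nn0 n2]].
have W0 : 0 < Wd mu (n N) 1.
  by apply: lt_le_trans (Wlo _ (ltnW nn0)); rewrite divr_gt0 // sqrtr_gt0 ltr0n ltnW.
(* b + n + 1 exceeds n, so the exact series has stabilised at degree n, and it has the form b + m
   used in the comparison with [SpS b]. *)
rewrite (@hit_prob_SxS _ _ mu _ htheta K N (n N) (b + (n N).+1)) //; [|exact: ltnW|by rewrite addnS ltnS leq_addl|by rewrite gt_eqF].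
rewrite (sum_KK _ (hN1 N NN1)) mulr_suml.
set nN := n N in nlo nup nm1 nm2 nn0 n2 W0 *.
pose Er := k * CE * (4 * (C0 * (1 + s)) / c0 / Num.sqrt b%:R + 8 / Num.sqrt nN%:R + N%:R ^- d * nN%:R).
pose hS x := (T * SxS mu T sl theta (@torus_proj d N) [pred y | y \in [fset torus_proj N y | y in K]%fset]
  (alser mu (@torus_step R d N theta) [pred y | y \in [fset torus_proj N y | y in K]%fset])
  (b + nN.+1) (torus_proj N x)) nN.
have near_x x : x \in K -> 0 <= (T * Spz b x) nN / Wd mu nN 1 - hS x / Wd mu nN 1 <= Er.
  move=> xK; have bn : (nN < b + nN.+1)%N by rewrite addnS ltnS leq_addl.
  have [ee ele /andP[lo up]] := SxS_near hmu htheta Ngt1 bn (hN2 N NN2 x xK) (hN1 N NN1)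
    (hE N Ngt1 (@torus_sym _ _ _ htheta N)).
  rewrite -mulrBl; apply/andP; split; first by rewrite divr_ge0 // ltW.
  rewrite ler_pdivrMr //; apply: le_trans up _.
  have kC0 : 0 <= k * CE by rewrite mulr_ge0 // ltW.
  have Nd0 : 0 <= N%:R ^- d :> R by rewrite invr_ge0 exprn_ge0.
  have b0 : (0 < b)%N by rewrite /b leq_max orbT.
  exact: (truncation_error mu_ge0 muD muDD T_ge0 TE c0_gt0 C0_gt0 Wlo Wup nN.+1 hd kC0 Nd0 b0 nn0 n2 ele).
have kEr : k * Er <= 3 * (e / 5).
  have t1 : H / Num.sqrt b%:R <= e / 5 by apply: hb2; rewrite /b !leq_max leqnn orbT.
  have t2 : H' * 8 / Num.sqrt nN%:R <= e / 5 by apply: hm1.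
  have H'0 : 0 <= H' by rewrite !mulr_ge0 // ltW.
  (* n N^(-d) is at most N^(alpha2 - d), made small by the choice of N5. *)
  have t3 : H' * (N%:R ^- d * nN%:R) <= e / 5.
    have Nd : 0 < N%:R ^+ d :> R by rewrite exprn_gt0 // ltr0n ltnW.
    rewrite mulrA mulrAC ler_pdivrMr //.
    apply: le_trans (ler_wpM2l H'0 nup) _.
    have -> : N%:R ^+ d = N%:R `^ (d%:R - alpha2) * N%:R `^ alpha2 :> R.
      rewrite -powRD ?subrK ?powR_mulrn ?ler0n //; apply/implyP => _.
      by rewrite pnatr_eq0 -lt0n ltnW.
    rewrite mulrA; apply: ler_wpM2r; first exact: powR_ge0.
    by rewrite -ler_pdivrMl // mulrC; exact: hN5.
  have -> : k * Er = H / Num.sqrt b%:R + H' * 8 / Num.sqrt nN%:R + H' * (N%:R ^- d * nN%:R).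
    by rewrite /Er /H /H'; ring.
  lra.
have sum_lo : 0 <= \sum_(x <- K) ((T * Spz b x) nN / Wd mu nN 1) - \sum_(x <- K) hS x / Wd mu nN 1.
  rewrite -sumrB big_seq; apply: sumr_ge0 => x xK.
  by have /andP[] := near_x x xK.
have sum_up : \sum_(x <- K) ((T * Spz b x) nN / Wd mu nN 1) - \sum_(x <- K) hS x / Wd mu nN 1 <= k * Er.
  have -> : k * Er = \sum_(x <- K) Er.
    by rewrite big_const_seq count_predT iter_addr_0 -[RHS]mulr_natl.
  rewrite -sumrB big_seq [leRHS]big_seq; apply: ler_sum => x xK.
  by have /andP[] := near_x x xK.
have bb1 : (b1 <= b)%N by rewrite /b !leq_max leqnn.
have := hb1 b bb1; have := hm2 nN nm2; rewrite /= => d1 d2.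
move: d1 d2 sum_lo sum_up; rewrite -/(BCap E K) !ler_norml => /andP[? ?] /andP[? ?] ? ?.
by apply/andP; split; rewrite /hS; lra.
Qed.
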